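(* Let $k>1$ be an integer and let $G=G(2k,2,2)$ acting on $V=\mathbb{C}^2$ with coordinates $(u,v)$. Its degrees are $d_1=d_2=2k$, so the space $\mathcal{X}_{-d_1}$ of polynomial vector fields on $M_G=\mathrm{Spec}\,\mathbb{C}[V]^G$ of degree $-d_1$ is two-dimensional, spanned by $\partial_x,\partial_y$ where $x=u^{2k}+v^{2k}$, $y=u^kv^k$. There exist exactly three lines $l_1,l_2,l_3\subset\mathcal{X}_{-d_1}$ such that, for nonzero $e\in\mathcal{X}_{-d_1}$, the vector field $e$ and the connection $\boldsymbol{\nabla}^V$ make a natural almost Saito structure for $G$ if and only if $e\in l_1\cup l_2\cup l_3$; they are spanned by $\partial_x$, $-2\partial_x+\partial_y$ and $-2\partial_x-\partial_y$. These natural almost Saito structures are the ones induced by branched covering maps $\pi:M_K\to M_G$ from the orbit spaces of the following duality groups $K$: $K=G(2k,2k,2)\subset G$ for $\partial_x$; $K=G(k,1,2)\subset G$ for $-2\partial_x+\partial_y$; and $K=\tau^{-1}G(k,1,2)\,\tau\subset G$ with $\tau=\mathrm{diag}(e^{2\pi i/2k},1)$ for $-2\partial_x-\partial_y$.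
   Context: $G(m,p,n)$ ($p\mid m$) is the group of $n\times n$ monomial matrices whose nonzero entries $\theta_1,\dots,\theta_n$ are $m$-th roots of unity with $(\theta_1\cdots\theta_n)^{m/p}=1$. A duality group is an irreducible finite complex reflection group of rank $n$ generated by $n$ reflections. For a finite complex reflection group $G$ on $V=\mathbb{C}^n$ with degrees $d_1\ge\dots\ge d_n$ and basic invariants $x^1,\dots,x^n$ (homogeneous generators of $\mathbb{C}[V]^G$): $M_G=\mathrm{Spec}\,\mathbb{C}[V]^G$; $M_{G,0}$ is the complement of the image of the union of the reflection hyperplanes of $G$; $E_{\mathrm{deg}}=\sum_\alpha d_\alpha x^\alpha\partial_{x^\alpha}$; $\boldsymbol{\nabla}^V$ is the connection on $TM_{G,0}$ induced from the trivial connection on $TV$ via the orbit map. Almost Saito structure on a complex manifold $N$ with parameter $r\in\mathbb{C}$: a triple $(\boldsymbol{\nabla},\star,e)$ of a torsion-free flat connection on $TN$, an associative commutative $\mathcal{O}_N$-bilinear multiplication $\star$ on $TN$ with unit vector field $E$, and a nonzero vector field $e$, such that for local vector fields $x,y,z$: (ASS1) $\boldsymbol{\nabla}_x(y\star z)-y\star\boldsymbol{\nabla}_xz-\boldsymbol{\nabla}_y(x\star z)+x\star\boldsymbol{\nabla}_yz=[x,y]\star z$; (ASS2) $[e,x\star y]-[e,x]\star y-x\star[e,y]+e\star x\star y=0$; (ASS3) $\boldsymbol{\nabla}_xE=rx$; (ASS4) $\boldsymbol{\nabla}_x\boldsymbol{\nabla}_ye-\boldsymbol{\nabla}_{\boldsymbol{\nabla}_xy}e+\boldsymbol{\nabla}_{x\star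 y}e=0$. Natural almost Saito structure for $G$: an almost Saito structure $(\boldsymbol{\nabla},\star,e)$ on $M_{G,0}$ with $\boldsymbol{\nabla}=\boldsymbol{\nabla}^V$, unit of $\star$ equal to $\frac{1}{d_1}E_{\mathrm{deg}}$ (hence $r=\frac1{d_1}$), and $e$ a nonzero polynomial vector field on $M_G$ of degree $-d_1$ (grading $\deg x^\alpha=d_\alpha$). Induced structures: if $K\subset G$ is a normal reflection subgroup, $\pi:M_K\to M_G$ restricts over $M_{G,0}$ to an unramified Galois covering with group $G/K$; a $G/K$-invariant almost Saito structure on $\pi^{-1}(M_{G,0})$ induces (by pushing forward along local inverses of $\pi$) an almost Saito structure on $M_{G,0}$. A duality group $K$ has a natural almost Saito structure, unique up to scaling of its vector field $e$; ''induced by $\pi$'' means induced from its restriction. *)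

(* Defs.v *)
From HB Require Import structures.
From mathcomp Require Import all_boot all_order all_algebra perm.
From mathcomp Require Import boolp classical_sets functions cardinality reals.
From mathcomp Require Import topology normedtype derive trigo.
From mathcomp Require Import complex.
(* The notations of mpoly clash with those of MathComp-Analysis:
   [mpoly n C] below is the ring C[X_0, ..., X_(n-1)], [comp_mpoly x q] is the
   composite q(x_0, ..., x_(n-1)), and [meval v q] is the value of q at v. *)
From mathcomp Require Import -(notations) mpoly.

Set Implicit Arguments.
Unset Strict Implicit.
Unset Printing Implicit Defensive.

Import Order.TTheory GRing.Theory Num.Theory.
Import numFieldNormedType.Exports.

Local Open Scope classical_set_scope.
Local Open Scope ring_scope.

(* The scalar field is generic here; the complex numbers are R[i] for
   R : realType.  V = C^(n+1) is the space of column vectors, on which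
   matrices act on the left. *)

Section MatrixGroups.
Variables (C : numFieldType) (n : nat).
Implicit Types (G K S : set 'M[C]_n.+1) (A B : 'M[C]_n.+1).

Definition is_group G : Prop :=
  [/\ G 1%:M,
      forall A B, G A -> G B -> G (A *m B) &
      forall A, G A -> A \in unitmx /\ G (invmx A)].

Definition normal_subgroup K G : Prop :=
  [/\ is_group K, is_group G, K `<=` G &
      forall A B, G A -> K B -> K (A *m B *m invmx A)].

(* For elements of a finite group: A fixes a hyperplane pointwise, A != 1. *)
Definition is_reflection A : bool := \rank (A - 1%:M) == 1%N.

(* Subspaces are row spaces of matrices W, hence the transpose of A. *)
Definition irreducible_group G : Prop :=
  forall W : 'M[C]_n.+1, (forall A, G A -> stablemx W A^T) ->
    \rank W = 0%N \/ \rank W = n.+1.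

Definition generated_by S G : Prop :=
  [/\ is_group G, S `<=` G & forall H, is_group H -> S `<=` H -> G `<=` H].

Definition duality_group G : Prop :=
  [/\ finite_set G, irreducible_group G &
      exists s : 'I_n.+1 -> 'M[C]_n.+1,
        (forall i, is_reflection (s i)) /\ generated_by (range s) G].

Definition reflection_hyperplanes G : set 'cV[C]_n.+1 :=
  [set v | exists A, [/\ G A, is_reflection A & A *m v = v]].

End MatrixGroups.

(* G(m,p,n), for p dividing m: diagonal matrix times permutation matrix. *)
Definition Gmpn (C : numFieldType) (m p n : nat) : set 'M[C]_n :=
  [set A | exists (theta : 'I_n -> C) (s : 'S_n),
    [/\ forall i, theta i ^+ m = 1,
        (\prod_i theta i) ^+ (m %/ p) = 1 &
        A = diag_mx (\row_i theta i) *m perm_mx s]].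
Arguments Gmpn C (m p n)%_nat_scope : clear implicits.

Section Invariants.
Variables (C : numFieldType) (n : nat).
Local Notation V := 'cV[C]_n.+1.
Local Notation poly := (mpoly n.+1 C).
Implicit Types (G : set 'M[C]_n.+1) (x : n.+1.-tuple poly)
  (d : n.+1.-tuple nat).

Definition pval (q : poly) (v : V) : C := meval (fun i => v i 0) q.

Definition poly_map x (v : V) : V := \col_i pval (tnth x i) v.

Definition invariant_poly G (q : poly) : Prop :=
  forall A, G A -> forall v : V, pval q (A *m v) = pval q v.

(* x consists of n+1 algebraically independent homogeneous generators of the
   ring of invariants, of degrees d_0 >= d_1 >= ...  Thus x identifies
   M_G = Spec C[V]^G with C^(n+1), and [poly_map x] is the orbit map
   V -> M_G. *)
Definition basic_invariants G x d : Prop :=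
  [/\ forall i j : 'I_n.+1, (i <= j)%N -> (tnth d j <= tnth d i)%N,
      forall i, tnth x i \is ishomog1 (tnth d i) mdeg,
      forall i, invariant_poly G (tnth x i),
      forall q, invariant_poly G q -> exists h : poly, q = comp_mpoly x h &
      forall h : poly, comp_mpoly x h = 0 -> h = 0].

(* M_{G,0}, in the coordinates x of M_G. *)
Definition regular_locus G x : set V :=
  ~` (poly_map x @` reflection_hyperplanes G).

(* A polynomial vector field on M_G is the column of its components with
   respect to the frame of coordinate fields; the i-th coordinate field,
   which is [delta_mx i 0], has degree - d_i. *)
Definition graded_vf d (delta : int) : set 'cV[poly]_n.+1 :=
  [set e | forall i mo, mo \in msupp (e i 0) ->
    ((\sum_j mo j * tnth d j)%N)%:Z - (tnth d i)%:Z = delta].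

Definition eval_vf (e : 'cV[poly]_n.+1) (p : V) : V :=
  \col_i pval (e i 0) p.

Definition vf_span (f : 'cV[poly]_n.+1) : set 'cV[poly]_n.+1 :=
  [set e | exists a : C, e = mpolyC n.+1 a *: f].

Definition is_line_in (X l : set 'cV[poly]_n.+1) : Prop :=
  exists f, [/\ X f, f != 0 & l = vf_span f].

Definition E_deg d (p : V) : V := \col_i ((tnth d i)%:R * p i 0).

End Invariants.

Section AlmostSaito.
Variables (C : numFieldType) (n : nat).
Local Notation V := 'cV[C]_n.+1.

(* Vector fields on open subsets of C^(n+1) are V-valued functions; only
   their values on the open set under consideration matter. *)
Definition vfield := V -> V.

(* Bilinear operations on tangent spaces, T p : T_p x T_p -> T_p. *)
Definition bitensor := V -> V -> V -> V.

Implicit Types (U N : set V) (X Y Z E e : vfield) (Gam mul : bitensor).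

(* [differentiable] is Frechet differentiability over C. *)
Definition holomorphic_on U X : Prop :=
  open U /\ forall p, U p -> differentiable X p.

Definition holomorphic_bitensor N (T : bitensor) : Prop :=
  [/\ forall p, N p -> forall a u u' v,
        T p (a *: u + u') v = a *: T p u v + T p u' v,
      forall p, N p -> forall a u v v',
        T p u (a *: v + v') = a *: T p u v + T p u v' &
      forall u v, holomorphic_on N (fun p => T p u v)].

Definition lie X Y : vfield := fun p => 'D_(X p) Y p - 'D_(Y p) X p.

(* The tangent bundle of an open subset of C^(n+1) is trivialized by the
   coordinate fields, so a connection is D + Gam, where Gam collects the
   Christoffel symbols. *)
Definition nabla Gam X Y : vfield := fun p => 'D_(X p) Y p + Gam p (X p) (Y p).

Definition trivial_connection : bitensor := fun _ _ _ => 0.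

Definition pointwise mul X Y : vfield := fun p => mul p (X p) (Y p).

Definition torsion_free N Gam : Prop :=
  forall U X Y, U `<=` N -> holomorphic_on U X -> holomorphic_on U Y ->
  forall p, U p -> nabla Gam X Y p - nabla Gam Y X p = lie X Y p.

(* The curvature is a tensor: it vanishes as soon as it vanishes on constant
   vector fields u, v, w, and for these [u, v] = 0. *)
Definition flat N Gam : Prop :=
  forall (u v w : V) p, N p ->
    nabla Gam (fun=> u) (nabla Gam (fun=> v) (fun=> w)) p
    - nabla Gam (fun=> v) (nabla Gam (fun=> u) (fun=> w)) p = 0.

Definition is_multiplication N mul E : Prop :=
  [/\ holomorphic_bitensor N mul,
      forall p u v, N p -> mul p u v = mul p v u,
      forall p u v w, N p -> mul p (mul p u v) w = mul p u (mul p v w),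
      holomorphic_on N E &
      forall p u, N p -> mul p (E p) u = u].

Definition ASS1 N Gam mul : Prop :=
  forall U X Y Z, U `<=` N ->
  holomorphic_on U X -> holomorphic_on U Y -> holomorphic_on U Z ->
  forall p, U p ->
    nabla Gam X (pointwise mul Y Z) p - pointwise mul Y (nabla Gam X Z) p
    - nabla Gam Y (pointwise mul X Z) p + pointwise mul X (nabla Gam Y Z) p
    = pointwise mul (lie X Y) Z p.

Definition ASS2 N mul e : Prop :=
  forall U X Y, U `<=` N -> holomorphic_on U X -> holomorphic_on U Y ->
  forall p, U p ->
    lie e (pointwise mul X Y) p - pointwise mul (lie e X) Y p
    - pointwise mul X (lie e Y) p + pointwise mul e (pointwise mul X Y) p = 0.

Definition ASS3 N (r : C) Gam E : Prop :=
  forall U X, U `<=` N -> holomorphic_on U X ->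
  forall p, U p -> nabla Gam X E p = r *: X p.

Definition ASS4 N Gam mul e : Prop :=
  forall U X Y, U `<=` N -> holomorphic_on U X -> holomorphic_on U Y ->
  forall p, U p ->
    nabla Gam X (nabla Gam Y e) p - nabla Gam (nabla Gam X Y) e p
    + nabla Gam (pointwise mul X Y) e p = 0.

(* Almost Saito structure (D + Gam, mul, e) with parameter r and unit E on
   the open submanifold N of C^(n+1). *)
Record almost_saito N (r : C) Gam mul E e : Prop := AlmostSaito {
  as_open : open N;
  as_connection : holomorphic_bitensor N Gam;
  as_torsion_free : torsion_free N Gam;
  as_flat : flat N Gam;
  as_mul : is_multiplication N mul E;
  as_field : holomorphic_on N e;
  as_field_neq0 : exists2 p, N p & e p != 0;
  as_ASS1 : ASS1 N Gam mul;
  as_ASS2 : ASS2 N mul e;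
  as_ASS3 : ASS3 N r Gam E;
  as_ASS4 : ASS4 N Gam mul e }.

(* X' on f^-1(U) and X on U are f-related, df(X') = X o f.  Where f is a local
   biholomorphism, X is the push-forward of X' along local inverses of f. *)
Definition related (f : V -> V) U X' X : Prop :=
  forall q, U (f q) -> 'D_(X' q) f q = X (f q).

(* In the next two definitions f is meant to be a covering over N; the
   structure upstairs must then be invariant under the deck transformations
   for the conclusions to hold. *)
Definition induced_connection (f : V -> V) N (Gam' Gam : bitensor) : Prop :=
  forall U X Y X' Y', U `<=` N ->
  holomorphic_on U X -> holomorphic_on U Y ->
  holomorphic_on (f @^-1` U) X' -> holomorphic_on (f @^-1` U) Y' ->
  related f U X' X -> related f U Y' Y ->
  related f U (nabla Gam' X' Y') (nabla Gam X Y).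

Definition induced_mul (f : V -> V) N (mul' mul : bitensor) : Prop :=
  forall U X Y X' Y', U `<=` N ->
  holomorphic_on U X -> holomorphic_on U Y ->
  holomorphic_on (f @^-1` U) X' -> holomorphic_on (f @^-1` U) Y' ->
  related f U X' X -> related f U Y' Y ->
  related f U (pointwise mul' X' Y') (pointwise mul X Y).

(* The first connection is nabla^V, on M_{G,0} with coordinates x. *)
Definition natural_almost_saito (G : set 'M[C]_n.+1)
    (x : n.+1.-tuple (mpoly n.+1 C)) (d : n.+1.-tuple nat)
    Gam mul (e : 'cV[mpoly n.+1 C]_n.+1) : Prop :=
  let N := regular_locus G x in
  let r := ((thead d)%:R : C)^-1 in
  [/\ induced_connection (poly_map x) N trivial_connection Gam,
      e != 0,
      graded_vf d (- (thead d)%:Z) e &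
      almost_saito N r Gam mul (fun p => r *: E_deg d p) (eval_vf e)].

(* K, with basic invariants z of degrees dz, is a normal reflection subgroup
   of G and a duality group, and the natural almost Saito structures for G
   with vector field in l are exactly those induced, by the map
   proj : M_K -> M_G such that proj o (orbit map of K) = (orbit map of G), from
   (the restrictions of) the natural almost Saito structures for K. *)
Definition induced_from (G : set 'M[C]_n.+1)
    (x : n.+1.-tuple (mpoly n.+1 C)) (d : n.+1.-tuple nat)
    (K : set 'M[C]_n.+1)
    (z : n.+1.-tuple (mpoly n.+1 C)) (dz : n.+1.-tuple nat)
    (l : set 'cV[mpoly n.+1 C]_n.+1) : Prop :=
  [/\ normal_subgroup K G, duality_group K, basic_invariants K z dz &
      exists proj : n.+1.-tuple (mpoly n.+1 C),
        (forall i, tnth x i = comp_mpoly z (tnth proj i)) /\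
        forall Gam mul (f : 'cV[mpoly n.+1 C]_n.+1),
          (l f /\ natural_almost_saito G x d Gam mul f) <->
          exists Gam' mul' f',
            [/\ natural_almost_saito K z dz Gam' mul' f',
                induced_connection (poly_map proj) (regular_locus G x) Gam' Gam,
                induced_mul (poly_map proj) (regular_locus G x) mul' mul &
                related (poly_map proj) (regular_locus G x)
                        (eval_vf f') (eval_vf f)]].

End AlmostSaito.

(* e^(i t) *)
Definition expi (R : realType) (t : R) : R[i] := Complex (cos t) (sin t).

(* Main.v *)
Require Import Defs.
From HB Require Import structures.
From mathcomp Require Import all_boot all_order all_algebra.
From mathcomp Require Import perm ring zify.
From mathcomp Require Import boolp classical_sets functions cardinality reals.
From mathcomp Require Import topology normedtype landau derive trigo complex.
From mathcomp Require Import cyclic separable cyclotomic.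
From mathcomp Require Import -(notations) mpoly.

(** In the basic invariants (x, y) = (u^(2k) + v^(2k), u^k v^k) the space M_G is
    the plane, its discriminant consists of the lines y = 0 and x = 2 y and
    x = - 2 y, and the vector fields of degree - 2k are the constant ones.  The
    connection nabla^V has explicit Christoffel symbols [chrG], rational in x
    and y, with the degree entering only through r = 1 / (2k).

    For a given field e the last axiom expresses the product of two vector
    fields wherever the endomorphism u |-> nabla_u e is invertible, so that a
    natural structure is determined by e ([multiplication_unique],
    [natural_structure_unique]).  For the three directions e tangent to the
    discriminant this gives explicit multiplications [mulD] and [mulB], and all
    axioms become rational identities between coordinate fields, by
    tensoriality ([pointwise_almost_saito], [sym_bitensor_almost_saito],
    [saito_GD], [saito_GB]).

    For any other direction ([necessity]), nabla_u e modulo e is proportional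
    to one linear form L.  At the zero of L every nabla_u e is a multiple of e,
    and the last axiom on (e, e) shows that L also vanishes on e, which happens
    only for the three directions ([necessity_generic]).  The argument breaks
    down when the zero of L lies on the discriminant; this occurs for three
    further directions, for which the square of e computed from the last axiom
    violates the second one at some point ([necessity_exceptional0],
    [necessity_exceptional]).

    The groups G(2k,2k,2) and G(k,1,2) and the conjugate of the latter are all
    of the form [mono m p z], the last two with z^k = s for s = 1 and s = - 1.
    Their invariants are sums of symmetrized monomials, hence polynomials in
    the basic ones ([mono_basic_invariants]).  The coverings M_K -> M_G are
    (x, y) |-> (x, y^k) and (x, y) |-> (y^2 - 2 s x, x); they carry the
    natural structure of K to that of G ([induced_projD], [induced_projB]), and
    by uniqueness on both orbit spaces every structure arises in this way
    ([induced_from_models]). *)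

Set Implicit Arguments.
Unset Strict Implicit.
Unset Printing Implicit Defensive.

Import Defs.
Import Order.TTheory GRing.Theory Num.Theory.
Import numFieldNormedType.Exports.

Local Open Scope classical_set_scope.
Local Open Scope ring_scope.

(** * Differential calculus over the scalar field *)

Section NearCalculus.
Variables (C : numFieldType) (V W : normedModType C).

(** The increments of the two functions agree near [x], so they have the same
    linear approximation. *)
Lemma near_differentiable (f g : V -> W) x :
  (\near x, f x = g x) -> differentiable f x -> differentiable g x.
Proof.
move=> fg df.
have fgx : f x = g x by exact: (nbhs_singleton fg).
have cdf : continuous ('d f x) by exact: diff_continuous.
suff H : g \o shift x = cst (g x) + 'd f x +o_ 0 id.
  by apply/diff_locallyP; rewrite (diff_unique cdf H).
apply/eqaddoP => e e0.
have := diff_locally df => /eqaddoP /(_ e e0) Hf.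
have fg0 : \forall h \near 0, f (h + x) = g (h + x).
  have := fg; rewrite (near_shift 0 x) subr0 => H.
  by near=> h; rewrite [h + x]/(shift x h); near: h.
near=> h.
have -> : (g \o shift x - (cst (g x) + 'd f x)) h
       = (f \o shift x - (cst (f x) + 'd f x)) h.
  rewrite /= !fctE /=.
  suff -> : g (h + x) = f (h + x) by rewrite fgx.
  by apply/esym; near: h.
by near: h.
Unshelve. all: by end_near. Qed.

End NearCalculus.

Section ColumnCalculus.
Variables (C : numFieldType) (V : normedModType C) (n : nat).
Implicit Types (F : V -> 'cV[C]_n) (p u : V).

Lemma coord_is_linear (i : 'I_n) : linear (fun M : 'cV[C]_n => M i 0 : C).
Proof. by move=> a x y; rewrite !mxE. Qed.

Lemma colE (v : 'cV[C]_n) : v = \sum_i v i 0 *: delta_mx i 0.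
Proof.
rewrite [LHS]matrix_sum_delta; apply: eq_bigr => i _.
by rewrite big_ord1.
Qed.

Lemma differentiable_colP F p :
  (forall i, differentiable (fun q => F q i 0) p) -> differentiable F p.
Proof.
move=> dF.
have -> : F = \sum_i (fun q => F q i 0 *: (delta_mx i 0 : 'cV[C]_n)).
  by apply/funext => q; rewrite fct_sumE; exact: colE.
by apply: differentiable_sum => i; apply: differentiableZl.
Qed.

Lemma differentiable_coord_comp F p i :
  differentiable F p -> differentiable (fun q => F q i 0) p.
Proof.
move=> dF.
by apply: (@differentiable_comp _ _ _ _ F (fun M : 'cV[C]_n => M i 0 : C)) => //;
  exact: differentiable_coord.
Qed.

Lemma derive_coord F p u i : differentiable F p ->
  ('D_u F p) i 0 = 'D_u (fun q => F q i 0) p.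
Proof.
move=> dF; have dFi := differentiable_coord_comp i dF.
rewrite !deriveE //.
pose co (M : 'cV[C]_n) : C := M i 0.
pose coL := GRing.isLinear.Build _ _ _ _ _ (coord_is_linear i).
pose coF : {linear 'cV[C]_n -> C} := HB.pack co coL.
have dco : differentiable coF (F p) by exact: (differentiable_coord (F p) i 0).
have dcomp : 'd (coF \o F) p u = ('d coF (F p) \o 'd F p) u by rewrite diff_comp.
have dlin : 'd coF (F p) = coF :> (_ -> _).
  by rewrite diff_lin //; exact: coord_continuous.
by rewrite -[RHS]/('d (coF \o F) p u) dcomp -[RHS]/('d coF (F p) ('d F p u)) dlin.
Qed.

End ColumnCalculus.

Section LinearFamilies.
Variables (C : numFieldType) (U : normedModType C) (n : nat).

(** Expanding [Z q] in the standard basis makes [L q (Z q)] a finite sum of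
    products of differentiable scalar functions. *)
Lemma linear_functional_leibniz (L : U -> 'cV[C]_n -> C) (Z : U -> 'cV[C]_n) p u :
  (\near p, linear (L p : _ -> C^o)) ->
  (forall z, differentiable (L^~ z) p) -> differentiable Z p ->
  differentiable (fun q => L q (Z q)) p /\
  'D_u (fun q => L q (Z q)) p = 'D_u (L^~ (Z p)) p + L p ('D_u Z p).
Proof.
move=> linL dL dZ.
have sumL q v : linear (L q : _ -> C^o) ->
    L q v = \sum_i v i 0 * L q (delta_mx i 0).
  move=> linq; pose LqL := GRing.isLinear.Build _ _ _ _ _ linq.
  pose Lq : {linear 'cV[C]_n -> C^o} := HB.pack (L q : _ -> C^o) LqL.
  rewrite [in LHS](colE v) -[LHS]/(Lq _) linear_sum; apply: eq_bigr => i _.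
  by rewrite linearZ.
have dZi i : differentiable (fun q => Z q i 0) p by exact: differentiable_coord_comp.
pose G (z : U -> 'cV[C]_n) : U -> C :=
  \sum_i ((fun q => z q i 0) * (fun q => L q (delta_mx i 0))).
have nearG z : \near p, G z p = L p (z p).
  near=> q; rewrite /G fct_sumE; apply/esym/sumL.
  by near: q.
have dG (z : U -> 'cV[C]_n) : (forall i, differentiable (fun q => z q i 0) p) ->
    differentiable (G z) p.
  by move=> dz; apply: differentiable_sum => i; exact: differentiableM.
have DG (z : U -> 'cV[C]_n) : (forall i, differentiable (fun q => z q i 0) p) ->
   'D_u (G z) p = \sum_i (z p i 0 * 'D_u (L^~ (delta_mx i 0)) p
                 + L p (delta_mx i 0) * 'D_u (fun q => z q i 0) p).
  move=> dz; rewrite derive_sum; last first.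
    by move=> i; apply: derivableM; exact: diff_derivable.
  by apply: eq_bigr => i _; rewrite deriveM //; exact: diff_derivable.
split.
  by apply: near_differentiable (nearG Z) _; exact: dG.
rewrite -(near_eq_derive _ (nearG Z)) DG //.
rewrite -(near_eq_derive _ (nearG (fun=> Z p))) DG //.
rewrite sumL; last exact: (nbhs_singleton linL).
rewrite -big_split /=; apply: eq_bigr => i _.
rewrite derive_cst mulr0 addr0 derive_coord //.
by rewrite [_ * L _ _]mulrC.
Unshelve. all: by end_near. Qed.

Lemma linear_family_leibniz m (L : U -> 'cV[C]_n -> 'cV[C]_m)
    (Z : U -> 'cV[C]_n) p u :
  (\near p, linear (L p)) ->
  (forall z, differentiable (L^~ z) p) -> differentiable Z p ->
  differentiable (fun q => L q (Z q)) p /\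
  'D_u (fun q => L q (Z q)) p = 'D_u (L^~ (Z p)) p + L p ('D_u Z p).
Proof.
move=> linL dL dZ.
have H i := @linear_functional_leibniz (fun q z => L q z i 0) Z p u.
have linLi i : \near p, linear ((fun z => L p z i 0) : _ -> C^o).
  near=> q => a x y; rewrite (_ : L q _ = a *: L q x + L q y) ?mxE //.
  by move: a x y; near: q.
have dLi i z : differentiable (fun q => L q z i 0) p.
  exact: differentiable_coord_comp.
have dLZ : differentiable (fun q => L q (Z q)) p.
  by apply: differentiable_colP => i; have [] := H i (linLi i) (dLi i) dZ.
split=> //; apply/colP => i; rewrite mxE !derive_coord //.
by have [] := H i (linLi i) (dLi i) dZ.
Unshelve. all: by end_near. Qed.

End LinearFamilies.

(** * The axioms on constant vector fields *)

Section Tensoriality.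
Variables (C : numFieldType) (n : nat).
Local Notation V := 'cV[C]_n.+1.
Implicit Types (N : set V) (Gam mul T : bitensor C n) (X Y Z E : V -> V).
Implicit Types (p u v w e : V).

Lemma holomorphic_cst N u : open N -> holomorphic_on N (fun=> u).
Proof. by move=> oN; split=> // p _; exact: differentiable_cst. Qed.

Lemma bitensor_linearl N T p v : holomorphic_bitensor N T -> N p ->
  linear (fun u => T p u v).
Proof. by move=> [H _ _] Np a u u'; exact: H. Qed.

Lemma bitensor_linearr N T p u : holomorphic_bitensor N T -> N p ->
  linear (fun v => T p u v).
Proof. by move=> [_ H _] Np a v v'; exact: H. Qed.

Section LinearFun.
Variables (f : V -> V) (lf : linear f).
Let fL := GRing.isLinear.Build _ _ _ _ _ lf.
Let f' : {linear V -> V} := HB.pack f fL.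
Lemma linfun0 : f 0 = 0. Proof. exact: (linear0 f'). Qed.
Lemma linfunD u v : f (u + v) = f u + f v. Proof. exact: (linearD f'). Qed.
Lemma linfunB u v : f (u - v) = f u - f v. Proof. exact: (linearB f'). Qed.
Lemma linfunZ a v : f (a *: v) = a *: f v. Proof. exact: (linearZ_LR f'). Qed.
End LinearFun.

(** The rule for linear families is applied to each argument in turn. *)
Lemma bitensor_leibniz N T Y Z p u : holomorphic_bitensor N T -> N p ->
  differentiable Y p -> differentiable Z p ->
  differentiable (fun q => T q (Y q) (Z q)) p /\
  'D_u (fun q => T q (Y q) (Z q)) p =
    'D_u (fun q => T q (Y p) (Z p)) p + T p ('D_u Y p) (Z p)
    + T p (Y p) ('D_u Z p).
Proof.
move=> holT Np dY dZ; have [_ _ dT] := holT.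
have oN : open N by have [] := dT 0 0.
have nearN : \near p, N p by exact: open_nbhs_nbhs.
have dTc v w : differentiable (fun q => T q v w) p by have [_] := dT v w; exact.
have inner w : differentiable (fun q => T q (Y q) w) p /\
    'D_u (fun q => T q (Y q) w) p = 'D_u (fun q => T q (Y p) w) p + T p ('D_u Y p) w.
  apply: (@linear_family_leibniz _ _ _ _ (fun q y => T q y w)) => //.
  by near=> q; apply: (bitensor_linearl _ holT); near: q.
have [|dTYZ ->] := @linear_family_leibniz _ _ _ _ (fun q z => T q (Y q) z) Z p u _
    (fun z => (inner z).1) dZ.
  by near=> q; apply: (bitensor_linearr _ holT); near: q.
by split=> //; have [_ ->] := inner (Z p).
Unshelve. all: by end_near. Qed.

(** The axioms of an almost Saito structure with a constant vector field [e],
    tested on constant vector fields. *)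
Record pointwise_saito N r Gam mul E e : Prop := PointwiseSaito {
  pw_torsion_free : forall p u v, N p -> Gam p u v = Gam p v u;
  pw_flat : forall p u v w, N p ->
    'D_u (fun q => Gam q v w) p + Gam p u (Gam p v w) =
    'D_v (fun q => Gam q u w) p + Gam p v (Gam p u w);
  pw_ASS1 : forall p u v w, N p ->
    'D_u (fun q => mul q v w) p + Gam p u (mul p v w) - mul p v (Gam p u w) =
    'D_v (fun q => mul q u w) p + Gam p v (mul p u w) - mul p u (Gam p v w);
  pw_ASS2 : forall p u v, N p ->
    'D_e (fun q => mul q u v) p + mul p e (mul p u v) = 0;
  pw_ASS3 : forall p u, N p -> 'D_u E p + Gam p u (E p) = r *: u;
  pw_ASS4 : forall p u v, N p ->
    'D_u (fun q => Gam q v e) p + Gam p u (Gam p v e)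
    - Gam p (Gam p u v) e + Gam p (mul p u v) e = 0 }.

Lemma nabla_cst Gam X e p : nabla Gam X (fun=> e) p = Gam p (X p) e.
Proof. by rewrite /nabla derive_cst add0r. Qed.

(** The defect of each axiom is a tensor: by the Leibniz rule the derivatives
    of the test fields cancel. *)
Lemma pointwise_almost_saito N r Gam mul E e : open N -> N !=set0 -> e != 0 ->
  holomorphic_bitensor N Gam -> is_multiplication N mul E ->
  pointwise_saito N r Gam mul E e ->
  almost_saito N r Gam mul E (fun=> e).
Proof.
move=> oN [p0 Np0] e0 holG ismul [tf fl a1 a2 a3 a4].
have [holm mulC mulA holE mulE] := ismul.
have Gl p v : N p -> linear (fun u => Gam p u v).
  exact: (bitensor_linearl _ holG).
have Gr p u : N p -> linear (Gam p u) by exact: (bitensor_linearr _ holG).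
have ml p v : N p -> linear (fun u => mul p u v).
  exact: (bitensor_linearl _ holm).
have mr p u : N p -> linear (mul p u) by exact: (bitensor_linearr _ holm).
split=> //.
- move=> U X Y UN [oU dX] [_ dY] p Up; have Np := UN _ Up.
  by rewrite /nabla /lie (tf p (Y p)) // opprD addrACA subrr addr0.
- move=> u v w p Np; apply/eqP; rewrite subr_eq0; apply/eqP.
  rewrite /nabla /= (_ : (fun p1 => 'D_v (fun=> w) p1 + _) = fun q => Gam q v w).
    rewrite (_ : (fun p1 => 'D_u (fun=> w) p1 + _) = fun q => Gam q u w).
      by rewrite !derive_cst !add0r fl.
    by apply/funext => q; rewrite derive_cst add0r.
  by apply/funext => q; rewrite derive_cst add0r.
- by exists p0.
- move=> U X Y Z UN [oU dX] [_ dY] [_ dZ] p Up; have Np := UN _ Up.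
  rewrite /nabla /pointwise /lie.
  have [_ ->] := bitensor_leibniz (X p) holm Np (dY p Up) (dZ p Up).
  have [_ ->] := bitensor_leibniz (Y p) holm Np (dX p Up) (dZ p Up).
  rewrite (linfunB (ml _ _ Np)) !(linfunD (mr _ _ Np)).
  have /eqP := a1 p (X p) (Y p) (Z p) Np; rewrite -subr_eq0 => /eqP H.
  rewrite -[RHS]addr0 -H.
  move: ('D_(X p) (fun q => mul q _ _) p) ('D_(Y p) (fun q => mul q _ _) p) => A B.
  by apply/matrixP => i j; rewrite !mxE; ring.
- move=> U X Y UN [oU dX] [_ dY] p Up; have Np := UN _ Up.
  rewrite /pointwise /lie !derive_cst !subr0.
  have [_ ->] := bitensor_leibniz e holm Np (dX p Up) (dY p Up).
  rewrite -[RHS](a2 p (X p) (Y p) Np).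
  move: ('D_e (fun q => mul q _ _) p) => A.
  by apply/matrixP => i j; rewrite !mxE; ring.
- by move=> U X UN [oU dX] p Up; have Np := UN _ Up; exact: a3.
- move=> U X Y UN [oU dX] [_ dY] p Up; have Np := UN _ Up.
  rewrite !nabla_cst /pointwise.
  rewrite {1}/nabla (_ : nabla Gam Y (fun=> e) = fun q => Gam q (Y q) e); last first.
    by apply/funext => q; rewrite nabla_cst.
  have [_ ->] := bitensor_leibniz (X p) holG Np (dY p Up) (differentiable_cst e p).
  rewrite derive_cst (linfun0 (Gr _ _ Np)) addr0.
  rewrite /nabla (linfunD (Gl _ _ Np)) -[RHS](a4 p (X p) (Y p) Np).
  move: ('D_(X p) (fun q => Gam q _ _) p) => A.
  by apply/matrixP => i j; rewrite !mxE; ring.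
Qed.

Lemma almost_saito_pointwise N r Gam mul E e :
  almost_saito N r Gam mul E (fun=> e) -> pointwise_saito N r Gam mul E e.
Proof.
case=> oN holG tf fl [holm mulC mulA holE mulE] _ _ a1 a2 a3 a4.
have cst u : holomorphic_on N (fun=> u) by exact: holomorphic_cst.
split.
- move=> p u v Np; have := tf N _ _ (@subset_refl _ N) (cst u) (cst v) p Np.
  by rewrite !nabla_cst /lie !derive_cst subrr => /subr0_eq.
- move=> p u v w Np; have := fl u v w p Np.
  rewrite (_ : nabla Gam (fun=> v) (fun=> w) = fun q => Gam q v w); last first.
    by apply/funext => q; rewrite nabla_cst.
  rewrite (_ : nabla Gam (fun=> u) (fun=> w) = fun q => Gam q u w); last first.
    by apply/funext => q; rewrite nabla_cst.
  by rewrite /nabla => /subr0_eq.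
- move=> p u v w Np.
  have := a1 N _ _ _ (@subset_refl _ N) (cst u) (cst v) (cst w) p Np.
  rewrite /pointwise /lie !derive_cst subrr.
  rewrite (linfun0 (bitensor_linearl _ holm Np)) !nabla_cst /nabla => H.
  apply/eqP; rewrite -subr_eq0 -H; apply/eqP.
  move: ('D_u (fun q => mul q _ _) p) ('D_v (fun q => mul q _ _) p) => A B.
  by apply/matrixP => i j; rewrite !mxE; ring.
- move=> p u v Np; have := a2 N _ _ (@subset_refl _ N) (cst u) (cst v) p Np.
  rewrite /pointwise /lie !derive_cst !subr0.
  by rewrite (linfun0 (bitensor_linearl _ holm Np))
    (linfun0 (bitensor_linearr _ holm Np)) !subr0.
- by move=> p u Np; have := a3 N _ (@subset_refl _ N) (cst u) p Np.
- move=> p u v Np; have := a4 N _ _ (@subset_refl _ N) (cst u) (cst v) p Np.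
  rewrite !nabla_cst /pointwise.
  rewrite {1}/nabla (_ : nabla Gam (fun=> v) (fun=> e) = fun q => Gam q v e) //.
  by apply/funext => q; rewrite nabla_cst.
Qed.

End Tensoriality.

(** * Rescaling and uniqueness *)

Section Extensionality.
Variables (C : numFieldType) (n : nat).
Local Notation V := 'cV[C]_n.+1.
Implicit Types (N : set V) (Gam mul T : bitensor C n) (E : V -> V) (p u v e : V).

Definition eq_on N T T' : Prop := forall p u v, N p -> T p u v = T' p u v.

Lemma eq_on_near N T T' p u v : open N -> N p -> eq_on N T T' ->
  \near p, T p u v = T' p u v.
Proof.
move=> oN Np TT'; have nearN : \near p, N p by exact: open_nbhs_nbhs.
by near=> q; apply: TT'; near: q.
Unshelve. all: by end_near. Qed.

Lemma eq_on_derive N T T' p u v w : open N -> N p -> eq_on N T T' ->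
  'D_w (fun q => T q u v) p = 'D_w (fun q => T' q u v) p.
Proof. by move=> oN Np TT'; apply: near_eq_derive; exact: eq_on_near TT'. Qed.

Lemma holomorphic_bitensor_eq_on N T T' : open N -> eq_on N T T' ->
  holomorphic_bitensor N T -> holomorphic_bitensor N T'.
Proof.
move=> oN TT' [l r h]; split.
- by move=> p Np a u u' v; rewrite -!TT' // l.
- by move=> p Np a u v v'; rewrite -!TT' // r.
- move=> u v; split=> // p Np; have [_ dT] := h u v.
  exact: near_differentiable (eq_on_near u v oN Np TT') (dT p Np).
Qed.

Lemma is_multiplication_eq_on N mul mul' E : open N -> eq_on N mul mul' ->
  is_multiplication N mul E -> is_multiplication N mul' E.
Proof.
move=> oN mm' [h c a hE mE]; split=> //.
- exact: holomorphic_bitensor_eq_on mm' h.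
- by move=> p u v Np; rewrite -!mm' // c.
- by move=> p u v w Np; rewrite -!mm' // a.
- by move=> p u Np; rewrite -mm' // mE.
Qed.

Lemma pointwise_saito_eq_on N r Gam Gam' mul mul' E e : open N ->
  eq_on N Gam Gam' -> eq_on N mul mul' ->
  pointwise_saito N r Gam mul E e -> pointwise_saito N r Gam' mul' E e.
Proof.
move=> oN GG' mm' [tf fl a1 a2 a3 a4]; split.
- by move=> p u v Np; rewrite -!GG' // tf.
- move=> p u v w Np; rewrite -!GG' // -!(eq_on_derive _ _ _ oN Np GG').
  exact: fl.
- move=> p u v w Np; rewrite -!mm' // -!GG' // -!(eq_on_derive _ _ _ oN Np mm').
  exact: a1.
- move=> p u v Np; rewrite -!mm' // -!(eq_on_derive _ _ _ oN Np mm').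
  exact: a2.
- by move=> p u Np; rewrite -GG' //; exact: a3.
- move=> p u v Np; rewrite -!mm' // -!GG' // -!(eq_on_derive _ _ _ oN Np GG').
  exact: a4.
Qed.

Lemma almost_saito_eq_on N r Gam Gam' mul mul' E e :
  eq_on N Gam Gam' -> eq_on N mul mul' ->
  almost_saito N r Gam mul E (fun=> e) -> almost_saito N r Gam' mul' E (fun=> e).
Proof.
move=> GG' mm' H; have pw := almost_saito_pointwise H.
case: H => oN holG _ _ ism _ [p0 Np0 e0] _ _ _ _.
apply: pointwise_almost_saito => //.
- by exists p0.
- exact: holomorphic_bitensor_eq_on GG' holG.
- exact: is_multiplication_eq_on mm' ism.
- exact: pointwise_saito_eq_on pw.
Qed.

(** Every axiom is homogeneous in the vector field [e]. *)
Lemma pointwise_saito_scale N r Gam mul E e (a : C) :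
  holomorphic_bitensor N Gam -> holomorphic_bitensor N mul ->
  pointwise_saito N r Gam mul E e -> pointwise_saito N r Gam mul E (a *: e).
Proof.
move=> holG holm [tf fl a1 a2 a3 a4].
have oN : open N by have [_ _ /(_ 0 0) []] := holG.
split=> //.
- move=> p u v Np; have [_ _ dm] := holm.
  rewrite (linfunZ (bitensor_linearl _ holm Np)).
  have /deriveE dE : differentiable (fun q => mul q u v) p.
    by have [_] := dm u v; exact.
  have := a2 p u v Np.
  rewrite !dE linearZ -scalerDr => ->; exact: scaler0.
- move=> p u v Np; have [_ _ dG] := holG.
  have dGv : differentiable (fun q => Gam q v e) p by have [_] := dG v e; exact.
  rewrite !(linfunZ (bitensor_linearr _ holG Np)).
  have -> : 'D_u (fun q => Gam q v (a *: e)) p = a *: 'D_u (fun q => Gam q v e) p.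
    rewrite -deriveZ; last exact: diff_derivable.
    apply: near_eq_derive.
    have nearN : \near p, N p by exact: open_nbhs_nbhs.
    near=> q; rewrite (linfunZ (bitensor_linearr _ holG _)) //.
    by near: q.
  by rewrite -scalerDr -scalerBr -scalerDr a4 // scaler0.
Unshelve. all: by end_near. Qed.

Lemma almost_saito_scale N r Gam mul E e (a : C) : a != 0 ->
  almost_saito N r Gam mul E (fun=> e) ->
  almost_saito N r Gam mul E (fun=> a *: e).
Proof.
move=> a0 H; have pw := almost_saito_pointwise H.
case: H => oN holG _ _ ism _ [p0 Np0 e0] _ _ _ _.
have [holm _ _ _ _] := ism.
apply: pointwise_almost_saito => //; first by exists p0.
  by rewrite scaler_eq0 negb_or a0.
exact: pointwise_saito_scale.
Qed.

(** Where the endomorphism [u |-> nabla_u e] is invertible, the last axiom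
    solves for the multiplication. *)
Lemma multiplication_unique N r Gam mul mul' E E' e p u v :
  holomorphic_bitensor N Gam -> N p ->
  (forall w, Gam p w e = 0 -> w = 0) ->
  pointwise_saito N r Gam mul E e -> pointwise_saito N r Gam mul' E' e ->
  mul p u v = mul' p u v.
Proof.
move=> holG Np inj H H'; apply/eqP; rewrite -subr_eq0; apply/eqP/inj.
rewrite (linfunB (bitensor_linearl _ holG Np)).
by apply/eqP; rewrite subr_eq0; apply/eqP/(addrI _)/(etrans (pw_ASS4 H u v Np))
  /esym/(pw_ASS4 H' u v Np).
Qed.

End Extensionality.

(** * Structures related by a local biholomorphism *)

Section InducedStructures.
Variables (C : numFieldType) (n : nat).
Local Notation V := 'cV[C]_n.+1.
Variables (f : V -> V) (N : set V).
Hypothesis oN : open N.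
Hypothesis df : forall q, differentiable f q.
Hypothesis ddf : forall q u, differentiable (fun q' => 'D_u f q') q.
Hypothesis df_inj : forall q u, N (f q) -> 'D_u f q = 0 -> u = 0.
Hypothesis df_lift : forall a, exists A,
  holomorphic_on (f @^-1` N) A /\ forall q, N (f q) -> 'D_(A q) f q = a.
Implicit Types (Gam mul : bitensor C n) (X Y : V -> V).

Lemma derive_dir_linear q : linear (fun u => 'D_u f q).
Proof. by move=> a u v; rewrite !deriveE // linearP. Qed.

Lemma derive_comp_map Y q u : differentiable Y (f q) ->
  differentiable (Y \o f) q /\ 'D_u (Y \o f) q = 'D_('D_u f q) Y (f q).
Proof.
move=> dY; have dYf : differentiable (Y \o f) q by exact: differentiable_comp.
split=> //; rewrite (deriveE u dYf) (deriveE _ dY) (deriveE u (df q)).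
by have /(congr1 (fun g => g u)) := @diff_comp _ _ _ _ f Y q (df q) dY.
Qed.

Lemma derive_along_field Y q u : differentiable Y q ->
  'D_u (fun q' => 'D_(Y q') f q') q =
    'D_u (fun q' => 'D_(Y q) f q') q + 'D_('D_u Y q) f q.
Proof.
move=> dY.
have lin : \forall q' \near q, linear (fun u' => 'D_u' f q').
  by near=> q'; exact: derive_dir_linear.
by have [_ ->] := linear_family_leibniz u lin (ddf q) dY.
Unshelve. all: by end_near. Qed.

Lemma open_preimage_map U : open U -> open (f @^-1` U).
Proof.
move=> oU; apply: open_comp => // q _.
exact: differentiable_continuous.
Qed.

(** Two vector fields related by [f] satisfy [Y o f = df (Y')]; differentiating
    this identity gives the transformation law of the Christoffel symbols. *)
Lemma induced_connectionP Gam' Gam :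
  induced_connection f N Gam' Gam <->
  forall q u v, N (f q) -> 'D_(Gam' q u v) f q =
    'D_u (fun q' => 'D_v f q') q + Gam (f q) ('D_u f q) ('D_v f q).
Proof.
split=> [H q u v Nq|H U X Y X' Y' UN [oU dX] [_ dY] [oU' dX'] [_ dY'] rX rY q Uq].
  have [A [hA fA]] := df_lift ('D_u f q).
  have [B [hB fB]] := df_lift ('D_v f q).
  have inj w w' : 'D_w f q = 'D_w' f q -> w = w'.
    move=> ww'; apply/eqP; rewrite -subr_eq0; apply/eqP/(df_inj Nq).
    by rewrite (linfunB (@derive_dir_linear q)) ww' subrr.
  have Aq : A q = u by apply: inj; exact: fA.
  have Bq : B q = v by apply: inj; exact: fB.
  have := H N (fun=> 'D_u f q) (fun=> 'D_v f q) A B (@subset_refl _ N)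
    (holomorphic_cst _ oN) (holomorphic_cst _ oN) hA hB fA fB q Nq.
  rewrite nabla_cst /nabla (linfunD (@derive_dir_linear q)) Aq Bq => <-.
  have [_ dB] := hB.
  have := derive_along_field u (dB q Nq).
  rewrite Bq (_ : 'D_u _ q = 0); last first.
    rewrite (@near_eq_derive _ _ _ _ (fun=> 'D_v f q)) ?derive_cst //.
    have nearN : \forall q' \near q, N (f q').
      by apply: open_nbhs_nbhs; split=> //; exact: open_preimage_map.
    by near=> q'; apply: fB; near: q'.
  by move=> HB; rewrite addrA -HB add0r.
have Nq := UN _ Uq.
rewrite /nabla (linfunD (@derive_dir_linear q)) H // rX // rY //.
have [_] := derive_comp_map (X' q) (dY _ Uq).
rewrite rX // => <-.
have -> : 'D_(X' q) (Y \o f) q = 'D_(X' q) (fun q' => 'D_(Y' q') f q') q.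
  apply: near_eq_derive.
  have nearU : \forall q' \near q, U (f q') by apply: open_nbhs_nbhs.
  by near=> q'; apply/esym/rY; near: q'.
rewrite (derive_along_field (X' q) (dY' q Uq)).
by rewrite addrA; congr (_ + _); rewrite addrC.
Unshelve. all: by end_near. Qed.

(** The lifts of constant fields take every value, so the condition on related
    fields can be read off at each point. *)
Lemma induced_mulP mul' mul :
  induced_mul f N mul' mul <->
  forall q u v, N (f q) ->
    'D_(mul' q u v) f q = mul (f q) ('D_u f q) ('D_v f q).
Proof.
split=> [H q u v Nq|H U X Y X' Y' UN _ _ _ _ rX rY q Uq]; last first.
  by rewrite /pointwise H ?rX ?rY //; exact: UN.
have [A [hA fA]] := df_lift ('D_u f q).
have [B [hB fB]] := df_lift ('D_v f q).
have inj w w' : 'D_w f q = 'D_w' f q -> w = w'.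
  move=> ww'; apply/eqP; rewrite -subr_eq0; apply/eqP/(df_inj Nq).
  by rewrite (linfunB (@derive_dir_linear q)) ww' subrr.
have := H N (fun=> 'D_u f q) (fun=> 'D_v f q) A B (@subset_refl _ N)
  (holomorphic_cst _ oN) (holomorphic_cst _ oN) hA hB fA fB q Nq.
by rewrite /pointwise (inj _ _ (fA q Nq)) (inj _ _ (fB q Nq)).
Qed.

Lemma induced_connection_eq_on Gam1' Gam2' Gam1 Gam2 :
  eq_on (f @^-1` N) Gam1' Gam2' -> eq_on N Gam1 Gam2 ->
  induced_connection f N Gam1' Gam1 -> induced_connection f N Gam2' Gam2.
Proof.
move=> GG' GG /induced_connectionP H; apply/induced_connectionP => q u v Nq.
by rewrite -GG' // -GG // H.
Qed.

Lemma induced_mul_eq_on mul1' mul2' mul1 mul2 :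
  eq_on (f @^-1` N) mul1' mul2' -> eq_on N mul1 mul2 ->
  induced_mul f N mul1' mul1 -> induced_mul f N mul2' mul2.
Proof.
move=> mm' mm /induced_mulP H; apply/induced_mulP => q u v Nq.
by rewrite -mm' // -mm // H.
Qed.

Hypothesis f_surj : forall p, N p -> exists q, f q = p.

(** At each point the transformation law of the Christoffel symbols determines
    the connection below from the one above. *)
Lemma induced_connection_unique Gam1' Gam2' Gam1 Gam2 :
  eq_on (f @^-1` N) Gam1' Gam2' ->
  induced_connection f N Gam1' Gam1 -> induced_connection f N Gam2' Gam2 ->
  eq_on N Gam1 Gam2.
Proof.
move=> GG' /induced_connectionP H1 /induced_connectionP H2 p u v Np.
have [q fq] := f_surj Np; move: Np; rewrite -fq => Nq.
have [A [_ /(_ q Nq) <-]] := df_lift u; have [B [_ /(_ q Nq) <-]] := df_lift v.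
by apply: (addrI ('D_(A q) (fun q' => 'D_(B q) f q') q)); rewrite -H1 // -H2 // GG'.
Qed.

Lemma induced_mul_unique mul1' mul2' mul1 mul2 :
  eq_on (f @^-1` N) mul1' mul2' ->
  induced_mul f N mul1' mul1 -> induced_mul f N mul2' mul2 -> eq_on N mul1 mul2.
Proof.
move=> mm' /induced_mulP H1 /induced_mulP H2 p u v Np.
have [q fq] := f_surj Np; move: Np; rewrite -fq => Nq.
have [A [_ /(_ q Nq) <-]] := df_lift u; have [B [_ /(_ q Nq) <-]] := df_lift v.
by rewrite -H1 // -H2 // mm'.
Qed.

End InducedStructures.

(** * Calculus in the plane *)

Notation xc v := (v ord0 0) (only parsing).
Notation yc v := (v ord_max 0) (only parsing).

Section PlaneCalculus.
Variable C : numFieldType.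
Local Notation V := 'cV[C]_2.
Implicit Types (p q u v w e : V) (f g : V -> C) (F : V -> V).

Definition vec2 (a b : C) : V := \col_i (if i == ord0 then a else b).

Lemma vec2E v : v = vec2 (xc v) (yc v).
Proof.
apply/colP => i; rewrite mxE.
by case: i => [[|[|//]] hi]; rewrite /=; congr (v _ 0); apply/val_inj.
Qed.

Lemma xc_vec2 a b : xc (vec2 a b) = a. Proof. by rewrite mxE. Qed.
Lemma yc_vec2 a b : yc (vec2 a b) = b. Proof. by rewrite mxE. Qed.

Lemma vec2P v w : xc v = xc w -> yc v = yc w -> v = w.
Proof. by move=> h1 h2; rewrite (vec2E v) (vec2E w) h1 h2. Qed.

Lemma vec2_eq0 a b : (vec2 a b == 0) = (a == 0) && (b == 0).
Proof.
apply/eqP/andP => [h|[/eqP -> /eqP ->]]; last first.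
  by apply: vec2P; rewrite ?xc_vec2 ?yc_vec2 mxE.
by split; apply/eqP; [rewrite -(xc_vec2 a b)|rewrite -(yc_vec2 a b)]; rewrite h mxE.
Qed.

Definition is_pd f p a b : Prop :=
  differentiable f p /\ forall u, 'D_u f p = a * xc u + b * yc u.

Lemma pd_eq f p a b a' b' : is_pd f p a b -> a = a' -> b = b' -> is_pd f p a' b'.
Proof. by move=> h <- <-. Qed.

Lemma pd_cst p k : is_pd (fun=> k) p 0 0.
Proof.
split; first exact: differentiable_cst.
by move=> u; rewrite derive_cst !mul0r addr0.
Qed.

Lemma pd_xc p : is_pd (fun q => xc q) p 1 0.
Proof.
split; first exact: differentiable_coord.
move=> u; rewrite -(derive_coord u _ (_ : differentiable id p)) //.
by rewrite derive_id mul1r mul0r addr0.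
Qed.

Lemma pd_yc p : is_pd (fun q => yc q) p 0 1.
Proof.
split; first exact: differentiable_coord.
move=> u; rewrite -(derive_coord u _ (_ : differentiable id p)) //.
by rewrite derive_id mul1r mul0r add0r.
Qed.

Lemma pdD f g p a b a' b' : is_pd f p a b -> is_pd g p a' b' ->
  is_pd (fun q => f q + g q) p (a + a') (b + b').
Proof.
move=> [df Df] [dg Dg]; split; first exact: (differentiableD df dg).
move=> u; rewrite (@deriveD _ _ _ f g); [|exact: diff_derivable..].
by rewrite Df Dg; ring.
Qed.

Lemma pdN f p a b : is_pd f p a b -> is_pd (fun q => - f q) p (- a) (- b).
Proof.
move=> [df Df]; split; first exact: (differentiableN df).
by move=> u; rewrite (@deriveN _ _ _ f); [rewrite Df; ring|exact: diff_derivable].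
Qed.

Lemma pdM f g p a b a' b' : is_pd f p a b -> is_pd g p a' b' ->
  is_pd (fun q => f q * g q) p (a * g p + f p * a') (b * g p + f p * b').
Proof.
move=> [df Df] [dg Dg]; split; first exact: (differentiableM df dg).
move=> u; rewrite (@deriveM _ _ f g); [|exact: diff_derivable..].
by rewrite Df Dg /GRing.scale /=; ring.
Qed.

Lemma pdV f p a b : f p != 0 -> is_pd f p a b ->
  is_pd (fun q => (f q)^-1) p (- a / f p ^+ 2) (- b / f p ^+ 2).
Proof.
move=> f0 [df Df]; split; first exact: (differentiableV df f0).
move=> u; rewrite (@deriveV _ _ f); [|by []|exact: diff_derivable].
by rewrite Df /GRing.scale /=; field.
Qed.

Lemma pdX f p a b n : is_pd f p a b ->
  is_pd (fun q => f q ^+ n) p (n%:R * f p ^+ n.-1 * a) (n%:R * f p ^+ n.-1 * b).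
Proof.
move=> pdf; elim: n => [|n IHn].
  by rewrite !mul0r; exact: pd_cst.
have -> : (fun q => f q ^+ n.+1) = (fun q => f q * f q ^+ n).
  by apply/funext => q; rewrite exprS.
apply: pd_eq (pdM pdf IHn) _ _; case: n {IHn} => [|n] /=; rewrite ?exprS; ring.
Qed.

Definition is_vpd F p Fx Fy : Prop :=
  differentiable F p /\ forall u, 'D_u F p = xc u *: Fx + yc u *: Fy.

Lemma vpd_vec2 f g p a b a' b' Fx Fy : is_pd f p a b -> is_pd g p a' b' ->
  Fx = vec2 a a' -> Fy = vec2 b b' -> is_vpd (fun q => vec2 (f q) (g q)) p Fx Fy.
Proof.
move=> [df Df] [dg Dg] -> ->.
have c0 : (fun q => xc (vec2 (f q) (g q))) = f.
  by apply/funext => q; rewrite xc_vec2.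
have c1 : (fun q => yc (vec2 (f q) (g q))) = g.
  by apply/funext => q; rewrite yc_vec2.
have dF : differentiable (fun q => vec2 (f q) (g q)) p.
  apply: differentiable_colP => i.
  have [->|->] : i = ord0 \/ i = ord_max.
    by case: i => [[|[|//]] hi]; [left|right]; exact: val_inj.
    by rewrite c0.
  by rewrite c1.
split=> // u; apply: vec2P; rewrite derive_coord // ?c0 ?c1 ?Df ?Dg !mxE /=.
  by rewrite mulrC [b * _]mulrC.
by rewrite mulrC [b' * _]mulrC.
Qed.

(** A symmetric bilinear operation, given by its values [a], [b], [c] on the
    pairs of coordinate fields (0,0), (0,1) and (1,1). *)
Definition sym_bitensor (a b c : V -> V) : bitensor C 1 := fun p u v =>
  (xc u * xc v) *: a p + (xc u * yc v + yc u * xc v) *: b p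
  + (yc u * yc v) *: c p.

(** The derivatives of the three values: [d0x] is that of the first value in the
    first coordinate, [d2y] that of the third in the second. *)
Record partials := Partials { d0x : V; d0y : V; d1x : V; d1y : V; d2x : V; d2y : V }.

Definition has_partials (a b c : V -> V) p (D : partials) : Prop :=
  [/\ is_vpd a p (d0x D) (d0y D), is_vpd b p (d1x D) (d1y D) &
      is_vpd c p (d2x D) (d2y D)].

Lemma sym_bitensor_partials a b c p u v w D : has_partials a b c p D ->
  'D_w (fun q => sym_bitensor a b c q u v) p =
    (xc u * xc v) *: (xc w *: d0x D + yc w *: d0y D)
    + (xc u * yc v + yc u * xc v) *: (xc w *: d1x D + yc w *: d1y D)
    + (yc u * yc v) *: (xc w *: d2x D + yc w *: d2y D).
Proof.
move=> [[da Da] [db Db] [dc Dc]].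
have dZ k (F : V -> V) : differentiable F p -> differentiable (k \*: F) p.
  by move=> dF; exact: differentiableZ.
have dab k k' : derivable (k \*: a + k' \*: b) p w.
  by apply: diff_derivable; apply: differentiableD; exact: dZ.
have dv k (F : V -> V) : differentiable F p -> derivable (k \*: F) p w.
  by move=> dF; apply: diff_derivable; exact: dZ.
have DZ k (F : V -> V) : differentiable F p -> 'D_w (k \*: F) p = k *: 'D_w F p.
  by move=> dF; rewrite deriveZ //; exact: diff_derivable.
transitivity ('D_w ((xc u * xc v) \*: a + (xc u * yc v + yc u * xc v) \*: b
    + (yc u * yc v) \*: c) p); first by [].
rewrite (deriveD (dab _ _) (dv _ _ dc)) (deriveD (dv _ _ da) (dv _ _ db)).
by rewrite (DZ _ _ da) (DZ _ _ db) (DZ _ _ dc) Da Db Dc.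
Qed.

Lemma holomorphic_sym_bitensor N a b c : open N ->
  (forall p, N p -> [/\ differentiable a p, differentiable b p & differentiable c p]) ->
  holomorphic_bitensor N (sym_bitensor a b c).
Proof.
move=> oN dabc; split=> [p Np k u u' v|p Np k u v v'|u v].
- by apply/colP => i; rewrite !mxE; ring.
- by apply/colP => i; rewrite !mxE; ring.
- split=> // p Np; have [da db dc] := dabc p Np.
  have dZ k (F : V -> V) : differentiable F p -> differentiable (k \*: F) p.
    by move=> dF; exact: differentiableZ.
  suff : differentiable ((xc u * xc v) \*: a + (xc u * yc v + yc u * xc v) \*: b
    + (yc u * yc v) \*: c) p by [].
  apply: differentiableD; last exact: dZ.
  by apply: differentiableD; exact: dZ.
Qed.

End PlaneCalculus.

(** * Almost Saito structures in the plane *)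

Section PlaneSaito.
Variable C : numFieldType.
Local Notation V := 'cV[C]_2.
Implicit Types (p q u v w e : V) (F : V -> V).

Definition comb u (a b : V) : V := xc u *: a + yc u *: b.

Lemma comb_vec2 u (a b c d : C) :
  comb u (vec2 a b) (vec2 c d) = vec2 (xc u * a + yc u * c) (xc u * b + yc u * d).
Proof. by apply: vec2P; rewrite !mxE. Qed.

Lemma vec2D (a b c d : C) : vec2 a b + vec2 c d = vec2 (a + c) (b + d).
Proof. by apply: vec2P; rewrite !mxE. Qed.

Lemma vec2N (a b : C) : - vec2 a b = vec2 (- a) (- b).
Proof. by apply: vec2P; rewrite !mxE. Qed.

Lemma vec2Z (k a b : C) : k *: vec2 a b = vec2 (k * a) (k * b).
Proof. by apply: vec2P; rewrite !mxE. Qed.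

Lemma vec2_0 : (0 : V) = vec2 0 0.
Proof. by apply: vec2P; rewrite !mxE. Qed.

(** The axioms at one point of the plane, tested on the two coordinate fields.
    The connection has Christoffel symbols [a], [b], [c] and the multiplication
    has structure constants [A], [B], [C']; the other vectors are their
    partial derivatives.  The unit field is [E], with diagonal derivative
    (1, wt). *)
Record saito_symbols (r wt : C) (E e a b c A B C' : V)
    (G M : partials C) : Prop := SaitoSymbols {
  ss_flat0 : (d1x G) + comb b a b = (d0y G) + comb a b c;
  ss_flat1 : (d2x G) + comb c a b = (d1y G) + comb b b c;
  ss_mulA0 : comb A B C' = comb B A B;
  ss_mulA1 : comb B B C' = comb C' A B;
  ss_mul1x : comb E A B = vec2 1 0;
  ss_mul1y : comb E B C' = vec2 0 1;
  ss_ASS1x : (d1x M) + comb B a b - comb a B C' = (d0y M) + comb A b c - comb b A B;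
  ss_ASS1y : (d2x M) + comb C' a b - comb b B C' = (d1y M) + comb B b c - comb c A B;
  ss_ASS2A : comb e (d0x M) (d0y M) + comb e (comb A A B) (comb A B C') = 0;
  ss_ASS2B : comb e (d1x M) (d1y M) + comb e (comb B A B) (comb B B C') = 0;
  ss_ASS2C : comb e (d2x M) (d2y M) + comb e (comb C' A B) (comb C' B C') = 0;
  ss_ASS3x : vec2 1 0 + comb E a b = vec2 r 0;
  ss_ASS3y : vec2 0 wt + comb E b c = vec2 0 r;
  ss_ASS4xx : comb e (d0x G) (d1x G) + comb (comb e a b) a b
    - comb a (comb e a b) (comb e b c) + comb A (comb e a b) (comb e b c) = 0;
  ss_ASS4xy : comb e (d1x G) (d2x G) + comb (comb e b c) a b
    - comb b (comb e a b) (comb e b c) + comb B (comb e a b) (comb e b c) = 0;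
  ss_ASS4yy : comb e (d1y G) (d2y G) + comb (comb e b c) b c
    - comb c (comb e a b) (comb e b c) + comb C' (comb e a b) (comb e b c) = 0 }.

Definition euler_field (wt : C) : V -> V := fun p => vec2 (xc p) (wt * yc p).

Lemma vpd_euler wt p : is_vpd (euler_field wt) p (vec2 1 0) (vec2 0 wt).
Proof.
apply: vpd_vec2 (pd_xc p) _ (erefl _) (erefl _).
by apply: pd_eq (pdM (pd_cst p wt) (pd_yc p)) _ _; ring.
Qed.

Lemma sym_bitensorE (a b c : V -> V) p u v :
  sym_bitensor a b c p u v = comb u (comb v (a p) (b p)) (comb v (b p) (c p)).
Proof. by apply/colP => i; rewrite !mxE; ring. Qed.

(** Every axiom is multilinear in its arguments, and the axioms that exchange
    two arguments are alternating in them, so the identities on coordinate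
    fields suffice. *)
Lemma sym_bitensor_almost_saito N r wt e (a b c A B C' : V -> V) :
  open N -> N !=set0 -> e != 0 ->
  (forall p, N p -> exists G M, [/\ has_partials a b c p G,
     has_partials A B C' p M & saito_symbols r wt (euler_field wt p) e
       (a p) (b p) (c p) (A p) (B p) (C' p) G M]) ->
  almost_saito N r (sym_bitensor a b c) (sym_bitensor A B C')
    (euler_field wt) (fun=> e).
Proof.
move=> oN N0 e0 H.
have holG : holomorphic_bitensor N (sym_bitensor a b c).
  apply: holomorphic_sym_bitensor => // p Np.
  by have [G [M [[[? _] [? _] [? _]] _ _]]] := H p Np.
have holM : holomorphic_bitensor N (sym_bitensor A B C').
  apply: holomorphic_sym_bitensor => // p Np.
  by have [G [M [_ [[? _] [? _] [? _]] _]]] := H p Np.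
have Mc p u v : N p -> sym_bitensor A B C' p u v = sym_bitensor A B C' p v u.
  by move=> Np; apply/colP => i; rewrite !mxE; ring.
apply: pointwise_almost_saito => //.
- split=> //.
  + move=> p u v w Np.
    have [G [M [hG hM S]]] := H p Np.
    apply/eqP; rewrite -subr_eq0.
    have -> : sym_bitensor A B C' p (sym_bitensor A B C' p u v) w -
              sym_bitensor A B C' p u (sym_bitensor A B C' p v w) =
       (xc v * (xc u * yc w - yc u * xc w)) *:
         (comb (A p) (B p) (C' p) - comb (B p) (A p) (B p)) +
       (yc v * (xc u * yc w - yc u * xc w)) *:
         (comb (B p) (B p) (C' p) - comb (C' p) (A p) (B p)).
      by apply/colP => i; rewrite !mxE; ring.
    by rewrite (ss_mulA0 S) (ss_mulA1 S) !subrr !scaler0 addr0.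
  + by split=> // p _; have [] := vpd_euler wt p.
  + move=> p u Np.
    have [G [M [hG hM S]]] := H p Np.
    have -> : sym_bitensor A B C' p (euler_field wt p) u =
       comb u (comb (euler_field wt p) (A p) (B p))
              (comb (euler_field wt p) (B p) (C' p)).
      by rewrite sym_bitensorE; apply/colP => i; rewrite !mxE; ring.
    rewrite (ss_mul1x S) (ss_mul1y S); apply: vec2P; rewrite !mxE /=; ring.
split.
- by move=> p u v Np; apply/colP => i; rewrite !mxE; ring.
- move=> p u v w Np.
  have [G [M [hG hM S]]] := H p Np.
  rewrite !(sym_bitensor_partials _ _ _ hG); apply/eqP; rewrite -subr_eq0.
  set lhs := (X in X == 0).
  have -> : lhs = (xc u * yc v - yc u * xc v) *:
     (xc w *: ((d1x G) + comb (b p) (a p) (b p) - ((d0y G) + comb (a p) (b p) (c p))) +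
      yc w *: ((d2x G) + comb (c p) (a p) (b p) - ((d1y G) + comb (b p) (b p) (c p)))).
    by rewrite /lhs; apply/colP => i; rewrite !mxE; ring.
  by rewrite (ss_flat0 S) (ss_flat1 S) !subrr !scaler0 addr0 scaler0.
- move=> p u v w Np.
  have [G [M [hG hM S]]] := H p Np.
  rewrite !(sym_bitensor_partials _ _ _ hM); apply/eqP; rewrite -subr_eq0.
  set lhs := (X in X == 0).
  have -> : lhs = (xc u * yc v - yc u * xc v) *:
     (xc w *: ((d1x M) + comb (B p) (a p) (b p) - comb (a p) (B p) (C' p)
               - ((d0y M) + comb (A p) (b p) (c p) - comb (b p) (A p) (B p))) +
      yc w *: ((d2x M) + comb (C' p) (a p) (b p) - comb (b p) (B p) (C' p)
               - ((d1y M) + comb (B p) (b p) (c p) - comb (c p) (A p) (B p)))).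
    by rewrite /lhs; apply/colP => i; rewrite !mxE; ring.
  by rewrite (ss_ASS1x S) (ss_ASS1y S) !subrr !scaler0 addr0 scaler0.
- move=> p u v Np.
  have [G [M [hG hM S]]] := H p Np.
  rewrite !(sym_bitensor_partials _ _ _ hM).
  set lhs := (X in X = 0).
  have -> : lhs =
    (xc u * xc v) *: (comb e (d0x M) (d0y M) + comb e (comb (A p) (A p) (B p)) (comb (A p) (B p) (C' p)))
    + (xc u * yc v + yc u * xc v) *:
        (comb e (d1x M) (d1y M) + comb e (comb (B p) (A p) (B p)) (comb (B p) (B p) (C' p)))
    + (yc u * yc v) *:
        (comb e (d2x M) (d2y M) + comb e (comb (C' p) (A p) (B p)) (comb (C' p) (B p) (C' p))).
    by rewrite /lhs; apply/colP => i; rewrite !mxE; ring.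
  by rewrite (ss_ASS2A S) (ss_ASS2B S) (ss_ASS2C S) !scaler0 !addr0.
- move=> p u Np.
  have [G [M [hG hM S]]] := H p Np.
  have [_ ->] := vpd_euler wt p.
  set lhs := LHS.
  have -> : lhs = comb u (vec2 1 0 + comb (euler_field wt p) (a p) (b p))
                         (vec2 0 wt + comb (euler_field wt p) (b p) (c p)).
    by rewrite /lhs sym_bitensorE; apply/colP => i; rewrite !mxE; ring.
  by rewrite (ss_ASS3x S) (ss_ASS3y S); apply: vec2P; rewrite !mxE /=; ring.
- move=> p u v Np.
  have [G [M [hG hM S]]] := H p Np.
  rewrite !(sym_bitensor_partials _ _ _ hG).
  set lhs := (X in X = 0).
  set Ge := comb e (a p) (b p); set Gf := comb e (b p) (c p).
  (* the coefficient of the pair (1,0) differs from that of (0,1) by curvature *)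
  have -> : lhs =
    (xc u * xc v) *: (comb e (d0x G) (d1x G) + comb Ge (a p) (b p)
                      - comb (a p) Ge Gf + comb (A p) Ge Gf)
    + (xc u * yc v + yc u * xc v) *:
        (comb e (d1x G) (d2x G) + comb Gf (a p) (b p) - comb (b p) Ge Gf + comb (B p) Ge Gf)
    + (yc u * yc v) *: (comb e (d1y G) (d2y G) + comb Gf (b p) (c p)
                        - comb (c p) Ge Gf + comb (C' p) Ge Gf)
    - (yc u * xc v) *:
      (xc e *: ((d1x G) + comb (b p) (a p) (b p) - ((d0y G) + comb (a p) (b p) (c p))) +
       yc e *: ((d2x G) + comb (c p) (a p) (b p) - ((d1y G) + comb (b p) (b p) (c p)))).
    by rewrite /lhs /Ge /Gf; apply/colP => i; rewrite !mxE; ring.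
  rewrite (ss_ASS4xx S) (ss_ASS4xy S) (ss_ASS4yy S) (ss_flat0 S) (ss_flat1 S).
  by rewrite !subrr !scaler0 !addr0 scaler0 subrr.
Qed.

(** Cramer's rule, to be applied to the endomorphism [u |-> nabla_u e]. *)
Lemma comb_inj (a b w : V) : xc a * yc b - yc a * xc b != 0 ->
  comb w a b = 0 -> w = 0.
Proof.
move=> d0 h.
have hx : xc w * xc a + yc w * xc b = 0.
  by have := congr1 (fun z : V => xc z) h; rewrite !mxE.
have hy : xc w * yc a + yc w * yc b = 0.
  by have := congr1 (fun z : V => yc z) h; rewrite !mxE.
apply: vec2P; rewrite mxE; apply: (mulIf d0); rewrite mul0r.
  transitivity ((xc w * xc a + yc w * xc b) * yc b
                - (xc w * yc a + yc w * yc b) * xc b); first ring.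
  by rewrite hx hy !mul0r subrr.
transitivity ((xc w * yc a + yc w * yc b) * xc a
              - (xc w * xc a + yc w * xc b) * yc a); first ring.
by rewrite hx hy !mul0r subrr.
Qed.

Definition vec2_simp :=
  (comb_vec2, vec2D, vec2N, vec2Z, vec2_0, @xc_vec2 C, @yc_vec2 C).

End PlaneSaito.

(** * Locally invertible maps of the plane *)

Section PlaneMaps.
Variable C : numFieldType.
Local Notation V := 'cV[C]_2.

Lemma pd_xc_comp (F : V -> V) p a b :
  is_vpd F p a b -> is_pd (fun q => xc (F q)) p (xc a) (xc b).
Proof.
move=> [dF DF]; split; first exact: differentiable_coord_comp.
by move=> u; rewrite -derive_coord // DF !mxE mulrC [yc u * _]mulrC.
Qed.

Lemma pd_yc_comp (F : V -> V) p a b :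
  is_vpd F p a b -> is_pd (fun q => yc (F q)) p (yc a) (yc b).
Proof.
move=> [dF DF]; split; first exact: differentiable_coord_comp.
by move=> u; rewrite -derive_coord // DF !mxE mulrC [yc u * _]mulrC.
Qed.

(** A map of the plane that is locally invertible over [N], with its first and
    second partial derivatives; one field serves for both mixed ones. *)
Record etale_over (N : set V) (f fx fy fxx fxy fyy : V -> V) : Prop := EtaleOver {
  et_open : open N;
  et_f : forall q, is_vpd f q (fx q) (fy q);
  et_fx : forall q, is_vpd fx q (fxx q) (fxy q);
  et_fy : forall q, is_vpd fy q (fxy q) (fyy q);
  et_jac : forall q, N (f q) -> xc (fx q) * yc (fy q) - yc (fx q) * xc (fy q) != 0 }.

Variables (N : set V) (f fx fy fxx fxy fyy : V -> V).
Hypothesis et : etale_over N f fx fy fxx fxy fyy.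

Lemma etale_derive q u : 'D_u f q = comb u (fx q) (fy q).
Proof. by have [_] := et_f et q; exact. Qed.

Lemma etale_differentiable q : differentiable f q.
Proof. by have [] := et_f et q. Qed.

Lemma etale_derive2 q u : differentiable (fun q' => 'D_u f q') q /\
  forall v, 'D_v (fun q' => 'D_u f q') q =
   (xc v * xc u) *: fxx q + (xc v * yc u + yc v * xc u) *: fxy q
   + (yc v * yc u) *: fyy q.
Proof.
have [dx Dx] := et_fx et q; have [dy Dy] := et_fy et q.
have -> : (fun q' => 'D_u f q') = xc u \*: fx + yc u \*: fy.
  by apply/funext => q'; rewrite etale_derive.
have dux : differentiable (xc u \*: fx) q by exact: differentiableZ.
have duy : differentiable (yc u \*: fy) q by exact: differentiableZ.
split=> [|v]; first exact: differentiableD.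
rewrite deriveD; [|exact: diff_derivable..].
rewrite (deriveZ _ (diff_derivable dx)) (deriveZ _ (diff_derivable dy)) Dx Dy.
by apply/colP => i; rewrite !mxE; ring.
Qed.

Lemma etale_inj q u : N (f q) -> 'D_u f q = 0 -> u = 0.
Proof. by move=> Nq; rewrite etale_derive; exact: (comb_inj (et_jac et Nq)). Qed.

(** The lift of a constant vector field, by Cramer's rule. *)
Lemma etale_lift a : exists A,
  holomorphic_on (f @^-1` N) A /\ forall q, N (f q) -> 'D_(A q) f q = a.
Proof.
pose J q := xc (fx q) * yc (fy q) - yc (fx q) * xc (fy q).
pose A q := vec2 ((yc (fy q) * xc a - xc (fy q) * yc a) * (J q)^-1)
                 ((xc (fx q) * yc a - yc (fx q) * xc a) * (J q)^-1).
exists A; split.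
  split.
    apply: open_comp; last exact: et_open et.
    by move=> q _; apply: differentiable_continuous; exact: etale_differentiable.
  move=> q Nq.
  have x1 := pd_xc_comp (et_fx et q); have y1 := pd_yc_comp (et_fx et q).
  have x2 := pd_xc_comp (et_fy et q); have y2 := pd_yc_comp (et_fy et q).
  have iJ := pdV (et_jac et Nq) (pdD (pdM x1 y2) (pdN (pdM y1 x2))).
  have := vpd_vec2
    (pdM (pdD (pdM y2 (pd_cst q (xc a))) (pdN (pdM x2 (pd_cst q (yc a))))) iJ)
    (pdM (pdD (pdM x1 (pd_cst q (yc a))) (pdN (pdM y1 (pd_cst q (xc a))))) iJ)
    (erefl _) (erefl _).
  by case.
move=> q Nq; rewrite etale_derive.
have := et_jac et Nq => J0.
apply: vec2P; rewrite !mxE /= /J; field; exact: J0.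
Qed.

(** Both sides of the transformation law of the Christoffel symbols are
    symmetric and bilinear, so it suffices to compare them on coordinate
    fields. *)
Lemma etale_induced_connection Gam' (a' b' c' a b c : V -> V) :
  eq_on (f @^-1` N) Gam' (sym_bitensor a' b' c') ->
  (forall q, N (f q) -> let G := sym_bitensor a b c (f q) in
    [/\ comb (a' q) (fx q) (fy q) = fxx q + G (fx q) (fx q),
        comb (b' q) (fx q) (fy q) = fxy q + G (fx q) (fy q) &
        comb (c' q) (fx q) (fy q) = fyy q + G (fy q) (fy q)]) ->
  induced_connection f N Gam' (sym_bitensor a b c).
Proof.
move=> GG' H; apply/(induced_connectionP (et_open et) etale_differentiable
  (fun q u => (etale_derive2 q u).1) etale_inj etale_lift) => q u v Nq.
rewrite GG' // !etale_derive (etale_derive2 q v).2.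
have [h1 h2 h3] := H q Nq.
transitivity ((xc u * xc v) *: comb (a' q) (fx q) (fy q)
  + (xc u * yc v + yc u * xc v) *: comb (b' q) (fx q) (fy q)
  + (yc u * yc v) *: comb (c' q) (fx q) (fy q)).
  by apply/colP => i; rewrite !mxE; ring.
by rewrite h1 h2 h3; apply/colP => i; rewrite !mxE; ring.
Qed.

Lemma etale_induced_mul (A' B' C' A B D : V -> V) :
  (forall q, N (f q) -> let M := sym_bitensor A B D (f q) in
    [/\ comb (A' q) (fx q) (fy q) = M (fx q) (fx q),
        comb (B' q) (fx q) (fy q) = M (fx q) (fy q) &
        comb (C' q) (fx q) (fy q) = M (fy q) (fy q)]) ->
  induced_mul f N (sym_bitensor A' B' C') (sym_bitensor A B D).
Proof.
move=> H; apply/(induced_mulP (et_open et) etale_differentiable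
  etale_inj etale_lift) => q u v Nq.
rewrite !etale_derive; have [h1 h2 h3] := H q Nq.
transitivity ((xc u * xc v) *: comb (A' q) (fx q) (fy q)
  + (xc u * yc v + yc u * xc v) *: comb (B' q) (fx q) (fy q)
  + (yc u * yc v) *: comb (C' q) (fx q) (fy q)).
  by apply/colP => i; rewrite !mxE; ring.
by rewrite h1 h2 h3; apply/colP => i; rewrite !mxE; ring.
Qed.

End PlaneMaps.

(** * Explicit structures *)

Ltac pd_step := first
  [ exact: pd_cst | exact: pd_xc | exact: pd_yc
  | eapply pdX | eapply pdM | eapply pdD | eapply pdN | eapply pdV ].

(* The partial derivatives are existential variables, solved by the rules of
   calculus. *)
Ltac model_partials :=
  refine (ex_intro _ (Partials _ _ _ _ _ _)
           (ex_intro _ (Partials _ _ _ _ _ _) _)); split;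
  [ split; apply: vpd_vec2; try reflexivity; repeat pd_step
  | split; apply: vpd_vec2; try reflexivity; repeat pd_step
  | ].

Section PlaneModels.
Variable C : numFieldType.
Local Notation V := 'cV[C]_2.
Variables (r s : C) (k : nat).
Implicit Types (p q : V) (N : set V).

(** The letters G, D and B stand for G(2k,2,2), for its subgroup G(2k,2k,2) and
    for the conjugate of G(k,1,2) with basic invariants u^k v^k, v^k + s u^k,
    where s = 1 or s = -1; the scalar [r] is the inverse of the highest degree
    2k.  The symbols [chrG], [chrD] and [chrB] are the solutions of the
    transformation law of the Christoffel symbols for the three orbit maps and
    the trivial connection on V.  The multiplications [mulD] and [mulB] on M_G
    solve the last axiom for the vector fields (1, 0) and (-2s, 1); [mulK] and
    [mulM] solve it on the orbit spaces of the two subgroups for (1, 0). *)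
Definition chrG0 p : V :=
  vec2 ((r - 1) * xc p / (xc p ^+ 2 - 4 * yc p ^+ 2))
       (r * yc p / (xc p ^+ 2 - 4 * yc p ^+ 2)).
Definition chrG1 p : V :=
  vec2 (- 4 * (r - 1) * yc p / (xc p ^+ 2 - 4 * yc p ^+ 2))
       (- r * xc p / (xc p ^+ 2 - 4 * yc p ^+ 2)).
Definition chrG2 p : V :=
  vec2 (4 * (r - 1) * xc p / (xc p ^+ 2 - 4 * yc p ^+ 2))
       (((2 * r - 1) * xc p ^+ 2 - 4 * (r - 1) * yc p ^+ 2)
        / (yc p * (xc p ^+ 2 - 4 * yc p ^+ 2))).
Definition chrG := sym_bitensor chrG0 chrG1 chrG2.

Definition mulD0 p : V :=
  vec2 (xc p / (xc p ^+ 2 - 4 * yc p ^+ 2)) (- yc p / (xc p ^+ 2 - 4 * yc p ^+ 2)).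
Definition mulD1 p : V :=
  vec2 (- 4 * yc p / (xc p ^+ 2 - 4 * yc p ^+ 2)) (xc p / (xc p ^+ 2 - 4 * yc p ^+ 2)).
Definition mulD2 p : V :=
  vec2 (4 * xc p / (xc p ^+ 2 - 4 * yc p ^+ 2))
       (- 4 * yc p / (xc p ^+ 2 - 4 * yc p ^+ 2)).
Definition mulD := sym_bitensor mulD0 mulD1 mulD2.

Definition mulB0 p : V := vec2 (xc p - 2 * s * yc p)^-1 0.
Definition mulB1 p : V := vec2 (- 2 * s / (xc p - 2 * s * yc p)) 0.
Definition mulB2 p : V :=
  vec2 (2 * s * xc p / (yc p * (xc p - 2 * s * yc p))) (yc p)^-1.
Definition mulB := sym_bitensor mulB0 mulB1 mulB2.

Definition chrD0 p : V :=
  vec2 ((r - 1) * xc p / (xc p ^+ 2 - 4 * yc p ^+ (2 * k)))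
       (2 * r ^+ 2 * yc p / (xc p ^+ 2 - 4 * yc p ^+ (2 * k))).
Definition chrD1 p : V :=
  vec2 (- 2 / r * (r - 1) * yc p ^+ (2 * k - 1)
          / (xc p ^+ 2 - 4 * yc p ^+ (2 * k)))
       (- r * xc p / (xc p ^+ 2 - 4 * yc p ^+ (2 * k))).
Definition chrD2 p : V :=
  vec2 ((r - 1) / r ^+ 2 * xc p * yc p ^+ (2 * k - 2)
          / (xc p ^+ 2 - 4 * yc p ^+ (2 * k)))
       (2 * yc p ^+ (2 * k - 1) / (xc p ^+ 2 - 4 * yc p ^+ (2 * k))).
Definition chrD := sym_bitensor chrD0 chrD1 chrD2.

Definition mulK0 p : V :=
  vec2 (xc p / (xc p ^+ 2 - 4 * yc p ^+ (2 * k)))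
       (- 2 * r * yc p / (xc p ^+ 2 - 4 * yc p ^+ (2 * k))).
Definition mulK1 p : V :=
  vec2 (- 2 / r * yc p ^+ (2 * k - 1) / (xc p ^+ 2 - 4 * yc p ^+ (2 * k)))
       (xc p / (xc p ^+ 2 - 4 * yc p ^+ (2 * k))).
Definition mulK2 p : V :=
  vec2 (1 / r ^+ 2 * xc p * yc p ^+ (2 * k - 2)
          / (xc p ^+ 2 - 4 * yc p ^+ (2 * k)))
       (- 2 / r * yc p ^+ (2 * k - 1) / (xc p ^+ 2 - 4 * yc p ^+ (2 * k))).
Definition mulK := sym_bitensor mulK0 mulK1 mulK2.

Definition chrB0 p : V :=
  vec2 (((4 - 4 * r) * xc p - s * (1 - 2 * r) * yc p ^+ 2)
          / (xc p * (s * yc p ^+ 2 - 4 * xc p)))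
       ((2 * r - 1) * yc p / (xc p * (s * yc p ^+ 2 - 4 * xc p))).
Definition chrB1 p : V :=
  vec2 (- 2 * r * s * yc p / (s * yc p ^+ 2 - 4 * xc p))
       ((2 - 4 * r) / (s * yc p ^+ 2 - 4 * xc p)).
Definition chrB2 p : V :=
  vec2 (4 * r * s * xc p / (s * yc p ^+ 2 - 4 * xc p))
       ((2 * r - 1) * s * yc p / (s * yc p ^+ 2 - 4 * xc p)).
Definition chrB := sym_bitensor chrB0 chrB1 chrB2.

Definition mulM0 p : V :=
  vec2 (xc p)^-1 (2 * yc p / (xc p * (s * yc p ^+ 2 - 4 * xc p))).
Definition mulM1 p : V := vec2 0 (- 4 / (s * yc p ^+ 2 - 4 * xc p)).
Definition mulM2 p : V := vec2 0 (2 * s * yc p / (s * yc p ^+ 2 - 4 * xc p)).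
Definition mulM := sym_bitensor mulM0 mulM1 mulM2.

Lemma saito_GD N : open N -> N !=set0 ->
  (forall p, N p -> yc p != 0 /\ xc p ^+ 2 - 4 * yc p ^+ 2 != 0) ->
  almost_saito N r chrG mulD (euler_field 1) (fun=> vec2 1 0).
Proof.
move=> oN N0 Nreg; apply: sym_bitensor_almost_saito => //.
  by rewrite vec2_eq0 oner_eq0.
move=> p /Nreg [y0 d0].
rewrite /chrG0 /chrG1 /chrG2 /mulD0 /mulD1 /mulD2 /euler_field.
model_partials; rewrite ?mulf_neq0 //.
move: (xc p) (yc p) y0 d0 => x y y0 d0 {N oN N0 Nreg p}.
by split; rewrite !vec2_simp; congr vec2; field; rewrite ?y0 ?d0.
Qed.

Hypothesis s1 : s = 1 \/ s = -1.

Lemma saito_GB N : open N -> N !=set0 ->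
  (forall p, N p -> yc p != 0 /\ xc p ^+ 2 - 4 * yc p ^+ 2 != 0) ->
  almost_saito N r chrG mulB (euler_field 1) (fun=> vec2 (- 2 * s) 1).
Proof.
move=> oN N0 Nreg; apply: sym_bitensor_almost_saito => //.
  by rewrite vec2_eq0 oner_eq0 andbF.
move=> p /Nreg [y0 d0].
have ds : (xc p - 2 * s * yc p) * (xc p + 2 * s * yc p) != 0.
  by rewrite (_ : _ * _ = xc p ^+ 2 - 4 * yc p ^+ 2) //; case: s1 => ->; ring.
have [d1 d2] : xc p - 2 * s * yc p != 0 /\ xc p + 2 * s * yc p != 0.
  by move: ds; rewrite mulf_eq0 negb_or => /andP.
rewrite /chrG0 /chrG1 /chrG2 /mulB0 /mulB1 /mulB2 /euler_field.
model_partials; rewrite ?mulf_neq0 //.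
move: (xc p) (yc p) y0 d0 d1 d2 => x y y0 d0 d1 d2 {N oN N0 Nreg p ds}.
by split; rewrite !vec2_simp; congr vec2; case: s1 d1 d2 => ->;
  rewrite ?mulr1 ?mulrN1 => d1 d2; field; rewrite ?y0 ?d0 ?d1.
Qed.

Lemma saito_B N : open N -> N !=set0 ->
  (forall p, N p -> xc p != 0 /\ s * yc p ^+ 2 - 4 * xc p != 0) ->
  almost_saito N r chrB mulM (euler_field 2^-1) (fun=> vec2 1 0).
Proof.
move=> oN N0 Nreg; apply: sym_bitensor_almost_saito => //.
  by rewrite vec2_eq0 oner_eq0.
move=> p /Nreg [x0 d0].
rewrite /chrB0 /chrB1 /chrB2 /mulM0 /mulM1 /mulM2 /euler_field.
model_partials; rewrite ?mulf_neq0 //.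
move: (xc p) (yc p) x0 d0 => x y x0 d0 {N oN N0 Nreg p}.
by split; rewrite !vec2_simp; congr vec2; case: s1 d0 => ->;
  rewrite ?mul1r ?mulN1r => d0; field; rewrite ?x0 ?d0.
Qed.

Hypothesis k1 : (1 < k)%N.
Hypothesis rk : r * (2 * k)%:R = 1.

Lemma r_neq0 : r != 0.
Proof. by apply/eqP => r0; move/eqP: rk; rewrite r0 mul0r eq_sym oner_eq0. Qed.

Lemma saito_D N : open N -> N !=set0 ->
  (forall p, N p -> xc p ^+ 2 - 4 * yc p ^+ (2 * k) != 0) ->
  almost_saito N r chrD mulK (euler_field (2 * r)) (fun=> vec2 1 0).
Proof.
move=> oN N0 Nreg; apply: sym_bitensor_almost_saito => //.
  by rewrite vec2_eq0 oner_eq0.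
move=> p /Nreg d0; have r0 := r_neq0.
rewrite /chrD0 /chrD1 /chrD2 /mulK0 /mulK1 /mulK2 /euler_field.
have [m km] : exists m, k = m.+2 by case: k k1 => [|[|m]] // _; exists m.
have e0 : (2 * k = (2 * m).+4)%N by lia.
have n0 : (2 * m).+4%:R = r^-1 by rewrite -e0; apply: (mulfI r0); rewrite rk divff.
have n1 : (2 * m).+3%:R = r^-1 - 1 by rewrite -n0 -[(2 * m).+4]addn1 natrD addrK.
have n2 : (2 * m).+2%:R = r^-1 - 2.
  by rewrite -n0 -[(2 * m).+4]addn2 natrD addrK.
move: d0; rewrite e0 !subSS !subn0 => d0.
model_partials => //=.
rewrite n0 n1 n2 !exprS expr0 ?mulr1; move: d0; rewrite !exprS expr0 ?mulr1.
move: (xc p) (yc p) (yc p ^+ (2 * m)) => x y t d0 {N oN N0 Nreg p n0 n1 n2}.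
by split; rewrite !vec2_simp; congr vec2; field; rewrite ?r0 ?d0.
Qed.

End PlaneModels.

(** * Explicit orbit maps and coverings *)

Section PlaneModelMaps.
Variable C : numFieldType.
Local Notation V := 'cV[C]_2.
Variables (r s : C) (k : nat).
Hypothesis s1 : s = 1 \/ s = -1.
Hypothesis k1 : (1 < k)%N.
Hypothesis rk : r * (2 * k)%:R = 1.
Implicit Types (p q : V) (N : set V).

(** The orbit map [orbG] is [projD] after [orbD], and [projB] after [orbB]. *)
Definition orbG q : V :=
  vec2 (xc q ^+ (2 * k) + yc q ^+ (2 * k)) (xc q ^+ k * yc q ^+ k).
Definition orbD q : V := vec2 (xc q ^+ (2 * k) + yc q ^+ (2 * k)) (xc q * yc q).
Definition orbB q : V := vec2 (xc q ^+ k * yc q ^+ k) (yc q ^+ k + s * xc q ^+ k).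
Definition projD q : V := vec2 (xc q) (yc q ^+ k).
Definition projB q : V := vec2 (yc q ^+ 2 - 2 * s * xc q) (xc q).

Definition orbGx q : V :=
  vec2 ((2 * k)%:R * xc q ^+ (2 * k - 1)) (k%:R * xc q ^+ (k - 1) * yc q ^+ k).
Definition orbGy q : V :=
  vec2 ((2 * k)%:R * yc q ^+ (2 * k - 1)) (k%:R * xc q ^+ k * yc q ^+ (k - 1)).
Definition orbGxx q : V :=
  vec2 ((2 * k)%:R * (2 * k - 1)%:R * xc q ^+ (2 * k - 2))
       (k%:R * (k - 1)%:R * xc q ^+ (k - 2) * yc q ^+ k).
Definition orbGxy q : V :=
  vec2 0 (k%:R * k%:R * xc q ^+ (k - 1) * yc q ^+ (k - 1)).
Definition orbGyy q : V :=
  vec2 ((2 * k)%:R * (2 * k - 1)%:R * yc q ^+ (2 * k - 2))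
       (k%:R * (k - 1)%:R * xc q ^+ k * yc q ^+ (k - 2)).

Definition orbDx q : V := vec2 ((2 * k)%:R * xc q ^+ (2 * k - 1)) (yc q).
Definition orbDy q : V := vec2 ((2 * k)%:R * yc q ^+ (2 * k - 1)) (xc q).
Definition orbDxx q : V :=
  vec2 ((2 * k)%:R * (2 * k - 1)%:R * xc q ^+ (2 * k - 2)) 0.
Definition orbDxy q : V := vec2 0 1.
Definition orbDyy q : V :=
  vec2 ((2 * k)%:R * (2 * k - 1)%:R * yc q ^+ (2 * k - 2)) 0.

Definition orbBx q : V :=
  vec2 (k%:R * xc q ^+ (k - 1) * yc q ^+ k) (s * k%:R * xc q ^+ (k - 1)).
Definition orbBy q : V :=
  vec2 (k%:R * xc q ^+ k * yc q ^+ (k - 1)) (k%:R * yc q ^+ (k - 1)).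
Definition orbBxx q : V :=
  vec2 (k%:R * (k - 1)%:R * xc q ^+ (k - 2) * yc q ^+ k)
       (s * k%:R * (k - 1)%:R * xc q ^+ (k - 2)).
Definition orbBxy q : V :=
  vec2 (k%:R * k%:R * xc q ^+ (k - 1) * yc q ^+ (k - 1)) 0.
Definition orbByy q : V :=
  vec2 (k%:R * (k - 1)%:R * xc q ^+ k * yc q ^+ (k - 2))
       (k%:R * (k - 1)%:R * yc q ^+ (k - 2)).

Definition projDx q : V := vec2 1 0.
Definition projDy q : V := vec2 0 (k%:R * yc q ^+ (k - 1)).
Definition projDxx q : V := vec2 0 0.
Definition projDyy q : V := vec2 0 (k%:R * (k - 1)%:R * yc q ^+ (k - 2)).

Definition projBx q : V := vec2 (- 2 * s) 1.
Definition projBy q : V := vec2 (2 * yc q) 0.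
Definition projBxx q : V := vec2 0 0.
Definition projByy q : V := vec2 2 0.

Lemma k_succ2 : exists m, k = m.+2.
Proof. by case: k k1 => [|[|m]] // _; exists m. Qed.

Lemma nat_casts m : k = m.+2 ->
  [/\ m.+2%:R = (2 * r)^-1 :> C, m.+1%:R = (2 * r)^-1 - 1 :> C,
      (2 * m).+4%:R = r^-1 :> C & (2 * m).+3%:R = r^-1 - 1 :> C].
Proof.
move=> km; have r0 := r_neq0 rk.
have e : (2 * k = (2 * m).+4)%N by lia.
have h4 : (2 * m).+4%:R = r^-1 :> C.
  by rewrite -e; apply: (mulfI r0); rewrite rk divff.
have h2 : m.+2%:R = (2 * r)^-1 :> C.
  by rewrite invfM -h4 -e natrM km mulKf // pnatr_eq0.
split=> //; first by rewrite -h2 -[m.+2]addn1 natrD addrK.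
by rewrite -h4 -[(2 * m).+4]addn1 natrD addrK.
Qed.

Ltac etale_pd := apply: vpd_vec2; repeat pd_step.

Lemma two_neq0 : 2 != 0 :> C. Proof. by rewrite pnatr_eq0. Qed.

Lemma etale_orbG N : open N ->
  (forall p, N p -> yc p != 0 /\ xc p ^+ 2 - 4 * yc p ^+ 2 != 0) ->
  etale_over N orbG orbGx orbGy orbGxx orbGxy orbGyy.
Proof.
have [m km] := k_succ2; have [c2 c1 d4 d3] := nat_casts km.
have e0 : (2 * k = (2 * m).+4)%N by lia.
have r0 := r_neq0 rk.
move=> oN Nreg; rewrite /orbG /orbGx /orbGy /orbGxx /orbGxy /orbGyy e0 km.
rewrite !subSS !subn0.
split=> // [q|q|q|q /Nreg].
- by etale_pd; rewrite /=; congr vec2; ring.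
- by etale_pd; rewrite /=; congr vec2; ring.
- by etale_pd; rewrite /=; congr vec2; ring.
rewrite !xc_vec2 !yc_vec2 c2 d4 mul2n -addnn !exprS !exprD.
move: (xc q) (yc q) (xc q ^+ m) (yc q ^+ m) => x y X Y [].
rewrite !mulf_eq0 !negb_or => /andP[/and3P[x0 _ X0] /and3P[y0 _ Y0]].
rewrite (_ : _ - _ = (x * x * X * X * x * x - y * y * Y * Y * y * y) ^+ 2);
  last by ring.
rewrite expf_eq0 /= => d0.
rewrite (_ : _ - _ = (x * X) * (y * Y) *
  (x * x * X * X * x * x - y * y * Y * Y * y * y) / (2 * r ^+ 2)); last by field.
by rewrite mulf_neq0 ?invr_neq0 ?mulf_neq0 ?expf_neq0 ?two_neq0.
Qed.

Lemma etale_orbD N : open N ->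
  (forall p, N p -> xc p ^+ 2 - 4 * yc p ^+ (2 * k) != 0) ->
  etale_over N orbD orbDx orbDy orbDxx orbDxy orbDyy.
Proof.
have [m km] := k_succ2; have [c2 c1 d4 d3] := nat_casts km.
have e0 : (2 * k = (2 * m).+4)%N by lia.
have r0 := r_neq0 rk.
move=> oN Nreg; rewrite /orbD /orbDx /orbDy /orbDxx /orbDxy /orbDyy e0.
rewrite !subSS !subn0.
split=> // [q|q|q|q /Nreg].
- by etale_pd; rewrite /=; congr vec2; ring.
- by etale_pd; rewrite /=; congr vec2; ring.
- by etale_pd; rewrite /=; congr vec2; ring.
rewrite !xc_vec2 !yc_vec2 e0 d4 mul2n -addnn !exprS !exprD !exprMn.
move: (xc q) (yc q) (xc q ^+ m) (yc q ^+ m) => x y X Y.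
rewrite (_ : _ - _ = (x * x * X * X * x * x - y * y * Y * Y * y * y) ^+ 2);
  last by ring.
rewrite expf_eq0 /= => d0.
rewrite (_ : _ - _ = (x * x * X * X * x * x - y * y * Y * Y * y * y) / r);
  last by field.
by rewrite mulf_neq0 ?invr_neq0.
Qed.

Lemma etale_orbB N : open N ->
  (forall p, N p -> xc p != 0 /\ s * yc p ^+ 2 - 4 * xc p != 0) ->
  etale_over N orbB orbBx orbBy orbBxx orbBxy orbByy.
Proof.
have [m km] := k_succ2; have [c2 c1 d4 d3] := nat_casts km.
have r0 := r_neq0 rk.
move=> oN Nreg; rewrite /orbB /orbBx /orbBy /orbBxx /orbBxy /orbByy km.
rewrite !subSS !subn0.
split=> // [q|q|q|q /Nreg].
- by etale_pd; rewrite /=; congr vec2; ring.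
- by etale_pd; rewrite /=; congr vec2; ring.
- by etale_pd; rewrite /=; congr vec2; ring.
rewrite !xc_vec2 !yc_vec2 c2 !exprS.
move: (xc q) (yc q) (xc q ^+ m) (yc q ^+ m) => x y X Y [].
rewrite !mulf_eq0 !negb_or => /andP[/and3P[x0 _ X0] /and3P[y0 _ Y0]].
rewrite (_ : _ - _ = s * (y * y * Y - s * (x * x * X)) ^+ 2);
  last by case: s1 => ->; ring.
rewrite mulf_eq0 negb_or expf_eq0 /= => /andP[s0 d0].
rewrite (_ : _ - _ = (x * X) * (y * Y) * (y * y * Y - s * (x * x * X))
    / (4 * r ^+ 2)); last by field.
by rewrite mulf_neq0 ?invr_neq0 ?mulf_neq0 ?expf_neq0 ?pnatr_eq0.
Qed.

Lemma etale_projD N : open N -> (forall p, N p -> yc p != 0) ->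
  etale_over N projD projDx projDy projDxx projDxx projDyy.
Proof.
have [m km] := k_succ2; have [c2 c1 d4 d3] := nat_casts km.
have r0 := r_neq0 rk.
move=> oN Nreg; rewrite /projD /projDx /projDy /projDxx /projDyy km.
rewrite !subSS !subn0.
split=> // [q|q|q|q /Nreg].
- by etale_pd; rewrite /=; congr vec2; ring.
- by etale_pd; rewrite /=; congr vec2; ring.
- by etale_pd; rewrite /=; congr vec2; ring.
rewrite !xc_vec2 !yc_vec2 c2 !exprS !mulf_eq0 !negb_or => /and3P[y0 _ Y0].
by rewrite mul1r mul0r subr0 !mulf_neq0 ?invr_neq0 ?mulf_neq0 ?two_neq0.
Qed.

Lemma etale_projB N : open N -> (forall p, N p -> xc p + 2 * s * yc p != 0) ->
  etale_over N projB projBx projBy projBxx projBxx projByy.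
Proof.
move=> oN Nreg; rewrite /projB /projBx /projBy /projBxx /projByy.
split=> // [q|q|q|q /Nreg].
- by etale_pd; rewrite /=; congr vec2; ring.
- by etale_pd; rewrite /=; congr vec2; ring.
- by etale_pd; rewrite /=; congr vec2; ring.
rewrite !xc_vec2 !yc_vec2 subrK expf_eq0 /= => y0.
by rewrite mulr0 mul1r sub0r oppr_eq0 mulf_neq0 ?two_neq0.
Qed.

End PlaneModelMaps.

Section InducedModels.
Variable C : numFieldType.
Local Notation V := 'cV[C]_2.
Variables (r s : C) (k : nat).
Hypothesis s1 : s = 1 \/ s = -1.
Hypothesis k1 : (1 < k)%N.
Hypothesis rk : r * (2 * k)%:R = 1.
Implicit Types (p q : V) (N : set V).

Lemma sym_bitensor0 (N : set V) :
  eq_on N (@trivial_connection C 1) (sym_bitensor (fun=> 0) (fun=> 0) (fun=> 0)).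
Proof. by move=> p u v _; rewrite /sym_bitensor !scaler0 !addr0. Qed.

Lemma induced_orbG N : open N ->
  (forall p, N p -> yc p != 0 /\ xc p ^+ 2 - 4 * yc p ^+ 2 != 0) ->
  induced_connection (orbG k) N (@trivial_connection C 1) (chrG r).
Proof.
have [m km] := k_succ2 k1; have [c2 c1 d4 d3] := nat_casts k1 rk km.
have e0 : (2 * k = (2 * m).+4)%N by lia.
have r0 := r_neq0 rk.
move=> oN Nreg; apply: (etale_induced_connection (etale_orbG k1 rk oN Nreg)).
  exact: sym_bitensor0.
move=> q /Nreg; rewrite /chrG0 /chrG1 /chrG2 !sym_bitensorE.
rewrite /orbG /orbGx /orbGy /orbGxx /orbGxy /orbGyy e0 km !subSS !subn0.
rewrite !vec2_simp c2 c1 d4 d3 mul2n -addnn !exprS !exprD !expr0 !mulr1.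
move: (xc q) (yc q) (xc q ^+ m) (yc q ^+ m) => x y X Y [].
rewrite !mulf_eq0 !negb_or => /andP[/and3P[x0 _ X0] /and3P[y0 _ Y0]] d0.
by split; congr vec2; field; rewrite ?d0 ?r0 ?x0 ?y0 ?X0 ?Y0.
Qed.

Lemma induced_orbD N : open N ->
  (forall p, N p -> xc p ^+ 2 - 4 * yc p ^+ (2 * k) != 0) ->
  induced_connection (orbD k) N (@trivial_connection C 1) (chrD r k).
Proof.
have [m km] := k_succ2 k1; have [c2 c1 d4 d3] := nat_casts k1 rk km.
have e0 : (2 * k = (2 * m).+4)%N by lia.
have r0 := r_neq0 rk.
move=> oN Nreg; apply: (etale_induced_connection (etale_orbD k1 rk oN Nreg)).
  exact: sym_bitensor0.
move=> q /Nreg; rewrite /chrD0 /chrD1 /chrD2 !sym_bitensorE.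
rewrite /orbD /orbDx /orbDy /orbDxx /orbDxy /orbDyy e0 !subSS !subn0.
rewrite !vec2_simp d4 d3 mul2n -addnn !exprS !exprD !exprMn !expr0 !mulr1.
move: (xc q) (yc q) (xc q ^+ m) (yc q ^+ m) => x y X Y d0.
by split; congr vec2; field; rewrite ?d0 ?r0.
Qed.

Lemma induced_orbB N : open N ->
  (forall p, N p -> xc p != 0 /\ s * yc p ^+ 2 - 4 * xc p != 0) ->
  induced_connection (orbB s k) N (@trivial_connection C 1) (chrB r s).
Proof.
have [m km] := k_succ2 k1; have [c2 c1 d4 d3] := nat_casts k1 rk km.
have r0 := r_neq0 rk.
move=> oN Nreg; apply: (etale_induced_connection (etale_orbB s1 k1 rk oN Nreg)).
  exact: sym_bitensor0.
move=> q /Nreg; rewrite /chrB0 /chrB1 /chrB2 !sym_bitensorE.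
rewrite /orbB /orbBx /orbBy /orbBxx /orbBxy /orbByy km !subSS !subn0.
rewrite !vec2_simp c2 c1 !exprS !expr0 !mulr1.
move: (xc q) (yc q) (xc q ^+ m) (yc q ^+ m) => x y X Y [].
rewrite !mulf_eq0 !negb_or => /andP[/and3P[x0 _ X0] /and3P[y0 _ Y0]].
by case: s1 => ->; rewrite ?mul1r ?mulN1r => d0;
  split; congr vec2; field; rewrite ?d0 ?r0 ?x0 ?y0 ?X0 ?Y0.
Qed.

(** The discriminant of G pulls back to y^k (x^2 - 4 y^(2k)), whose second factor
    is the discriminant of G(2k,2k,2); the covering is branched along y = 0. *)
Lemma induced_projD N : open N ->
  (forall p, N p -> yc p != 0 /\ xc p ^+ 2 - 4 * yc p ^+ 2 != 0) ->
  induced_connection (projD k) N (chrD r k) (chrG r) /\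
  induced_mul (projD k) N (mulK r k) (@mulD C).
Proof.
have [m km] := k_succ2 k1; have [c2 c1 d4 d3] := nat_casts k1 rk km.
have e0 : (2 * k = (2 * m).+4)%N by lia.
have r0 := r_neq0 rk.
move=> oN Nreg; have Ny p (Np : N p) := (Nreg p Np).1.
have et := etale_projD k1 rk oN Ny.
split; [apply: (etale_induced_connection et) => //|apply: (etale_induced_mul et)];
  move=> q /Nreg; rewrite /= !sym_bitensorE.
- rewrite /chrG0 /chrG1 /chrG2 /chrD0 /chrD1 /chrD2.
  rewrite /projD /projDx /projDy /projDxx /projDyy e0 km !subSS !subn0.
  rewrite !vec2_simp c2 c1 mul2n -addnn !exprS !exprD !expr0 !mulr1.
  move: (xc q) (yc q) (yc q ^+ m) => x y Y [].
  rewrite !mulf_eq0 !negb_or => /and3P[y0 _ Y0].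
  have -> : x * x - 4 * (y * (y * Y) * (y * (y * Y))) =
      x * x - 4 * (y * (y * (y * (y * (Y * Y))))) by ring.
  by move=> d0; split; congr vec2; field; rewrite ?d0 ?r0 ?y0 ?Y0.
rewrite /mulD0 /mulD1 /mulD2 /mulK0 /mulK1 /mulK2.
rewrite /projD /projDx /projDy e0 km !subSS !subn0.
rewrite !vec2_simp c2 mul2n -addnn !exprS !exprD !expr0 !mulr1.
move: (xc q) (yc q) (yc q ^+ m) => x y Y [].
rewrite !mulf_eq0 !negb_or => /and3P[y0 _ Y0].
have -> : x * x - 4 * (y * (y * Y) * (y * (y * Y))) =
    x * x - 4 * (y * (y * (y * (y * (Y * Y))))) by ring.
by move=> d0; split; congr vec2; field; rewrite ?d0 ?r0 ?y0 ?Y0.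
Qed.

(** The pull-back of x^2 - 4 y^2 is y^2 (y^2 - 4 s x): the covering is branched
    along y = 0, over the line x + 2 s y = 0. *)
Lemma induced_projB N : open N ->
  (forall p, N p -> yc p != 0 /\ xc p ^+ 2 - 4 * yc p ^+ 2 != 0) ->
  induced_connection (projB s) N (chrB r s) (chrG r) /\
  induced_mul (projB s) N (mulM s) (mulB s).
Proof.
move=> oN Nreg; have Ny p : N p -> xc p + 2 * s * yc p != 0.
  move=> /Nreg [_]; rewrite (_ : _ - _ = (xc p + 2 * s * yc p) * (xc p - 2 * s * yc p)).
    by rewrite mulf_eq0 negb_or => /andP[].
  by case: s1 => ->; ring.
have et := etale_projB oN Ny.
split; [apply: (etale_induced_connection et) => //|apply: (etale_induced_mul et)];
  move=> q /Nreg; rewrite /= !sym_bitensorE.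
- rewrite /chrG0 /chrG1 /chrG2 /chrB0 /chrB1 /chrB2.
  rewrite /projB /projBx /projBy /projBxx /projByy.
  rewrite !vec2_simp; move: (xc q) (yc q) => x y [x0 d1]; have := d1.
  rewrite (_ : _ - _ = y * (s * (y * (s * y ^+ 2 - 4 * x)))); last first.
    by case: s1 => ->; ring.
  rewrite !mulf_eq0 !negb_or => /and4P[y0 _ _].
  case: s1 d1 => ->; rewrite ?mul1r ?mulN1r ?mulr1 ?mulrN1 => d1 d0;
  by split; congr vec2; field; rewrite ?d0 ?x0 ?y0 ?d1.
rewrite /mulB0 /mulB1 /mulB2 /mulM0 /mulM1 /mulM2.
rewrite /projB /projBx /projBy.
rewrite !vec2_simp; move: (xc q) (yc q) => x y [x0].
rewrite (_ : _ - _ = y * (s * (y * (s * y ^+ 2 - 4 * x)))); last first.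
  by case: s1 => ->; ring.
rewrite !mulf_eq0 !negb_or => /and4P[y0 s0 _ d0].
have d1 : y ^+ 2 - 2 * s * x - 2 * s * x != 0.
  rewrite (_ : _ - _ = s * (s * y ^+ 2 - 4 * x)) ?mulf_neq0 //.
  by case: s1 => ->; ring.
case: s1 d0 d1 => ->; rewrite ?mul1r ?mulN1r ?mulr1 ?mulrN1 => d0 d1;
by split; congr vec2; field; rewrite ?d0 ?d1 ?x0 ?y0.
Qed.

End InducedModels.

(** * The vector fields admitting a structure *)

Section Necessity.
Variable C : numFieldType.
Local Notation V := 'cV[C]_2.
Variables (r : C) (N : set V).
Hypothesis r0 : r != 0.
Hypothesis r1 : 1 - r != 0.
Hypothesis r2 : 1 - 2 * r != 0.
Hypothesis NE : forall p : V, N p <-> yc p != 0 /\ xc p ^+ 2 - 4 * yc p ^+ 2 != 0.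
Implicit Types (p q e : V) (mul : bitensor C 1).

Definition wedge (u v : V) : C := xc u * yc v - yc u * xc v.

Lemma euler1 : euler_field 1 = id :> (V -> V).
Proof. by apply/funext => p; apply: vec2P; rewrite !mxE ?mul1r. Qed.

Lemma wedgeN u v : wedge u (- v) = - wedge u v.
Proof. by rewrite /wedge !mxE; ring. Qed.

Lemma derive_wedge F e p u : differentiable F p ->
  'D_u (fun q => wedge e (F q)) p = wedge e ('D_u F p).
Proof.
move=> dF; rewrite /wedge !derive_coord //.
have dx := differentiable_coord_comp ord0 dF.
have dy := differentiable_coord_comp ord_max dF.
have derivZ k (f : V -> C) : differentiable f p ->
    derivable (k \*: f) p u /\ 'D_u (k \*: f) p = k * 'D_u f p.
  move=> df; split; first by apply: diff_derivable; exact: differentiableZ.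
  by rewrite (deriveZ _ (diff_derivable df)).
have [d1 D1] := derivZ (xc e) _ dy; have [d2 D2] := derivZ (yc e) _ dx.
by rewrite -D1 -D2 -(deriveB d1 d2).
Qed.

(** The last axiom on the pair (e, e): the two curvature terms cancel because
    the connection is torsion free. *)
Lemma ASS4_diagonal mul e p :
  almost_saito N r (chrG r) mul (euler_field 1) (fun=> e) -> N p ->
  differentiable (fun q => chrG r q e e) p /\
  'D_e (fun q => chrG r q e e) p = - chrG r p (mul p e e) e.
Proof.
move=> S Np; split.
  have [_ [_ _ /(_ e e)[_ dG]] _ _ _ _ _ _ _ _ _] := S; exact: dG.
have /almost_saito_pointwise {}S := S.
have := pw_ASS4 S e e Np; rewrite (pw_torsion_free S e (chrG r p e e)) // addrK.
by move/eqP; rewrite addr_eq0 => /eqP.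
Qed.

(** Modulo [e], the vector [nabla_u e] at q is [L q * wedge u q] divided by the
    discriminant, for one linear form [L q = A y + B x].  At the zero [p] of [L]
    every [nabla_u e] is therefore a multiple of [e], so by the last axiom on
    (e, e) the derivative [L e * wedge e p] of the numerator along [e] vanishes.
    As [wedge e p = - L e], this gives [L e = 0].  The hypotheses on [A] and [B]
    say that [p] lies off the discriminant. *)
Lemma necessity_generic mul (a b : C) :
  let A := a ^+ 2 * r + 4 * b ^+ 2 * (r - 1) in
  let B := a * b * (1 - 2 * r) in
  almost_saito N r (chrG r) mul (euler_field 1) (fun=> vec2 a b) ->
  B != 0 -> A ^+ 2 - 4 * B ^+ 2 != 0 -> b * (a ^+ 2 - 4 * b ^+ 2) = 0.
Proof.
move=> A B S B0 AB0; pose p := vec2 A (- B); pose e := vec2 a b.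
have Np : N p by apply/NE; rewrite xc_vec2 yc_vec2 oppr_eq0 sqrrN.
have oN : open N by case: S.
have [dG DG] := ASS4_diagonal S Np.
have wedge_e q u : N q -> wedge e (chrG r q u e) =
    (A * yc q + B * xc q) * ((xc u * yc q - yc u * xc q) *
      (yc q * (xc q ^+ 2 - 4 * yc q ^+ 2))^-1).
  move=> /NE [y0 d0]; rewrite /chrG sym_bitensorE /chrG0 /chrG1 /chrG2 /e.
  rewrite !vec2_simp /wedge !xc_vec2 !yc_vec2 /A /B.
  by field; rewrite y0 d0.
have Lp : A * yc p + B * xc p = 0 by rewrite xc_vec2 yc_vec2; ring.
have Le : A * b + B * a = b * (a ^+ 2 - 4 * b ^+ 2) * (1 - r).
  by rewrite /A /B; ring.
have : 'D_e (fun q => wedge e (chrG r q e e)) p = 0.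
  by rewrite (derive_wedge _ _ dG) DG wedgeN wedge_e // Lp mul0r oppr0.
have [y0 d0] := (NE p).1 Np.
have -> : 'D_e (fun q => wedge e (chrG r q e e)) p =
    'D_e (fun q => (A * yc q + B * xc q) * ((a * yc q - b * xc q) *
      (yc q * (xc q ^+ 2 - 4 * yc q ^+ 2))^-1)) p.
  apply: near_eq_derive.
  have nearN : \near p, N p by exact: open_nbhs_nbhs.
  by near=> q; rewrite wedge_e /e ?xc_vec2 ?yc_vec2 //; near: q.
have [g0 [g1 [_ ->]]] : exists g0 g1, is_pd (fun q => (A * yc q + B * xc q) *
    ((a * yc q - b * xc q) * (yc q * (xc q ^+ 2 - 4 * yc q ^+ 2))^-1)) p
    (B * ((a * yc p - b * xc p) * (yc p * (xc p ^+ 2 - 4 * yc p ^+ 2))^-1)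
     + (A * yc p + B * xc p) * g0)
    (A * ((a * yc p - b * xc p) * (yc p * (xc p ^+ 2 - 4 * yc p ^+ 2))^-1)
     + (A * yc p + B * xc p) * g1).
  do 2 eexists; apply: pd_eq.
    eapply pdM; last by repeat pd_step; exact: mulf_neq0 y0 d0.
    by repeat pd_step.
    by rewrite /=; congr (_ + _); ring.
  by rewrite /=; congr (_ + _); ring.
rewrite Lp !mul0r !addr0 /e !xc_vec2 !yc_vec2.
move: y0 d0; rewrite /p !xc_vec2 !yc_vec2 oppr_eq0 => y0 d0.
rewrite (_ : _ + _ = - (b * (a ^+ 2 - 4 * b ^+ 2) * (1 - r)) ^+ 2
    * (- B * (A ^+ 2 - 4 * (- B) ^+ 2))^-1); last by rewrite -Le; ring.
move/eqP; rewrite mulf_eq0 invr_eq0 [X in _ || X]mulf_eq0 !oppr_eq0.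
by rewrite (negPf y0) (negPf d0) !orbF expf_eq0 /= mulf_eq0 (negPf r1) orbF => /eqP.
Unshelve. all: by end_near. Qed.

(** The component along [e] of the second axiom on (e, e), when the square of
    [e] is [al E + be e]. *)
Lemma ASS2_diagonal mul e p (al be : V -> C) a0 a1 b0 b1 :
  almost_saito N r (chrG r) mul (euler_field 1) (fun=> e) -> N p ->
  (forall q, N q -> mul q e e = al q *: q + be q *: e) ->
  is_pd al p a0 a1 -> is_pd be p b0 b1 -> wedge p e != 0 ->
  b0 * xc e + b1 * yc e + 2 * al p + be p ^+ 2 = 0.
Proof.
move=> S Np mulE [dal Dal] [dbe Dbe] pe0.
have oN : open N by case: S.
have [_ _ _ _ [holm mulC _ _ unit] _ _ _ _ _ _] := S.
have /almost_saito_pointwise {}S := S.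
have := pw_ASS2 S e e Np.
rewrite (_ : 'D_e _ p = 'D_e (fun q => al q *: q + be q *: e) p); last first.
  apply: near_eq_derive.
  have nearN : \near p, N p by exact: open_nbhs_nbhs.
  by near=> q; apply: mulE; near: q.
have -> : 'D_e (fun q => al q *: q + be q *: e) p =
   (a0 * xc e + a1 * yc e) *: p + al p *: e + (b0 * xc e + b1 * yc e) *: e.
  have dF : differentiable (fun q => al q *: q + be q *: e) p.
    apply: differentiable_colP => i.
    rewrite (_ : (fun q => _) = (al * (fun q => q i 0)) + (be * (fun=> e i 0))).
      by apply: differentiableD; apply: differentiableM => //;
        exact: differentiable_coord.
    by apply/funext => q; rewrite !mxE.
  apply/colP => i; rewrite derive_coord //.
  rewrite (_ : (fun q => _) = (al * (fun q => q i 0)) + (be * (fun=> e i 0))).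
    have dc : differentiable (fun q : V => q i 0) p by exact: differentiable_coord.
    have dk : differentiable (fun q : V => e i 0) p by exact: differentiable_cst.
    rewrite deriveD; try by apply: diff_derivable; exact: differentiableM.
    rewrite !deriveM; try exact: diff_derivable.
    rewrite Dal Dbe derive_cst -(derive_coord _ _ (_ : differentiable id p)) //.
    by rewrite derive_id !mxE /GRing.scale /=; ring.
  by apply/funext => q; rewrite !mxE.
have up : mul p e p = e by rewrite mulC // -[X in mul p X]/(id p) -euler1 unit.
rewrite mulE // (linfunD (bitensor_linearr _ holm Np)).
rewrite !(linfunZ (bitensor_linearr _ holm Np)) up mulE // => h.
have := congr1 (wedge p) h.
rewrite (_ : wedge p _ = wedge p e *
  (b0 * xc e + b1 * yc e + 2 * al p + be p ^+ 2)); last first.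
  by rewrite /wedge !mxE; ring.
rewrite (_ : wedge p 0 = 0); last by rewrite /wedge !mxE; ring.
by move/eqP; rewrite mulf_eq0 (negPf pe0) => /eqP.
Unshelve. all: by end_near. Qed.

(** Where [u |-> nabla_u e] is invertible, the last axiom on (e, e) computes
    the square of [e]. *)
Lemma square_of_field mul e (al be : V -> C) :
  almost_saito N r (chrG r) mul (euler_field 1) (fun=> e) ->
  (forall q, N q -> exists G, [/\ has_partials (chrG0 r) (chrG1 r) (chrG2 r) q G,
    wedge (comb e (chrG0 r q) (chrG1 r q)) (comb e (chrG1 r q) (chrG2 r q)) != 0 &
    comb e (comb e (comb e (d0x G) (d0y G)) (comb e (d1x G) (d1y G)))
         (comb e (comb e (d1x G) (d1y G)) (comb e (d2x G) (d2y G)))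
    + comb (al q *: q + be q *: e) (comb e (chrG0 r q) (chrG1 r q))
                     (comb e (chrG1 r q) (chrG2 r q)) = 0]) ->
  forall q, N q -> mul q e e = al q *: q + be q *: e.
Proof.
move=> S H q Nq; have [G [hG dG sG]] := H q Nq.
have [_] := ASS4_diagonal S Nq.
rewrite (sym_bitensor_partials _ _ _ hG) /chrG sym_bitensorE => D4.
apply/eqP; rewrite -subr_eq0; apply/eqP/(comb_inj dG).
move: sG; set X := comb e _ _ => /eqP; rewrite addr_eq0 => /eqP sX.
set Ge := comb e _ _ in sX *; set Gf := comb e _ _ in sX D4 *.
have -> : comb (mul q e e - (al q *: q + be q *: e)) Ge Gf =
   comb (mul q e e) Ge Gf - comb (al q *: q + be q *: e) Ge Gf.
  by apply/colP => i; rewrite !mxE; ring.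
have -> : comb (mul q e e) Ge Gf = - X.
  by rewrite -[LHS]opprK -D4 /X; congr (- _); apply/colP => i; rewrite !mxE; ring.
by rewrite sX opprK subrr.
Qed.

(** The last axiom computes the square of (0, 1), and the second axiom then fails
    at the point (1, 1), by a nonzero multiple of 1 - 2 r. *)
Lemma necessity_exceptional0 mul :
  ~ almost_saito N r (chrG r) mul (euler_field 1) (fun=> vec2 0 1).
Proof.
move=> S.
pose al q := (4 * (1 - r) - (2 * r - 1) * (xc q ^+ 2 / yc q ^+ 2))
  / ((1 - r) * (xc q ^+ 2 - 4 * yc q ^+ 2)).
pose be q := - 8 * yc q / (xc q ^+ 2 - 4 * yc q ^+ 2).
have sq q : N q -> mul q (vec2 0 1) (vec2 0 1) = al q *: q + be q *: vec2 0 1.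
  apply: square_of_field S _ q => q /NE [y0 d0].
  refine (ex_intro _ (Partials _ _ _ _ _ _) _); split.
  - by split; apply: vpd_vec2; try reflexivity; repeat pd_step;
      rewrite ?mulf_neq0.
  - rewrite /chrG0 /chrG1 /chrG2 !vec2_simp /wedge !xc_vec2 !yc_vec2.
    rewrite (_ : _ - _ = - 4 * (1 - r) ^+ 2 / (xc q ^+ 2 - 4 * yc q ^+ 2)).
      by rewrite mulf_neq0 ?invr_neq0 // mulf_neq0 ?expf_neq0 // oppr_eq0 pnatr_eq0.
    by field; rewrite y0 d0.
  - rewrite /chrG0 /chrG1 /chrG2 /= /al /be [X in _ *: X + _](vec2E q).
    rewrite !vec2Z !vec2_simp; by congr vec2; field; rewrite ?y0 ?d0 ?r1.
have Np : N (vec2 1 1).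
  apply/NE; rewrite xc_vec2 yc_vec2 oner_eq0; split=> //.
  by rewrite (_ : _ - _ = - 3) ?oppr_eq0 ?pnatr_eq0 //; ring.
have [a0 [a1 [b0 [b1 [hal hbe]]]]] : exists a0 a1 b0 b1,
   [/\ is_pd al (vec2 1 1) a0 a1, is_pd be (vec2 1 1) b0 b1 &
     b0 * 0 + b1 * 1 + 2 * al (vec2 1 1) + be (vec2 1 1) ^+ 2 != 0].
  have [y0 d0] := (NE _).1 Np.
  do 4 eexists; split.
  - by rewrite /al; repeat pd_step; rewrite ?mulf_neq0.
  - by rewrite /be; repeat pd_step.
  rewrite /al /be /= !xc_vec2 !yc_vec2.
  set X := (X in X != 0).
  have -> : X = 2 * (1 - 2 * r) / ((1 - r) * (- 3)).
    by rewrite /X; field; rewrite ?r1.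
  by rewrite mulf_neq0 ?invr_neq0 ?mulf_neq0 ?oppr_eq0 ?pnatr_eq0.
apply/negP; rewrite negbK; apply/eqP.
have := ASS2_diagonal S Np sq hal hbe.
rewrite /wedge !xc_vec2 !yc_vec2; apply.
by rewrite mulr1 mulr0 subr0 oner_eq0.
Qed.

(** For these fields the zero of the linear form [L] lies on the line x = - 2 t y
    of the discriminant.  The last axiom still computes the square of the field,
    and the second axiom fails at the point (0, 1), by a nonzero multiple of
    1 - r. *)
Lemma necessity_exceptional mul (t : C) : t = 1 \/ t = -1 ->
  ~ almost_saito N r (chrG r) mul (euler_field 1)
      (fun=> vec2 (2 * t * (1 - r) / r) 1).
Proof.
move=> t1 S; set a := 2 * t * (1 - r) / r in S.
pose m q := xc q + 2 * t * yc q.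
pose D q := yc q * (xc q - 2 * t * yc q).
pose al q := ((2 * r - 1) * a - 2 * t
   + 4 / r * ((2 * yc q * m q - 2 * t / r * yc q ^+ 2) / m q ^+ 2))
  / ((1 - r) * D q).
pose be q := (xc q + (a - 4 * t) * yc q) / D q.
have mD q : N q -> [/\ yc q != 0, xc q - 2 * t * yc q != 0, m q != 0 & D q != 0].
  move=> /NE [y0 d0].
  have : (xc q - 2 * t * yc q) * m q != 0.
    by rewrite (_ : _ * _ = xc q ^+ 2 - 4 * yc q ^+ 2) // /m; case: t1 => ->; ring.
  by rewrite mulf_eq0 negb_or => /andP[d1 m0]; split=> //; rewrite mulf_neq0.
have sq q : N q -> mul q (vec2 a 1) (vec2 a 1) = al q *: q + be q *: vec2 a 1.
  apply: square_of_field S _ q => q Nq; have [y0 d1 m0 D0] := mD q Nq.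
  have [_ d0] := (NE q).1 Nq.
  refine (ex_intro _ (Partials _ _ _ _ _ _) _); split.
  - by split; apply: vpd_vec2; try reflexivity; repeat pd_step;
      rewrite ?mulf_neq0.
  - rewrite /chrG0 /chrG1 /chrG2 !vec2_simp /wedge !xc_vec2 !yc_vec2.
    rewrite (_ : _ - _ = 2 * t * (1 - r) ^+ 2 * (1 - 2 * r) / (r * D q)).
      rewrite mulf_neq0 ?invr_neq0 ?mulf_neq0 ?expf_neq0 ?pnatr_eq0 //.
      by case: t1 => ->; rewrite ?oppr_eq0 oner_eq0.
    rewrite /D /a; move: d1 m0; rewrite /m; case: t1 => ->;
      rewrite ?mulr1 ?mulrN1 => d1 m0; by field; rewrite ?y0 ?d0 ?r0 ?d1.
  - rewrite /chrG0 /chrG1 /chrG2 /= /al /be [X in _ *: X + _](vec2E q).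
    rewrite !vec2_simp /D /a /m; move: d1 m0; rewrite /m; case: t1 => ->;
      rewrite ?mulr1 ?mulrN1 => d1 m0;
      by congr vec2; field; rewrite ?y0 ?d0 ?r0 ?d1 ?m0 ?r1.
have Np : N (vec2 0 1).
  apply/NE; rewrite xc_vec2 yc_vec2 oner_eq0; split=> //.
  by rewrite (_ : _ - _ = - 4) ?oppr_eq0 ?pnatr_eq0 //; ring.
have t0 : t != 0 by case: t1 => ->; rewrite ?oppr_eq0 oner_eq0.
have [a0 [a1 [b0 [b1 [hal hbe]]]]] : exists a0 a1 b0 b1,
   [/\ is_pd al (vec2 0 1) a0 a1, is_pd be (vec2 0 1) b0 b1 &
     b0 * a + b1 * 1 + 2 * al (vec2 0 1) + be (vec2 0 1) ^+ 2 != 0].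
  have [y0 d1 m0 D0] := mD _ Np.
  do 4 eexists; split.
  - by rewrite /al /m /D; repeat pd_step; rewrite ?mulf_neq0.
  - by rewrite /be /D; repeat pd_step.
  rewrite /al /be /m /D /a /= !xc_vec2 !yc_vec2.
  set X := (X in X != 0).
  have -> : X = 2 * (1 - r) / r ^+ 2.
    by rewrite /X; case: t1 => ->; field; rewrite ?r0 ?r1.
  by rewrite mulf_neq0 ?invr_neq0 ?mulf_neq0 ?expf_neq0 ?pnatr_eq0.
apply/negP; rewrite negbK; apply/eqP.
have := ASS2_diagonal S Np sq hal hbe.
rewrite /wedge !xc_vec2 !yc_vec2; apply.
rewrite mul0r mul1r sub0r oppr_eq0 /a.
by rewrite mulf_neq0 ?invr_neq0 ?mulf_neq0 ?pnatr_eq0.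
Qed.

(** The discriminant consists of the lines y = 0, x = 2 y and x = - 2 y.  For a
    direction off these lines, either the zero of [L] is a regular point, which
    is impossible, or the direction is one of the exceptional ones. *)
Lemma necessity mul (a b : C) :
  almost_saito N r (chrG r) mul (euler_field 1) (fun=> vec2 a b) ->
  [\/ b = 0, a = 2 * b | a = - 2 * b].
Proof.
move=> S; have [->|b0] := eqVneq b 0; first by constructor 1.
have [a1|a1] := eqVneq a (2 * b); first by constructor 2.
have [a2|a2] := eqVneq a (- 2 * b); first by constructor 3.
exfalso.
have S1 : almost_saito N r (chrG r) mul (euler_field 1) (fun=> vec2 (a / b) 1).
  have := almost_saito_scale (invr_neq0 b0) S.
  by rewrite vec2Z mulVf // mulrC.
have ab0 : b * (a ^+ 2 - 4 * b ^+ 2) != 0.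
  rewrite mulf_neq0 // (_ : _ - _ = (a - 2 * b) * (a + 2 * b)); last by ring.
  by rewrite mulf_neq0 ?subr_eq0 // -[2 * b]opprK subr_eq0 -mulNr.
have [a0|a0] := eqVneq a 0.
  by move: S1; rewrite a0 mul0r; exact: necessity_exceptional0.
pose A := a ^+ 2 * r + 4 * b ^+ 2 * (r - 1); pose B := a * b * (1 - 2 * r).
have B0 : B != 0 by rewrite !mulf_neq0.
have [AB|AB] := eqVneq (A ^+ 2 - 4 * B ^+ 2) 0; last first.
  by move: ab0; rewrite (necessity_generic S B0 AB) eqxx.
have exc t : t = 1 \/ t = -1 -> A - 2 * t * B = 0 -> False.
  move=> t1 AB0; have : (a + 2 * t * b) * (r * a - 2 * t * b * (1 - r)) = 0.
    by rewrite -[RHS]AB0 /A /B; case: t1 => ->; ring.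
  move/eqP; rewrite mulf_eq0 => /orP[|] /eqP h.
    case: t1 h => ->; rewrite ?mulr1 ?mulrN1 => /eqP; rewrite addr_eq0.
      by rewrite -mulNr (negPf a2).
    by rewrite mulNr opprK (negPf a1).
  apply: (@necessity_exceptional mul t t1).
  have <- : a / b = 2 * t * (1 - r) / r.
    apply: (mulIf b0); rewrite divfK //; apply: (mulfI r0).
    by rewrite (subr0_eq h); field; rewrite r0.
  exact: S1.
have : (A - 2 * 1 * B) * (A - 2 * (-1) * B) = 0 by rewrite -[RHS]AB; ring.
move/eqP; rewrite mulf_eq0 => /orP[] /eqP; apply: exc; by [left|right].
Qed.

End Necessity.

(** * Matrices of size two *)

Section Matrices2.
Variable C : fieldType.

Definition mat2 (a b c d : C) : 'M[C]_2 :=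
  \matrix_(i, j) if i == ord0 then (if j == ord0 then a else b)
                 else (if j == ord0 then c else d).

Lemma ord2P (i : 'I_2) : i = ord0 \/ i = ord_max.
Proof. by case: i => [[|[|//]] hi]; [left|right]; exact: val_inj. Qed.

Lemma mat2P (A B : 'M[C]_2) :
  A ord0 ord0 = B ord0 ord0 -> A ord0 ord_max = B ord0 ord_max ->
  A ord_max ord0 = B ord_max ord0 -> A ord_max ord_max = B ord_max ord_max ->
  A = B.
Proof.
move=> h1 h2 h3 h4; apply/matrixP => i j.
by case: (ord2P i) => ->; case: (ord2P j) => ->.
Qed.

Lemma sum2 (V : zmodType) (F : 'I_2 -> V) : \sum_i F i = F ord0 + F ord_max.
Proof. by rewrite big_ord_recr big_ord1 /=; congr (F _ + _); exact: val_inj. Qed.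

Lemma prod2 (F : 'I_2 -> C) : \prod_i F i = F ord0 * F ord_max.
Proof. by rewrite big_ord_recr big_ord1 /=; congr (F _ * _); exact: val_inj. Qed.

Lemma mat2M a b c d a' b' c' d' : mat2 a b c d *m mat2 a' b' c' d' =
  mat2 (a * a' + b * c') (a * b' + b * d') (c * a' + d * c') (c * b' + d * d').
Proof. by apply: mat2P; rewrite !mxE sum2 !mxE. Qed.

Lemma mat2_1 : 1%:M = mat2 1 0 0 1.
Proof. by apply: mat2P; rewrite !mxE. Qed.

Lemma invmx_mat2 a b c d a' b' c' d' :
  mat2 a b c d *m mat2 a' b' c' d' = 1%:M ->
  mat2 a b c d \in unitmx /\ invmx (mat2 a b c d) = mat2 a' b' c' d'.
Proof.
move=> h; have [uA uB] := mulmx1_unit h; split=> //.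
by rewrite -[RHS](mulKmx uA) h mulmx1.
Qed.

Lemma rank1_mat2 (A : 'M[C]_2) : A != 0 ->
  A ord0 ord0 * A ord_max ord_max = A ord0 ord_max * A ord_max ord0 ->
  \rank A = 1%N.
Proof.
move=> A0 h.
have rA0 : \rank A != 0%N by rewrite mxrank_eq0.
suff : \rank A != 2 by have := rank_leq_row A; case: (\rank A) rA0 => [|[|[|]]].
apply/eqP => r2; have : A \in unitmx by rewrite -row_full_unit /row_full r2.
rewrite unitmxE.
have -> : \det A = 0.
  rewrite (expand_det_row _ ord0) sum2 /cofactor !det_mx11 !mxE /=.
  have -> : lift ord0 ord0 = ord_max :> 'I_2 by exact: val_inj.
  have -> : lift ord_max ord0 = ord0 :> 'I_2 by exact: val_inj.
  by rewrite expr0 expr1 mul1r h mulN1r mulrN subrr.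
by rewrite unitr0.
Qed.

End Matrices2.

(** * Monomial groups *)

Section MonomialGroups.
Variable C : numFieldType.
Implicit Types (a b z w : C) (m p : nat) (A B : 'M[C]_2).

(** The group t^-1 G(m,p,2) t, where t = diag(z, 1). *)
Definition mono m p z : set 'M[C]_2 := [set A | exists a b,
  [/\ a ^+ m = 1, b ^+ m = 1, (a * b) ^+ (m %/ p) = 1 &
      A = mat2 a 0 0 b \/ A = mat2 0 (a / z) (z * b) 0]].

Lemma Gmpn_mono m p : Gmpn C m p 2 = mono m p 1.
Proof.
apply/seteqP; split=> A.
  case=> th [s [thm thp ->]]; exists (th ord0), (th ord_max).
  split; rewrite -?prod2 //.
  have entry i j : (diag_mx (\row_i th i) *m perm_mx s) i j = th i * (s i == j)%:R.
    by rewrite mul_diag_mx !mxE.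
  have sinj : s ord0 != s ord_max by rewrite (inj_eq perm_inj).
  have [s0|s0] := ord2P (s ord0); have [s1|s1] := ord2P (s ord_max);
    move: sinj; rewrite s0 s1 ?eqxx // => _; [left|right];
    apply: mat2P; rewrite entry !mxE /= ?s0 ?s1 /=;
    by rewrite ?divr1 ?mul1r ?mulr1 ?mulr0.
case=> a [b [am bm abp] hA].
pose th (i : 'I_2) := if i == ord0 then a else b.
have thm i : th i ^+ m = 1 by rewrite /th; case: ifP.
have thp : (\prod_i th i) ^+ (m %/ p) = 1 by rewrite prod2.
case: hA => ->.
  exists th, 1%g; split=> //; rewrite perm_mx1 mulmx1.
  by apply: mat2P; rewrite !mxE /= ?mulr1n ?mulr0n.
exists th, (tperm ord0 ord_max); split=> //.
by apply: mat2P; rewrite mul_diag_mx !mxE ?tpermL ?tpermR /=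
  ?divr1 ?mul1r ?mulr1 ?mulr0.
Qed.

Lemma inv_diag2 a b : a != 0 -> b != 0 ->
  mat2 a 0 0 b \in unitmx /\ invmx (mat2 a 0 0 b) = mat2 a^-1 0 0 b^-1.
Proof.
move=> a0 b0; apply: invmx_mat2.
by rewrite mat2M mat2_1 !mulr0 !mul0r !addr0 add0r !divff.
Qed.

Lemma inv_anti2 a b : a != 0 -> b != 0 ->
  mat2 0 a b 0 \in unitmx /\ invmx (mat2 0 a b 0) = mat2 0 b^-1 a^-1 0.
Proof.
move=> a0 b0; apply: invmx_mat2.
by rewrite mat2M mat2_1 !mulr0 !mul0r !addr0 !add0r !divff.
Qed.

Lemma conj_mono m p z : z != 0 ->
  [set invmx (diag_mx (\row_i (if i == ord0 then z else 1))) *m A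
       *m diag_mx (\row_i (if i == ord0 then z else 1)) | A in mono m p 1]
  = mono m p z.
Proof.
move=> z0.
have -> : diag_mx (\row_i (if i == ord0 then z else 1)) = mat2 z 0 0 1.
  by apply: mat2P; rewrite !mxE /= ?mulr1n ?mulr0n.
have [_ ->] := inv_diag2 z0 (oner_neq0 C).
apply/seteqP; split=> A.
  case=> _ [a [b [am bm abp [->|->]]]] <-; exists a, b; split=> //.
    left; rewrite !mat2M invr1; by congr mat2; field; rewrite ?z0.
  right; rewrite !mat2M invr1; by congr mat2; field; rewrite ?z0.
case=> a [b [am bm abp [->|->]]].
  exists (mat2 a 0 0 b); first by exists a, b; split=> //; left.
  rewrite !mat2M invr1; by congr mat2; field; rewrite ?z0.
exists (mat2 0 (a / 1) (1 * b) 0); first by exists a, b; split=> //; right.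
rewrite !mat2M invr1; by congr mat2; field; rewrite ?z0.
Qed.

Lemma root1_neq0 a m : (0 < m)%N -> a ^+ m = 1 -> a != 0.
Proof.
by move=> m0 am; apply/eqP => a0; move/eqP: am;
  rewrite a0 expr0n eqn0Ngt m0 eq_sym oner_eq0.
Qed.

Lemma mono_group m p z : (0 < m)%N -> z != 0 -> is_group (mono m p z).
Proof.
move=> m0 z0; split.
- by exists 1, 1; rewrite mulr1 !expr1n; split=> //; left; rewrite mat2_1.
- move=> A B [a [b [am bm abp hA]]] [a' [b' [am' bm' abp' hB]]].
  have key (x y x' y' : C) : x ^+ m = 1 -> x' ^+ m = 1 -> y ^+ m = 1 -> y' ^+ m = 1 ->
     (x * y) ^+ (m %/ p) = 1 -> (x' * y') ^+ (m %/ p) = 1 ->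
     [/\ (x * x') ^+ m = 1, (y * y') ^+ m = 1 &
         (x * x' * (y * y')) ^+ (m %/ p) = 1].
    move=> xm xm' ym ym' h h'; split.
    - by rewrite exprMn xm xm' mulr1.
    - by rewrite exprMn ym ym' mulr1.
    - by rewrite mulrACA exprMn h h' mulr1.
  have bap' : (b' * a') ^+ (m %/ p) = 1 by rewrite mulrC.
  case: hA hB => -> [] ->; rewrite mat2M.
  + have [h1 h2 h3] := key a b a' b' am am' bm bm' abp abp'.
    exists (a * a'), (b * b'); split=> //; left; by congr mat2; ring.
  + have [h1 h2 h3] := key a b a' b' am am' bm bm' abp abp'.
    exists (a * a'), (b * b'); split=> //; right; by congr mat2; field; rewrite ?z0.
  + have [h1 h2 h3] := key a b b' a' am bm' bm am' abp bap'.
    exists (a * b'), (b * a'); split=> //; right; by congr mat2; field; rewrite ?z0.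
  + have [h1 h2 h3] := key a b b' a' am bm' bm am' abp bap'.
    exists (a * b'), (b * a'); split=> //; left; by congr mat2; field; rewrite ?z0.
- move=> A [a [b [am bm abp hA]]].
  have a0 := root1_neq0 m0 am; have b0 := root1_neq0 m0 bm.
  have am' : a^-1 ^+ m = 1 by rewrite exprVn am invr1.
  have bm' : b^-1 ^+ m = 1 by rewrite exprVn bm invr1.
  have abp' : (a^-1 * b^-1) ^+ (m %/ p) = 1 by rewrite -invfM exprVn abp invr1.
  case: hA => ->.
    by have [-> ->] := inv_diag2 a0 b0; split=> //; exists a^-1, b^-1; split=> //; left.
  have [-> ->] := inv_anti2 (mulf_neq0 a0 (invr_neq0 z0)) (mulf_neq0 z0 b0).
  split=> //; exists b^-1, a^-1; split=> //; first by rewrite mulrC.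
  by right; congr mat2; field; rewrite ?a0 ?b0 ?z0.
Qed.

(** Conjugation by an element of G(2k,2,2) with nonzero entries c, d changes the
    entries of an antidiagonal element by factors c / d, d / c and z^2, whose
    k-th powers are 1: indeed (c / d)^k = c^(2k) / (c d)^k. *)
Lemma mono_normal_B k z s : (0 < k)%N -> z ^+ k = s -> s = 1 \/ s = -1 ->
  normal_subgroup (mono k 1 z) (mono (2 * k) 2 1).
Proof.
move=> k0 zk s1.
have s2 : s * s = 1 by case: s1 => ->; rewrite ?mulrNN mulr1.
have z0 : z != 0.
  by apply: (@root1_neq0 _ (k * 2)); rewrite ?muln_gt0 ?k0 // exprM zk expr2.
have k20 : (0 < 2 * k)%N by rewrite muln_gt0.
split; [exact: mono_group | exact: mono_group (oner_neq0 C) | |].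
  move=> A [a [b [am bm _ hA]]]; case: hA => ->.
    exists a, b; rewrite mulKn // exprMn !(mulnC 2 k) !exprM am bm expr1n mulr1.
    by split=> //; left.
  exists (a / z), (z * b); rewrite mulKn //; split.
  - by rewrite mulnC exprM exprMn exprVn am zk mul1r exprVn expr2 s2 invr1.
  - by rewrite mulnC exprM exprMn bm zk mulr1 expr2 s2.
  - rewrite (_ : _ * _ = a * b); last by field; rewrite ?z0.
    by rewrite exprMn am bm mulr1.
  - by right; rewrite divr1 mul1r.
have key (c d : C) : c ^+ (2 * k) = 1 -> d ^+ (2 * k) = 1 ->
   (c * d) ^+ (2 * k %/ 2) = 1 -> (c / d) ^+ k = 1.
  move=> cm dm; rewrite mulKn // => cd; have d0 := root1_neq0 k20 dm.
  have <- : c ^+ (2 * k) / (c * d) ^+ k = (c / d) ^+ k.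
    have c0 := root1_neq0 k20 cm.
    rewrite mul2n -addnn exprD !exprMn exprVn.
    by field; rewrite !expf_neq0.
  by rewrite cm cd divr1.
move=> A B [c [d [cm dm cdp hA]]] [a [b [am bm abp hB]]].
have c0 := root1_neq0 k20 cm; have d0 := root1_neq0 k20 dm.
have a0 := root1_neq0 k0 am; have b0 := root1_neq0 k0 bm.
have cd1 := key c d cm dm cdp.
have dc1 : (d / c) ^+ k = 1 by apply: key => //; rewrite mulrC.
have abk : (a * b) ^+ k = 1 by rewrite exprMn am bm mulr1.
case: hA hB => -> [] ->.
- have [_ ->] := inv_diag2 c0 d0; exists a, b; split=> //; left.
  rewrite !mat2M; by congr mat2; field; rewrite ?c0 ?d0.
- have [_ ->] := inv_diag2 c0 d0.
  exists (a * (c / d)), (b * (d / c)); rewrite divn1.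
  have h1 : (a * (c / d)) ^+ k = 1 by rewrite exprMn am cd1 mulr1.
  have h2 : (b * (d / c)) ^+ k = 1 by rewrite exprMn bm dc1 mulr1.
  split=> //; first by rewrite exprMn h1 h2 mulr1.
  by right; rewrite !mat2M; congr mat2; field; rewrite ?c0 ?d0 ?z0.
- rewrite divr1 mul1r; have [_ ->] := inv_anti2 c0 d0.
  exists b, a; split=> //; first by rewrite mulrC.
  by left; rewrite !mat2M; congr mat2; field; rewrite ?c0 ?d0.
- rewrite divr1 mul1r; have [_ ->] := inv_anti2 c0 d0.
  exists (z * z * b * (c / d)), (a / (z * z) * (d / c)); rewrite divn1.
  have h1 : (z * z * b * (c / d)) ^+ k = 1.
    by rewrite exprMn cd1 !exprMn bm zk s2 !mulr1.
  have h2 : (a / (z * z) * (d / c)) ^+ k = 1.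
    by rewrite exprMn dc1 exprMn am exprVn exprMn zk s2 invr1 !mulr1.
  split=> //; first by rewrite exprMn h1 h2 mulr1.
  by right; rewrite !mat2M; congr mat2; field; rewrite ?c0 ?d0 ?z0.
Qed.

Lemma mono_normal_D k : (0 < k)%N ->
  normal_subgroup (mono (2 * k) (2 * k) 1) (mono (2 * k) 2 1).
Proof.
move=> k0; have k20 : (0 < 2 * k)%N by rewrite muln_gt0.
split; [exact: mono_group (oner_neq0 C) | exact: mono_group (oner_neq0 C) | |].
  move=> A [a [b [am bm]]]; rewrite divnn k20 expr1 => ab hA.
  by exists a, b; split=> //; rewrite ab expr1n.
move=> A B [c [d [cm dm cdp hA]]] [a [b [am bm]]]; rewrite divnn k20 expr1 => ab hB.
have c0 := root1_neq0 k20 cm; have d0 := root1_neq0 k20 dm.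
have a0 := root1_neq0 k20 am; have b0 := root1_neq0 k20 bm.
have cd1 (x y : C) : x ^+ (2 * k) = 1 -> y ^+ (2 * k) = 1 -> (x / y) ^+ (2 * k) = 1.
  by move=> xm ym; rewrite exprMn exprVn xm ym divr1.
have e1 : (2 * k %/ (2 * k) = 1)%N by rewrite divnn k20.
have mx (x y : C) : x ^+ (2 * k) = 1 -> y ^+ (2 * k) = 1 -> (x * y) ^+ (2 * k) = 1.
  by move=> xm ym; rewrite exprMn xm ym mulr1.
case: hA hB => -> [] ->; rewrite ?divr1 ?mul1r.
- have [_ ->] := inv_diag2 c0 d0; exists a, b; rewrite e1 expr1; split=> //; left.
  by rewrite !mat2M; congr mat2; field; rewrite ?c0 ?d0.
- have [_ ->] := inv_diag2 c0 d0.
  exists (a * (c / d)), (b * (d / c)); rewrite e1 expr1.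
  split; [by rewrite mx ?cd1|by rewrite mx ?cd1| |].
    by rewrite mulrACA ab mul1r mulrA divfK // divff.
  by right; rewrite !mat2M; congr mat2; field; rewrite ?c0 ?d0.
- have [_ ->] := inv_anti2 c0 d0.
  exists b, a; rewrite e1 expr1 mulrC; split=> //.
  by left; rewrite !mat2M; congr mat2; field; rewrite ?c0 ?d0.
- have [_ ->] := inv_anti2 c0 d0.
  exists (b * (c / d)), (a * (d / c)); rewrite e1 expr1.
  split; [by rewrite mx ?cd1|by rewrite mx ?cd1| |].
    by rewrite mulrACA (mulrC b) ab mul1r mulrA divfK // divff.
  by right; rewrite !mat2M; congr mat2; field; rewrite ?c0 ?d0.
Qed.

End MonomialGroups.

Section DualityGroups.
Variable C : numFieldType.
Implicit Types (a b z w : C) (m p k : nat) (A B : 'M[C]_2) (G : set 'M[C]_2).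

Lemma mono_finite m p z w : m.-primitive_root w -> finite_set (mono m p z).
Proof.
move=> pw; pose f (t : 'I_m * 'I_m * bool) : 'M[C]_2 :=
  if t.2 then mat2 (w ^+ t.1.1) 0 0 (w ^+ t.1.2)
  else mat2 0 (w ^+ t.1.1 / z) (z * w ^+ t.1.2) 0.
apply: (@sub_finite_set _ _ (f @` [set: _])).
  move=> A [a [b [am bm _ hA]]].
  have [i ai] := prim_rootP pw am; have [j bj] := prim_rootP pw bm.
  by case: hA => ->; [exists (i, j, true)|exists (i, j, false)];
    rewrite // /f ai bj.
exact/finite_image/finite_finset.
Qed.

(** The diagonal element separates the coordinate axes and the antidiagonal one
    exchanges them. *)
Lemma diag_anti_irreducible G a b c d : a != b -> c != 0 -> d != 0 ->
  G (mat2 a 0 0 b) -> G (mat2 0 c d 0) -> irreducible_group G.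
Proof.
move=> ab c0 d0 Gab Gcd W stabW.
have [|rW] := eqVneq (\rank W) 0%N; first by left.
right; have W0 : W != 0 by rewrite -mxrank_eq0.
have [i wi0] : exists i, row i W != 0.
  apply/existsP; apply: contraNT W0 => /existsPn h.
  by apply/eqP/row_matrixP => i; rewrite row0; apply/eqP; have := h i; rewrite negbK.
set w := row i W in wi0; have wW : (w <= W)%MS by exact: row_sub.
have stab A (u : 'rV[C]_2) : G A -> (u <= W)%MS -> (u *m A^T <= W)%MS.
  by move=> GA uW; apply: submx_trans (stabW _ GA); exact: submxMr.
have e0D (u : 'rV[C]_2) : u *m (mat2 a 0 0 b)^T - b *: u = ((a - b) * u 0 ord0) *: delta_mx 0 ord0.
  apply/rowP => j; rewrite !mxE sum2 !mxE.
  by case: (ord2P j) => -> /=; ring.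
have e1D (u : 'rV[C]_2) : u *m (mat2 a 0 0 b)^T - a *: u =
    ((b - a) * u 0 ord_max) *: delta_mx 0 ord_max.
  apply/rowP => j; rewrite !mxE sum2 !mxE.
  by case: (ord2P j) => -> /=; ring.
have scal (x : C) (u : 'rV[C]_2) : x != 0 -> (x *: u <= W)%MS -> (u <= W)%MS.
  by move=> x0; rewrite eqmx_scale.
have swap0 : (delta_mx 0 ord0 : 'rV[C]_2) *m (mat2 0 c d 0)^T = d *: delta_mx 0 ord_max.
  apply/rowP => j; rewrite !mxE sum2 !mxE.
  by case: (ord2P j) => -> /=; ring.
have swap1 : (delta_mx 0 ord_max : 'rV[C]_2) *m (mat2 0 c d 0)^T = c *: delta_mx 0 ord0.
  apply/rowP => j; rewrite !mxE sum2 !mxE.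
  by case: (ord2P j) => -> /=; ring.
have ba : b - a != 0 by rewrite subr_eq0 eq_sym.
have both : ((delta_mx 0 ord0 : 'rV[C]_2) <= W)%MS /\
            ((delta_mx 0 ord_max : 'rV[C]_2) <= W)%MS.
  have [w0|w0] := eqVneq (w 0 ord0) 0.
    have w1 : w 0 ord_max != 0.
      apply: contraNneq wi0 => w1; apply/eqP/rowP => j; rewrite [RHS]mxE.
      by case: (ord2P j) => ->.
    have h1 : ((delta_mx 0 ord_max : 'rV[C]_2) <= W)%MS.
      apply: (scal ((b - a) * w 0 ord_max)); first by rewrite mulf_neq0.
      by rewrite -e1D addmx_sub ?eqmx_opp ?scalemx_sub ?stab.
    by split=> //; apply: (scal c) => //; rewrite -swap1 stab.
  have h0 : ((delta_mx 0 ord0 : 'rV[C]_2) <= W)%MS.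
    apply: (scal ((a - b) * w 0 ord0)); first by rewrite mulf_neq0 // subr_eq0.
    by rewrite -e0D addmx_sub ?eqmx_opp ?scalemx_sub ?stab.
  by split=> //; apply: (scal d) => //; rewrite -swap0 stab.
suff : row_full W by move/eqP.
rewrite -sub1mx; apply/row_subP => j.
by rewrite row1; case: (ord2P j) => ->; case: both.
Qed.

Lemma anti_reflection c d : c * d = 1 -> @is_reflection C 1 (mat2 0 c d 0).
Proof.
move=> cd; rewrite /is_reflection; apply/eqP/rank1_mat2; last by rewrite !mxE /= !subr0 cd; ring.
apply/eqP => /matrixP /(_ ord0 ord0); rewrite !mxE /= => /eqP.
by rewrite sub0r oppr_eq0 oner_eq0.
Qed.

Lemma diag_reflection a : a != 1 -> @is_reflection C 1 (mat2 a 0 0 1).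
Proof.
move=> a1; rewrite /is_reflection; apply/eqP/rank1_mat2; last by rewrite !mxE /=; ring.
apply/eqP => /matrixP /(_ ord0 ord0); rewrite !mxE /= => /eqP.
by rewrite subr_eq0 (negPf a1).
Qed.

Lemma group_pow2 G a b i : is_group G -> G (mat2 a 0 0 b) ->
  G (mat2 (a ^+ i) 0 0 (b ^+ i)).
Proof.
move=> [G1 GM _] Gab; elim: i => [|i IHi]; first by rewrite !expr0 -mat2_1.
rewrite !exprS (_ : mat2 _ _ _ _ = mat2 a 0 0 b *m mat2 (a ^+ i) 0 0 (b ^+ i)).
  exact: GM.
by rewrite mat2M; congr mat2; ring.
Qed.

(** The product of two antidiagonal reflections generates the diagonal subgroup,
    which is cyclic. *)
Lemma duality_D m w : (2 < m)%N -> m.-primitive_root w -> @duality_group C 1 (mono m m 1).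
Proof.
move=> m2 pw; have m0 : (0 < m)%N by exact: prim_order_gt0 pw.
have wm := prim_expr_order pw; have w0 := root1_neq0 m0 wm.
have e1 : (m %/ m = 1)%N by rewrite divnn m0.
have memD (a : C) : a ^+ m = 1 -> mono m m 1 (mat2 a 0 0 a^-1).
  move=> am; have a0 := root1_neq0 m0 am; exists a, a^-1.
  by rewrite exprVn am invr1 divff // expr1n; split=> //; left.
have memA (a : C) : a ^+ m = 1 -> mono m m 1 (mat2 0 a a^-1 0).
  move=> am; have a0 := root1_neq0 m0 am; exists a, a^-1.
  rewrite exprVn am invr1 divff // expr1n; split=> //.
  by right; rewrite ?mulr1 mul1r.
have gen : generated_by (range (fun i : 'I_2 =>
    if i == ord0 then mat2 0 1 1 0 else mat2 0 w w^-1 0)) (mono m m 1).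
  split; first exact: mono_group (oner_neq0 C).
    move=> _ [i _ <-]; case: ifP => _; last exact: memA.
    by have := memA 1 (expr1n _ _); rewrite invr1.
  move=> H gH sH A [a [b [am bm]]]; rewrite e1 expr1 => ab hA.
  have [H1 HM _] := gH.
  have S1 : H (mat2 0 1 1 0) by apply: sH; exists ord0.
  have S2 : H (mat2 0 w w^-1 0) by apply: sH; exists ord_max.
  have R : H (mat2 w 0 0 w^-1).
    rewrite (_ : mat2 _ _ _ _ = mat2 0 w w^-1 0 *m mat2 0 1 1 0); first exact: HM.
    by rewrite mat2M; congr mat2; ring.
  have Hab : H (mat2 a 0 0 b).
    have a0 := root1_neq0 m0 am.
    have -> : b = a^-1 by apply: (mulfI a0); rewrite ab divff.
    have [i ->] := prim_rootP pw am.
    by rewrite -exprVn; exact: group_pow2.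
  case: hA => ->; first by [].
  rewrite (_ : mat2 _ _ _ _ = mat2 a 0 0 b *m mat2 0 1 1 0); first exact: HM.
  by rewrite mat2M; congr mat2; field.
split; first exact: mono_finite pw.
  apply: (@diag_anti_irreducible _ w w^-1 1 1); rewrite ?oner_neq0 //.
  - apply/eqP => ww; have /eqP : w ^+ 2 = 1 by rewrite expr2 {2}ww divff.
    by rewrite -(prim_order_dvd pw) => /dvdn_leq -/(_ isT); rewrite leqNgt m2.
  - exact: memD.
  - by have := memA 1 (expr1n _ _); rewrite invr1.
exists (fun i : 'I_2 => if i == ord0 then mat2 0 1 1 0 else mat2 0 w w^-1 0).
split=> // i; case: ifP => _; apply: anti_reflection; first by rewrite mulr1.
by rewrite divff.
Qed.

(** The antidiagonal reflection conjugates diag(w, 1) to diag(1, w), and these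
    two generate the diagonal subgroup. *)
Lemma duality_B k w z : (1 < k)%N -> k.-primitive_root w -> z != 0 ->
  @duality_group C 1 (mono k 1 z).
Proof.
move=> k1 pw z0; have k0 : (0 < k)%N by exact: prim_order_gt0 pw.
have wk := prim_expr_order pw; have w0 := root1_neq0 k0 wk.
have w1 : w != 1.
  apply/eqP => w1; have /eqP : w ^+ 1 = 1 by rewrite expr1.
  by rewrite -(prim_order_dvd pw) dvdn1 => /eqP k1'; rewrite k1' in k1.
have mem1 : mono k 1 z (mat2 0 z^-1 z 0).
  by exists 1, 1; rewrite !mulr1 !expr1n; split=> //; right; rewrite mul1r.
have mem2 : mono k 1 z (mat2 w 0 0 1).
  by exists w, 1; rewrite mulr1 divn1 expr1n; split=> //; left.
have gen : generated_by (range (fun i : 'I_2 =>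
    if i == ord0 then mat2 0 z^-1 z 0 else mat2 w 0 0 1)) (mono k 1 z).
  split; first exact: mono_group.
    by move=> _ [i _ <-]; case: ifP.
  move=> H gH sH A [a [b [am bm _ hA]]].
  have [H1 HM _] := gH.
  have S1 : H (mat2 0 z^-1 z 0) by apply: sH; exists ord0.
  have S2 : H (mat2 w 0 0 1) by apply: sH; exists ord_max.
  have S3 : H (mat2 1 0 0 w).
    rewrite (_ : mat2 _ _ _ _ =
      mat2 0 z^-1 z 0 *m mat2 w 0 0 1 *m mat2 0 z^-1 z 0).
      by apply: (HM) => //; exact: (HM).
    by rewrite !mat2M; congr mat2; field.
  have Hab : H (mat2 a 0 0 b).
    have [i ->] := prim_rootP pw am; have [j ->] := prim_rootP pw bm.
    rewrite (_ : mat2 _ _ _ _ =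
      mat2 (w ^+ i) 0 0 (1 ^+ i) *m mat2 (1 ^+ j) 0 0 (w ^+ j)).
      by apply: HM; exact: group_pow2.
    by rewrite mat2M !expr1n; congr mat2; ring.
  case: hA => ->; first by [].
  rewrite (_ : mat2 _ _ _ _ = mat2 a 0 0 b *m mat2 0 z^-1 z 0); first exact: HM.
  by rewrite mat2M; congr mat2; ring.
split; first exact: mono_finite pw.
  by apply: (@diag_anti_irreducible _ w 1 z^-1 z); rewrite ?invr_eq0.
exists (fun i : 'I_2 => if i == ord0 then mat2 0 z^-1 z 0 else mat2 w 0 0 1).
split=> // i; case: ifP => _; last exact: diag_reflection.
by apply: anti_reflection; rewrite mulVf.
Qed.

End DualityGroups.

(** * Reflection lines and orbit maps *)

Section OrbitMaps.
Variable C : numClosedFieldType.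
Local Notation V := 'cV[C]_2.
Implicit Types (z w : C) (m p n : nat) (v : V).

Lemma prim_root_exists n : (0 < n)%N -> exists w : C, n.-primitive_root w.
Proof.
pose p : {poly C} := 'X^n - 1; have [r Dp] := closed_field_poly_normal p.
move=> n_gt0; rewrite (monicP _) ?monicXnsubC // scale1r in Dp.
have rn1 : all n.-unity_root r.
  by apply/allP=> z; rewrite -root_prod_XsubC -Dp.
have sz_r : (n < (size r).+1)%N.
  by rewrite -(size_prod_XsubC r id) -Dp size_XnsubC.
have [|z] := hasP (has_prim_root n_gt0 rn1 _ sz_r); last by exists z.
by rewrite -separable_prod_XsubC -Dp separable_Xn_sub_1 // pnatr_eq0 -lt0n.
Qed.

(** The terms [S] and [T] of the sum have a known product, so the quadratic
    formula gives them; the roots are then taken so that the product of the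
    coordinates is the prescribed root of [Q]. *)
Lemma orbit_map_surjective m n z (P Q : C) : (0 < m)%N -> (0 < n)%N -> z != 0 ->
  exists v : V, yc v ^+ m + z ^+ m * xc v ^+ m = P /\ (xc v * yc v) ^+ n = Q.
Proof.
move=> m0 n0 z0; pose w := n.-root Q; have wn : w ^+ n = Q by exact: rootCK.
pose c := z ^+ m * w ^+ m.
pose d := sqrtC (P ^+ 2 - 4 * c); have d2 : d ^+ 2 = P ^+ 2 - 4 * c.
  by rewrite sqrtCK.
pose T := (P + d) / 2; pose S := P - T.
have two : 2 != 0 :> C by rewrite pnatr_eq0.
have ST : S * T = c.
  have -> : S * T = (P ^+ 2 - d ^+ 2) / 4 by rewrite /S /T; field.
  by rewrite d2; field.
have [T0|T0] := eqVneq T 0.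
  have w0 : w = 0.
    have /eqP : c = 0 by rewrite -ST T0 mulr0.
    rewrite /c mulf_eq0 (negPf (expf_neq0 _ z0)) /= expf_eq0 => /andP[_ /eqP //].
  have Q0 : Q = 0 by rewrite -wn w0 expr0n eqn0Ngt n0.
  exists (vec2 (m.-root (P / z ^+ m)) 0); rewrite xc_vec2 yc_vec2 rootCK //.
  rewrite !expr0n mulr0 expr0n !eqn0Ngt m0 n0 Q0; split=> //=.
  by rewrite add0r mulrC divfK // expf_neq0.
have rT0 : m.-root T != 0 by rewrite rootC_eq0.
exists (vec2 (w / m.-root T) (m.-root T)); rewrite xc_vec2 yc_vec2 divfK // wn.
split=> //; rewrite expr_div_n rootCK // mulrA -/c -ST mulfK //.
by rewrite /S addrC subrK.
Qed.

Lemma mat2_mul a b c d v : mat2 a b c d *m v =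
  vec2 (a * xc v + b * yc v) (c * xc v + d * yc v).
Proof. by apply: vec2P; rewrite !mxE sum2 !mxE. Qed.

(** An antidiagonal reflection fixes a line y = z b x with b^m = 1, and a
    diagonal one fixes an axis.  For p = m a diagonal element has mutually
    inverse entries, so it is not a reflection. *)
Lemma mono_hyperplane m p z v : (0 < m)%N -> z != 0 ->
  reflection_hyperplanes (mono m p z) v ->
  yc v ^+ m = z ^+ m * xc v ^+ m \/ (m %/ p != 1)%N /\ xc v * yc v = 0.
Proof.
move=> m0 z0 [A [[a [b [am bm abp [->|->]]]] refl Av]]; last first.
  left; move: Av; rewrite mat2_mul => /(congr1 (fun x : V => yc x)).
  by rewrite yc_vec2 mul0r addr0 => <-; rewrite !exprMn bm mulr1.
move: Av; rewrite mat2_mul => Av.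
have := congr1 (fun x : V => xc x) Av; have := congr1 (fun x : V => yc x) Av.
rewrite xc_vec2 yc_vec2 !mul0r addr0 add0r => hy hx.
have fixed (e x : C) : e * x = x -> e = 1 \/ x = 0.
  move=> /eqP; rewrite -subr_eq0 -{2}[x]mul1r -mulrBl mulf_eq0 subr_eq0.
  by case/orP => /eqP; [left|right].
have [mp|mp] := eqVneq (m %/ p)%N 1%N; last first.
  right; split=> //; case: (fixed _ _ hx) => [a1|->]; last by rewrite mul0r.
  case: (fixed _ _ hy) => [b1|->]; last by rewrite mulr0.
  by move: refl; rewrite /is_reflection a1 b1 -mat2_1 subrr mxrank0.
left; move: abp; rewrite mp expr1 => ab.
have a1 : a != 1.
  apply: contraTneq refl => a1; move: ab; rewrite a1 mul1r => b1.
  by rewrite /is_reflection b1 -mat2_1 subrr mxrank0.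
have b1 : b != 1 by apply: contraNneq a1 => b1; rewrite -ab b1 mulr1.
case: (fixed _ _ hx) => [/eqP|->]; first by rewrite (negPf a1).
case: (fixed _ _ hy) => [/eqP|->]; first by rewrite (negPf b1).
by rewrite !expr0n eqn0Ngt m0 mulr0.
Qed.

Lemma mono_anti_hyperplane m p z v : (0 < m)%N -> z != 0 ->
  yc v ^+ m = z ^+ m * xc v ^+ m -> reflection_hyperplanes (mono m p z) v.
Proof.
move=> m0 z0 h; have [x0|x0] := eqVneq (xc v) 0.
  have y0 : yc v = 0.
    apply/eqP; move/eqP: h; rewrite x0 expr0n eqn0Ngt m0 mulr0 expf_eq0.
    by case/andP.
  exists (mat2 0 z^-1 z 0); split.
  - by exists 1, 1; rewrite !mulr1 !expr1n; split=> //; right; rewrite mul1r.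
  - by apply: anti_reflection; rewrite mulVf.
  - by rewrite mat2_mul x0 y0 !mulr0 !addr0; apply: vec2P; rewrite !mxE.
pose b := yc v / (z * xc v).
have bm : b ^+ m = 1.
  by rewrite expr_div_n h exprMn divff // mulf_neq0 ?expf_neq0.
have b0 := root1_neq0 m0 bm.
have zx : z * b * xc v = yc v by rewrite /b; field; rewrite x0 z0.
exists (mat2 0 (b^-1 / z) (z * b) 0); split.
- by exists b^-1, b; rewrite exprVn bm invr1 mulVf // expr1n; split=> //; right.
- by apply: anti_reflection; field; rewrite b0 z0.
rewrite mat2_mul !mul0r addr0 add0r zx; apply: vec2P; rewrite ?xc_vec2 ?yc_vec2 //.
by rewrite -zx; field; rewrite b0 z0.
Qed.

Lemma mono_axis_hyperplane m p z v : (0 < m)%N -> (1 < m %/ p)%N -> (p %| m)%N ->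
  z != 0 -> xc v * yc v = 0 -> reflection_hyperplanes (mono m p z) v.
Proof.
move=> m0 mp1 pm z0 /eqP; rewrite mulf_eq0 => xy0.
have [w pw] := prim_root_exists m0.
have wm := prim_expr_order pw.
pose a := w ^+ p.
have am : a ^+ m = 1 by rewrite /a -exprM mulnC exprM wm expr1n.
have an : a ^+ (m %/ p) = 1 by rewrite /a -exprM mulnC divnK.
have a1 : a != 1.
  rewrite /a -(prim_order_dvd pw); apply/negP => mdp.
  have p0 : (0 < p)%N by rewrite lt0n; apply: contraTneq pm => ->; rewrite dvd0n -lt0n.
  by have := dvdn_leq p0 mdp; rewrite leqNgt -[X in (X < _)%N]mul1n -ltn_divRL // mp1.
case/orP: xy0 => /eqP h.
  exists (mat2 a 0 0 1); split; last by
    rewrite mat2_mul h !mul0r !mulr0 !add0r mul1r; apply: vec2P;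
    rewrite ?xc_vec2 ?yc_vec2.
    by exists a, 1; rewrite !mulr1 expr1n; split=> //; left.
  exact: diag_reflection.
exists (mat2 1 0 0 a); split; last by
  rewrite mat2_mul h !mul0r !mulr0 !addr0 mul1r; apply: vec2P;
  rewrite ?xc_vec2 ?yc_vec2.
  by exists 1, a; rewrite !mul1r expr1n; split=> //; left.
rewrite /is_reflection; apply/eqP/rank1_mat2; last by rewrite !mxE /=; ring.
apply/eqP => /matrixP /(_ ord_max ord_max); rewrite !mxE /= => /eqP.
by rewrite subr_eq0 (negPf a1).
Qed.

End OrbitMaps.

(** * Polynomials in two variables *)

Section PlanePolynomials.
Variable C : numFieldType.
Local Notation V := 'cV[C]_2.
Local Notation poly := (mpoly 2 C).
Local Notation mono2 := (multinom 2).
Implicit Types (q h : poly) (v : V) (mo : mono2).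

Lemma pval_expand q v :
  pval q v = \sum_(mo <- msupp q) mcoeff mo q * (xc v ^+ mo ord0 * yc v ^+ mo ord_max).
Proof. by rewrite /pval mevalE; apply: eq_bigr => mo _; rewrite prod2. Qed.

(** Substituting (t, t ^ N) for large [N] separates the monomials, which reduces
    the claim to polynomials in one variable. *)
Lemma pval_eq0 q : (forall v, pval q v = 0) -> q = 0.
Proof.
move=> q0; pose N := mmeasure mdeg q.
pose e mo := (mo ord0 + N * mo ord_max)%N.
pose f : {poly C} := \sum_(mo <- msupp q) (mcoeff mo q)%:P * 'X^(e mo).
have small mo : mo \in msupp q -> (mo ord0 < N)%N /\ (mo ord_max < N)%N.
  move=> /msize_mdeg_lt; rewrite -/N mdegE big_ord_recr big_ord1 /=.
  have -> : widen_ord (leqnSn 1) ord0 = ord0 by exact: val_inj.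
  by move=> h; split; apply: leq_ltn_trans h; rewrite ?leq_addl ?leq_addr.
have inj mo mo' : mo \in msupp q -> mo' \in msupp q -> e mo = e mo' -> mo = mo'.
  move=> /small[h0 h1] /small[h0' h1'] ee.
  have N0 : (0 < N)%N by apply: leq_ltn_trans h0.
  apply/mnmP => i; case: (ord2P i) => ->.
    have := congr1 (modn^~ N) ee; rewrite /e !(addnC (_ ord0)) !(mulnC N).
    by rewrite !modnMDl !modn_small.
  have := congr1 (divn^~ N) ee; rewrite /e !(addnC (_ ord0)) !(mulnC N).
  by rewrite !divnMDl // !divn_small // !addn0.
have f0 : f = 0.
  apply/eqP/negPn/negP => fn0.
  (* [f] vanishes at the naturals below its size: one root too many *)
  pose rs : seq C := [seq i%:R | i <- iota 0 (size f)].
  have : (size rs < size f)%N.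
    apply: max_poly_roots => //.
      apply/allP => _ /mapP[i _ ->]; rewrite /root horner_sum.
      rewrite -[X in _ == X](q0 (vec2 i%:R (i%:R ^+ N))) pval_expand xc_vec2 yc_vec2.
      apply/eqP; apply: eq_bigr => mo _.
      by rewrite hornerCM hornerXn /e exprD exprM.
    by rewrite map_inj_uniq ?iota_uniq // => i j /eqP; rewrite eqr_nat => /eqP.
  by rewrite size_map size_iota ltnn.
apply/eqP; rewrite -msupp_eq0; case E : (msupp q) => [//|mo s].
have mo_in : mo \in msupp q by rewrite E mem_head.
have /eqP := congr1 (fun g : {poly C} => g`_(e mo)) f0.
rewrite coef0 coef_sum (bigD1_seq mo) ?msupp_uniq //= coefCM coefXn eqxx mulr1.
rewrite big_seq_cond big1 ?addr0 => [|mo' /andP[mo'_in mo'n]].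
  by move: mo_in; rewrite mcoeff_msupp => /negPf ->.
rewrite coefCM coefXn; case: eqP => [ee|_]; last by rewrite mulr0.
by rewrite (inj _ _ mo_in mo'_in ee) eqxx in mo'n.
Qed.

Lemma pval_inj q h : (forall v, pval q v = pval h v) -> q = h.
Proof.
move=> qh; apply/eqP; rewrite -subr_eq0; apply/eqP/pval_eq0 => v.
by rewrite /pval mevalB; apply/eqP; rewrite subr_eq0; apply/eqP/qh.
Qed.

Definition mon_swap mo : mono2 := Multinom [tuple mo (rev_ord i) | i < 2].

Lemma mon_swap0 mo : mon_swap mo ord0 = mo ord_max.
Proof. by rewrite mnmE; congr (mo _); exact: val_inj. Qed.

Lemma mon_swap1 mo : mon_swap mo ord_max = mo ord0.
Proof. by rewrite mnmE; congr (mo _); exact: val_inj. Qed.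

(** The action of a monomial matrix on polynomials has this form. *)
Definition monomial_map (sg : mono2 -> mono2) (F : mono2 -> C) q : poly :=
  \sum_(mo <- msupp q) (mcoeff mo q * F mo) *: mpolyX C (sg mo).

Lemma monomial_map_pval sg F q v : pval (monomial_map sg F q) v =
  \sum_(mo <- msupp q) mcoeff mo q * F mo *
    (xc v ^+ sg mo ord0 * yc v ^+ sg mo ord_max).
Proof.
rewrite /pval /monomial_map raddf_sum /=; apply: eq_bigr => mo _.
by rewrite mevalZ mevalX prod2.
Qed.

Lemma monomial_map_coeff F q mo :
  mcoeff mo (monomial_map id F q) = mcoeff mo q * F mo.
Proof.
rewrite /monomial_map raddf_sum /=.
have [mo_in|mo_out] := boolP (mo \in msupp q); last first.
  rewrite big_seq big1 => [|mo' mo'_in].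
    by rewrite (memN_msupp_eq0 mo_out) mul0r.
  rewrite mcoeffZ mcoeffX; case: eqP => [ee|_]; last by rewrite mulr0.
  by move: mo_out; rewrite -ee mo'_in.
rewrite (bigD1_seq mo) ?msupp_uniq //= mcoeffZ mcoeffX eqxx mulr1.
rewrite big1 ?addr0 // => mo' mo'n.
by rewrite mcoeffZ mcoeffX (negPf mo'n) mulr0.
Qed.

Definition generated (z : 2.-tuple poly) q : Prop := exists h, q = comp_mpoly z h.

Lemma generatedD z q q' : generated z q -> generated z q' -> generated z (q + q').
Proof. by move=> [h ->] [h' ->]; exists (h + h'); rewrite comp_mpolyD. Qed.

Lemma generatedM z q q' : generated z q -> generated z q' -> generated z (q * q').
Proof. by move=> [h ->] [h' ->]; exists (h * h'); rewrite rmorphM. Qed.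

Lemma generatedZ z (a : C) q : generated z q -> generated z (a *: q).
Proof. by move=> [h ->]; exists (a *: h); rewrite comp_mpolyZ. Qed.

Lemma generatedX z q n : generated z q -> generated z (q ^+ n).
Proof. by move=> [h ->]; exists (h ^+ n); rewrite rmorphXn. Qed.

Lemma generated1 z : generated z 1.
Proof. by exists 1; rewrite comp_mpoly1. Qed.

Lemma generated0 z : generated z 0.
Proof. by exists 0; rewrite comp_mpoly0. Qed.

Lemma generated_tnth z i : generated z (tnth z i).
Proof.
exists (mpolyX C (mnm1 i)).
by rewrite comp_mpolyXU (tnth_nth 0).
Qed.

(** Newton's recursion. *)
Lemma generated_power_sum z (a b : poly) l :
  generated z (a + b) -> generated z (a * b) -> generated z (a ^+ l + b ^+ l).
Proof.
move=> gs gp.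
suff : generated z (a ^+ l + b ^+ l) /\ generated z (a ^+ l.+1 + b ^+ l.+1) by case.
elim: l => [|l [IH1 IH2]].
  by rewrite !expr0 !expr1; split=> //; apply: generatedD; exact: generated1.
split=> //.
have -> : a ^+ l.+2 + b ^+ l.+2 =
    (a + b) * (a ^+ l.+1 + b ^+ l.+1) + (-1) *: ((a * b) * (a ^+ l + b ^+ l)).
  by rewrite scaleN1r !exprS; ring.
apply: generatedD; first exact: generatedM.
by apply: generatedZ; exact: generatedM.
Qed.

Lemma generated_sum z (I : eqType) (s : seq I) (F : I -> poly) :
  (forall i, i \in s -> generated z (F i)) -> generated z (\sum_(i <- s) F i).
Proof.
move=> H; rewrite big_seq; elim/big_ind: _ => //; first exact: generated0.
by move=> ? ?; exact: generatedD.
Qed.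

End PlanePolynomials.

(** * Invariants of the monomial groups *)

Section MonomialInvariants.
Variable C : numClosedFieldType.
Local Notation V := 'cV[C]_2.
Local Notation poly := (mpoly 2 C).
Implicit Types (q h : poly) (v : V) (mo : multinom 2).
Let pu : poly := mpolyX C (mnm1 ord0).
Let pv : poly := mpolyX C (mnm1 ord_max).

Variables (m p : nat) (z : C).
Hypotheses (m0 : (0 < m)%N) (pm : (p %| m)%N) (z0 : z != 0).
Let n := (m %/ p)%N.

Lemma mono_quotient_gt0 : (0 < n)%N.
Proof.
by rewrite /n divn_gt0 ?(dvdn_leq m0 pm) // lt0n; apply: contraTneq pm => ->;
  rewrite dvd0n -lt0n.
Qed.

Lemma mpolyX_plane mo : mpolyX C mo = pu ^+ mo ord0 * pv ^+ mo ord_max.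
Proof.
rewrite mpolyXE_id big_ord_recr big_ord1 /= /pu /pv.
by have -> : widen_ord (leqnSn 1) ord0 = ord0 :> 'I_2 by exact: val_inj.
Qed.

(** A monomial of an invariant is fixed by the diagonal elements of the group;
    those with entries (w^p, 1), (1, w^p) and (w, w^-1) give the congruences. *)
Lemma invariant_support q mo : invariant_poly (mono m p z) q ->
  mo \in msupp q -> [/\ (n %| mo ord0)%N, (n %| mo ord_max)%N &
                        mo ord0 = mo ord_max %[mod m]].
Proof.
move=> inv mo_in; have [w pw] := prim_root_exists C m0.
have wm := prim_expr_order pw; have w0 := root1_neq0 m0 wm.
have key (a b : C) : a ^+ m = 1 -> b ^+ m = 1 -> (a * b) ^+ n = 1 ->
    a ^+ mo ord0 * b ^+ mo ord_max = 1.
  move=> am bm ab.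
  have hq : q = monomial_map id (fun mo => a ^+ mo ord0 * b ^+ mo ord_max) q.
    apply: pval_inj => v; have mA : mono m p z (mat2 a 0 0 b).
      by exists a, b; split=> //; left.
    rewrite -(inv _ mA) mat2_mul !mul0r addr0 add0r monomial_map_pval pval_expand.
    by apply: eq_bigr => mo' _; rewrite xc_vec2 yc_vec2 !exprMn; ring.
  have := congr1 (mcoeff mo) hq; rewrite monomial_map_coeff.
  move: mo_in; rewrite mcoeff_msupp => c0 /eqP.
  by rewrite -{1}[mcoeff mo q]mulr1 eq_sym (inj_eq (mulfI c0)) => /eqP.
have n_dvd e : w ^+ (p * e) = 1 -> (n %| e)%N.
  move/eqP; rewrite -(prim_order_dvd pw) -{1}(divnK pm) mulnC -/n.
  rewrite dvdn_pmul2l // lt0n; apply: contraTneq pm => ->.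
  by rewrite dvd0n -lt0n.
have wpm : (w ^+ p) ^+ m = 1 by rewrite -exprM mulnC exprM wm expr1n.
have wpn : (w ^+ p) ^+ n = 1 by rewrite -exprM mulnC divnK.
split.
- by apply: n_dvd; rewrite exprM -[LHS]mulr1 -(expr1n _ (mo ord_max)) key ?expr1n
    ?mulr1.
- by apply: n_dvd; rewrite exprM -[LHS]mul1r -(expr1n _ (mo ord0)) key ?expr1n
    ?mul1r.
apply/eqP; rewrite -(eq_prim_root_expr pw); apply/eqP.
have := key w w^-1; rewrite exprVn wm invr1 divff // expr1n => /(_ _ _ _) h.
have {}h := h (erefl _) (erefl _) (erefl _).
apply: (mulIf (expf_neq0 (mo ord_max) (invr_neq0 w0))).
by rewrite h -exprMn divff // expr1n.
Qed.

(** The element exchanging the coordinates writes twice an invariant as a sum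
    of symmetrized monomials. *)
Lemma invariant_symmetrize q : invariant_poly (mono m p z) q ->
  q + q = \sum_(mo <- msupp q) mcoeff mo q *:
    (mpolyX C mo + (z^-1 ^+ mo ord0 * z ^+ mo ord_max) *: mpolyX C (mon_swap mo)).
Proof.
move=> inv.
have hq : q = monomial_map (@mon_swap)
    (fun mo => z^-1 ^+ mo ord0 * z ^+ mo ord_max) q.
  apply: pval_inj => v; have mA : mono m p z (mat2 0 (1 / z) (z * 1) 0).
    by exists 1, 1; rewrite mulr1 !expr1n; split=> //; right.
  rewrite -(inv _ mA) mat2_mul mul1r mulr1 !mul0r addr0 add0r.
  rewrite monomial_map_pval pval_expand.
  apply: eq_bigr => mo' _.
  by rewrite xc_vec2 yc_vec2 mon_swap0 mon_swap1 !exprMn; ring.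
rewrite [X in _ + X]hq [X in X + _]mpolyE -big_split /=; apply: eq_bigr => mo _.
by rewrite scalerDr scalerA.
Qed.

Variable zt : 2.-tuple poly.
Hypothesis gP : generated zt (pv ^+ m + z ^+ m *: pu ^+ m).
Hypothesis gQ : generated zt (pu ^+ n * pv ^+ n).

(** Up to a scalar, a symmetrized monomial is the product of a power of u^n v^n
    and of a sum
    v^(m l) + (z u)^(m l), a power sum of v^m and (z u)^m. *)
Lemma invariant_generated q : invariant_poly (mono m p z) q -> generated zt q.
Proof.
move=> inv; suff : generated zt (q + q).
  move=> /(generatedZ 2^-1); rewrite (_ : _ *: _ = q) //.
  by rewrite -[q]scale1r -scalerDl scalerA; congr (_ *: _); field.
rewrite (invariant_symmetrize inv); apply: generated_sum => mo mo_in.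
have [h0 h1 h2] := invariant_support inv mo_in; apply: generatedZ.
rewrite !mpolyX_plane mon_swap0 mon_swap1.
have gUV i : (n %| i)%N -> generated zt (pu ^+ i * pv ^+ i).
  by move=> /dvdnP[l ->]; rewrite mulnC !exprM -exprMn; exact: generatedX.
have gS l : generated zt (pv ^+ (m * l) + z ^+ (m * l) *: pu ^+ (m * l)).
  rewrite !exprM -exprZn; apply: generated_power_sum => //.
  rewrite -scalerAr; apply: generatedZ; rewrite mulrC; apply: gUV.
  by rewrite /n dvdn_div.
move: (mo ord0) (mo ord_max) h0 h1 h2 => i j h0 h1 h2.
have [ij|ji] := leqP i j.
  have [l jE] : exists l, j = (i + m * l)%N.
    have : (m %| j - i)%N by rewrite -eqn_mod_dvd //; apply/eqP.
    by move=> /dvdnP[l e]; exists l; rewrite mulnC -e subnKC.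
  rewrite jE !exprD exprVn (_ : _ + _ = (pu ^+ i * pv ^+ i) *
      (pv ^+ (m * l) + z ^+ (m * l) *: pu ^+ (m * l))).
    by apply: generatedM => //; exact: gUV.
  rewrite mulKf ?expf_neq0 // mulrDr -!scalerAr.
  by congr (_ + _ *: _); ring.
have [l iE] : exists l, i = (j + m * l)%N.
  have : (m %| i - j)%N by rewrite -eqn_mod_dvd ?(ltnW ji) //; apply/eqP.
  by move=> /dvdnP[l e]; exists l; rewrite mulnC -e subnKC // ltnW.
rewrite iE (_ : _ + _ = z^-1 ^+ (m * l) *: ((pu ^+ j * pv ^+ j) *
    (pv ^+ (m * l) + z ^+ (m * l) *: pu ^+ (m * l)))).
  by apply: generatedZ; apply: generatedM => //; exact: gUV.
rewrite !exprD !exprVn -!mul_mpolyC.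
have hz (e : nat) : mpolyC 2 (z ^+ e)^-1 * mpolyC 2 (z ^+ e) = 1 :> poly.
  by rewrite -mpolyCM mulVf ?expf_neq0.
rewrite !mpolyCM.
transitivity (pu ^+ j * pv ^+ j * (mpolyC 2 (z ^+ (m * l))^-1 * pv ^+ (m * l)
  + (mpolyC 2 (z ^+ (m * l))^-1 * mpolyC 2 (z ^+ (m * l))) * pu ^+ (m * l))).
  rewrite hz; transitivity (pu ^+ j * pv ^+ j * (mpolyC 2 (z ^+ (m * l))^-1
    * (mpolyC 2 (z ^+ j)^-1 * mpolyC 2 (z ^+ j)) * pv ^+ (m * l) + pu ^+ (m * l))).
    by ring.
  by rewrite hz; ring.
by ring.
Qed.

End MonomialInvariants.

Section BasicInvariants.
Variable C : numClosedFieldType.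
Local Notation V := 'cV[C]_2.
Local Notation poly := (mpoly 2 C).
Local Notation pu := (mpolyX C (mnm1 ord0) : poly).
Local Notation pv := (mpolyX C (mnm1 ord_max) : poly).
Implicit Types (q h : poly) (v : V).

Lemma pval_comp (zt : 2.-tuple poly) h v :
  pval (comp_mpoly zt h) v = pval h (poly_map zt v).
Proof.
rewrite /pval comp_mpoly_meval; apply: meval_eq => i.
by rewrite /poly_map mxE.
Qed.

(** Algebraic independence follows from the surjectivity of the orbit map: a
    relation between the invariants vanishes on the whole plane. *)
Lemma mono_basic_invariants m p z (zt : 2.-tuple poly) (d : 2.-tuple nat) :
  (0 < m)%N -> (p %| m)%N -> z != 0 ->
  (tnth d ord_max <= tnth d ord0)%N ->
  (forall i, tnth zt i \is ishomog1 (tnth d i) mdeg) ->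
  (forall i A v, mono m p z A -> pval (tnth zt i) (A *m v) = pval (tnth zt i) v) ->
  generated zt (pv ^+ m + z ^+ m *: pu ^+ m) ->
  generated zt (pu ^+ (m %/ p) * pv ^+ (m %/ p)) ->
  (forall w, exists v, poly_map zt v = w) ->
  basic_invariants (mono m p z) zt d.
Proof.
move=> m0 pm z0 dd hom inv gP gQ surj; split=> //.
- move=> i j; case: (ord2P i) => ->; case: (ord2P j) => -> //.
- by move=> i A GA v; exact: inv.
- exact: invariant_generated.
- move=> h h0; apply: pval_eq0 => w; have [v <-] := surj w.
  by rewrite -pval_comp h0 /pval meval0.
Qed.

End BasicInvariants.

(** * Basic invariants and discriminants *)

Section OrbitDiscriminants.
Variable C : numFieldType.
Implicit Types (v : 'cV[C]_2) (k : nat).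

(** Up to sign, these factors of the discriminants pull back to the square of
    the product of the linear forms vanishing on the antidiagonal reflection
    lines. *)
Lemma orbG_disc k v : xc (orbG k v) ^+ 2 - 4 * yc (orbG k v) ^+ 2 =
  (yc v ^+ (2 * k) - xc v ^+ (2 * k)) ^+ 2.
Proof. by rewrite !xc_vec2 !yc_vec2 mulnC !exprM; ring. Qed.

Lemma orbD_disc k v : xc (orbD k v) ^+ 2 - 4 * yc (orbD k v) ^+ (2 * k) =
  (yc v ^+ (2 * k) - xc v ^+ (2 * k)) ^+ 2.
Proof. by rewrite !xc_vec2 !yc_vec2 exprMn; ring. Qed.

Lemma orbB_disc s k v : s = 1 \/ s = -1 ->
  s * yc (orbB s k v) ^+ 2 - 4 * xc (orbB s k v) =
  s * (yc v ^+ k - s * xc v ^+ k) ^+ 2.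
Proof. by rewrite !xc_vec2 !yc_vec2 => -[] ->; ring. Qed.

End OrbitDiscriminants.

Section ConcreteGroups.
Variable C : numClosedFieldType.
Local Notation V := 'cV[C]_2.
Local Notation poly := (mpoly 2 C).
Local Notation pu := (mpolyX C (mnm1 ord0) : poly).
Local Notation pv := (mpolyX C (mnm1 ord_max) : poly).
Implicit Types (q h : poly) (v w : V) (zt : 2.-tuple poly).

Lemma pval_pu v : pval pu v = xc v. Proof. exact: mevalXU. Qed.
Lemma pval_pv v : pval pv v = yc v. Proof. exact: mevalXU. Qed.
Lemma pvalD q h v : pval (q + h) v = pval q v + pval h v.
Proof. exact: mevalD. Qed.
Lemma pvalM q h v : pval (q * h) v = pval q v * pval h v.
Proof. exact: mevalM. Qed.
Lemma pvalX q i v : pval (q ^+ i) v = pval q v ^+ i.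
Proof. exact: rmorphXn. Qed.
Lemma pvalZ (a : C) q v : pval (a *: q) v = a * pval q v.
Proof. exact: mevalZ. Qed.

Definition pval_simp := (pval_pu, pval_pv, pvalD, pvalM, pvalX, pvalZ).

Lemma poly_map2 (a b : poly) v :
  poly_map [tuple a; b] v = vec2 (pval a v) (pval b v).
Proof. by apply: vec2P; rewrite !mxE /= !(tnth_nth 0). Qed.

Lemma mono_power_sum m p z (A : 'M[C]_2) v : z != 0 -> mono m p z A ->
  yc (A *m v) ^+ m + z ^+ m * xc (A *m v) ^+ m = yc v ^+ m + z ^+ m * xc v ^+ m
  /\ (xc (A *m v) * yc (A *m v)) ^+ (m %/ p) = (xc v * yc v) ^+ (m %/ p).
Proof.
move=> z0 [a [b [am bm abp [->|->]]]]; rewrite mat2_mul xc_vec2 yc_vec2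
  !mul0r ?addr0 ?add0r.
  split; first by rewrite !exprMn am bm !mul1r.
  by rewrite mulrACA exprMn abp mul1r.
split.
  by rewrite !exprMn am bm exprVn mulr1 mul1r mulrA divff ?expf_neq0 // mul1r addrC.
rewrite (_ : _ * _ * _ = (a * b) * (xc v * yc v)); last by field; rewrite ?z0.
by rewrite exprMn abp mul1r.
Qed.

Lemma regular_mono m p z zt w : (0 < m)%N -> (p %| m)%N -> z != 0 ->
  regular_locus (mono m p z) zt w <->
  forall v, poly_map zt v = w -> yc v ^+ m != z ^+ m * xc v ^+ m /\
     ((m %/ p)%N != 1%N -> xc v * yc v != 0).
Proof.
move=> m0 pm z0; split=> [reg v vw|H [v hv vw]].
  split; first by apply/eqP => h; apply: reg; exists v => //; exact: mono_anti_hyperplane.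
  move=> mp1; apply/eqP => h; apply: reg; exists v => //.
  apply: mono_axis_hyperplane => //.
  by have := mono_quotient_gt0 m0 pm; rewrite leq_eqVlt eq_sym (negPf mp1).
have [h1 h2] := H v vw.
case: (mono_hyperplane m0 z0 hv) => [/eqP|[mp1 /eqP]]; first by rewrite (negPf h1).
by rewrite (negPf (h2 mp1)).
Qed.

Lemma open_nonzero (f : V -> C) : (forall p, differentiable f p) ->
  open [set p | f p != 0].
Proof.
move=> df; have -> : [set p | f p != 0] = f @^-1` (~` [set 0]).
  by apply/seteqP; split=> p /=; [move=> /eqP|move=> h; apply/eqP].
apply: open_comp => [p _|]; first exact: differentiable_continuous.
apply: closed_openC; apply: accessible_closed_set1.
exact: hausdorff_accessible (@norm_hausdorff _ _).
Qed.

Variable k : nat.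
Hypothesis k1 : (1 < k)%N.

Let k0 : (0 < k)%N. Proof. exact: ltnW. Qed.
Let k20 : (0 < 2 * k)%N. Proof. by rewrite muln_gt0. Qed.

Definition xG : 2.-tuple poly := [tuple pu ^+ (2 * k) + pv ^+ (2 * k); pu ^+ k * pv ^+ k].
Definition xD : 2.-tuple poly := [tuple pu ^+ (2 * k) + pv ^+ (2 * k); pu * pv].
Definition xB (s : C) : 2.-tuple poly := [tuple pu ^+ k * pv ^+ k; pv ^+ k + s *: pu ^+ k].

Lemma poly_map_xG : poly_map xG = orbG k.
Proof. by apply/funext => v; rewrite poly_map2 !pval_simp. Qed.

Lemma poly_map_xD : poly_map xD = orbD k.
Proof. by apply/funext => v; rewrite poly_map2 !pval_simp. Qed.

Lemma poly_map_xB s : poly_map (xB s) = orbB s k.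
Proof. by apply/funext => v; rewrite poly_map2 !pval_simp. Qed.

Lemma orbG_surj w : exists v, orbG k v = w.
Proof.
have [v [h1 h2]] := orbit_map_surjective (xc w) (yc w) k20 k0 (oner_neq0 C).
exists v; apply: vec2P; rewrite ?xc_vec2 ?yc_vec2 -?h1 -?h2.
  by rewrite expr1n mul1r addrC.
by rewrite exprMn.
Qed.

Lemma orbD_surj w : exists v, orbD k v = w.
Proof.
have [v [h1 h2]] := orbit_map_surjective (xc w) (yc w) k20 (ltn0Sn 0) (oner_neq0 C).
exists v; apply: vec2P; rewrite ?xc_vec2 ?yc_vec2 -?h1 -?h2 //.
by rewrite expr1n mul1r addrC.
Qed.

Lemma orbB_surj z s w : z != 0 -> z ^+ k = s -> exists v, orbB s k v = w.
Proof.
move=> z0 zs.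
have [v [h1 h2]] := orbit_map_surjective (yc w) (xc w) k0 k0 z0.
exists v; apply: vec2P; rewrite ?xc_vec2 ?yc_vec2 -?h1 -?h2 ?exprMn //.
by rewrite zs.
Qed.

Lemma homog_pu (a : C) i : a *: pu ^+ i \is ishomog1 i mdeg.
Proof.
have h : pu \is ishomog1 1 mdeg by rewrite dhomogX; exact/eqP/mdeg1.
by apply: rpredZ; have := dhomogMn i h; rewrite mul1n.
Qed.

Lemma homog_pv i : pv ^+ i \is ishomog1 i mdeg.
Proof.
have h : pv \is ishomog1 1 mdeg by rewrite dhomogX; exact/eqP/mdeg1.
by have := dhomogMn i h; rewrite mul1n.
Qed.

Lemma homog_puv i : pu ^+ i * pv ^+ i \is ishomog1 (2 * i) mdeg.
Proof.
by rewrite mul2n -addnn; apply: dhomogM; [rewrite -[pu ^+ i]scale1r; exact: homog_pu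
  |exact: homog_pv].
Qed.

Lemma basic_invariants_G :
  basic_invariants (mono (2 * k) 2 1) xG [tuple (2 * k)%N; (2 * k)%N].
Proof.
apply: mono_basic_invariants; rewrite ?oner_neq0 ?mulKn ?dvdn_mulr //.
- move=> i; case: (ord2P i) => ->; rewrite !(tnth_nth 0) ?(tnth_nth 0%N) /=.
    by apply: dhomogD; [rewrite -[pu ^+ _]scale1r; exact: homog_pu|exact: homog_pv].
  exact: homog_puv.
- move=> i A v GA; have [h1 h2] := mono_power_sum v (oner_neq0 C) GA.
  move: h1 h2; rewrite expr1n !mul1r mulKn // => h1 h2.
  case: (ord2P i) => ->; rewrite !(tnth_nth 0) /= !pval_simp.
    by rewrite addrC h1 addrC.
  by rewrite -!exprMn h2.
- rewrite expr1n scale1r addrC; exact: (generated_tnth xG ord0).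
- exact: (generated_tnth xG ord_max).
- by move=> w; rewrite poly_map_xG; exact: orbG_surj.
Qed.

Lemma basic_invariants_D :
  basic_invariants (mono (2 * k) (2 * k) 1) xD [tuple (2 * k)%N; 2%N].
Proof.
have e1 : (2 * k %/ (2 * k) = 1)%N by rewrite divnn k20.
apply: mono_basic_invariants; rewrite ?oner_neq0 // ?e1.
- by rewrite !(tnth_nth 0%N) /= leq_pmulr.
- move=> i; case: (ord2P i) => ->; rewrite !(tnth_nth 0) ?(tnth_nth 0%N) /=.
    by apply: dhomogD; [rewrite -[pu ^+ _]scale1r; exact: homog_pu|exact: homog_pv].
  exact: (homog_puv 1).
- move=> i A v GA; have [h1 h2] := mono_power_sum v (oner_neq0 C) GA.
  move: h1 h2; rewrite expr1n !mul1r e1 !expr1 => h1 h2.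
  case: (ord2P i) => ->; rewrite !(tnth_nth 0) /= !pval_simp //.
  by rewrite addrC h1 addrC.
- rewrite expr1n scale1r addrC; exact: (generated_tnth xD ord0).
- exact: (generated_tnth xD ord_max).
- by move=> w; rewrite poly_map_xD; exact: orbD_surj.
Qed.

Lemma basic_invariants_B z s : z != 0 -> z ^+ k = s ->
  basic_invariants (mono k 1 z) (xB s) [tuple (2 * k)%N; k].
Proof.
move=> z0 zs; apply: mono_basic_invariants; rewrite ?divn1 ?dvd1n ?zs //.
- by rewrite !(tnth_nth 0%N) /= leq_pmull.
- move=> i; case: (ord2P i) => ->; rewrite !(tnth_nth 0) ?(tnth_nth 0%N) /=.
    exact: homog_puv.
  by apply: dhomogD; [exact: homog_pv|exact: homog_pu].
- move=> i A v GA; have [h1 h2] := mono_power_sum v z0 GA.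
  move: h1 h2; rewrite divn1 zs => h1 h2.
  case: (ord2P i) => ->; rewrite !(tnth_nth 0) /= !pval_simp //.
  by rewrite -!exprMn h2.
- exact: (generated_tnth (xB s) ord_max).
- exact: (generated_tnth (xB s) ord0).
- by move=> w; rewrite poly_map_xB; exact: orbB_surj zs.
Qed.

Definition regG : set V := [set p | yc p != 0 /\ xc p ^+ 2 - 4 * yc p ^+ 2 != 0].
Definition regD : set V := [set p | xc p ^+ 2 - 4 * yc p ^+ (2 * k) != 0].
Definition regB (s : C) : set V :=
  [set p | xc p != 0 /\ s * yc p ^+ 2 - 4 * xc p != 0].

Lemma regular_locus_G : regular_locus (mono (2 * k) 2 1) xG = regG.
Proof.
have reg := regular_mono _ _ k20 (dvdn_mulr k (dvdnn 2)) (oner_neq0 C).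
apply/seteqP; split=> w.
  move=> /reg H; have [v vw] := orbG_surj w.
  have := H v; rewrite poly_map_xG => /(_ vw).
  rewrite mulKn // gtn_eqF // expr1n mul1r => -[h1 /(_ isT) h2].
  rewrite -vw /regG /= orbG_disc expf_neq0 ?subr_eq0 //; split=> //.
  by rewrite yc_vec2 -exprMn expf_neq0.
move=> [y0 d0]; apply/reg => v; rewrite poly_map_xG => vw.
move: y0 d0; rewrite -vw orbG_disc yc_vec2 -exprMn => y0.
rewrite expf_eq0 subr_eq0 /= expr1n mul1r => d0; split=> // _.
by apply: contraNneq y0 => ->; rewrite expr0n eqn0Ngt k0.
Qed.

Lemma regular_locus_D : regular_locus (mono (2 * k) (2 * k) 1) xD = regD.
Proof.
have e1 : (2 * k %/ (2 * k) = 1)%N by rewrite divnn k20.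
have reg := regular_mono _ _ k20 (dvdnn (2 * k)) (oner_neq0 C).
apply/seteqP; split=> w.
  move=> /reg H; have [v vw] := orbD_surj w.
  have := H v; rewrite poly_map_xD => /(_ vw).
  rewrite expr1n mul1r => -[h1 _].
  by rewrite -vw /regD /= orbD_disc expf_neq0 ?subr_eq0.
move=> d0; apply/reg => v; rewrite poly_map_xD e1 => vw; split=> //; move: d0.
by rewrite -vw /regD /= orbD_disc expf_eq0 subr_eq0 expr1n mul1r.
Qed.

Lemma regular_locus_B z s : z != 0 -> z ^+ k = s -> s = 1 \/ s = -1 ->
  regular_locus (mono k 1 z) (xB s) = regB s.
Proof.
move=> z0 zs s1; have s0 : s != 0 by rewrite -zs expf_neq0.
have reg := regular_mono _ _ k0 (dvd1n k) z0.
apply/seteqP; split=> w.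
  move=> /reg H; have [v vw] := orbB_surj w z0 zs.
  have := H v; rewrite poly_map_xB => /(_ vw).
  rewrite divn1 gtn_eqF // zs => -[h1 /(_ isT) h2].
  rewrite -vw /regB /= (orbB_disc k v s1) mulf_neq0 ?expf_neq0 ?subr_eq0 //.
  by split=> //; rewrite xc_vec2 -exprMn expf_neq0.
move=> [x0 d0]; apply/reg => v; rewrite poly_map_xB => vw.
move: x0 d0; rewrite -vw (orbB_disc k v s1) xc_vec2 -exprMn => x0.
rewrite mulf_eq0 (negPf s0) expf_eq0 subr_eq0 /= zs => d0; split=> // _.
by apply: contraNneq x0 => ->; rewrite expr0n eqn0Ngt k0.
Qed.

Ltac differentiable_pd := let p := fresh in
  move=> p; refine (proj1 (_ : is_pd _ p _ _)); repeat pd_step.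

Lemma open_regG : open regG.
Proof.
have -> : regG = [set p | yc p != 0] `&` [set p | xc p ^+ 2 - 4 * yc p ^+ 2 != 0] by [].
by apply: openI; apply: open_nonzero; differentiable_pd.
Qed.

Lemma open_regD : open regD.
Proof. by apply: open_nonzero; differentiable_pd. Qed.

Lemma open_regB s : open (regB s).
Proof.
have -> : regB s = [set p | xc p != 0] `&` [set p | s * yc p ^+ 2 - 4 * xc p != 0] by [].
by apply: openI; apply: open_nonzero; differentiable_pd.
Qed.

Lemma regG_neq0 : regG !=set0.
Proof.
exists (vec2 0 1); rewrite /regG /= xc_vec2 yc_vec2 oner_neq0; split=> //.
by rewrite (_ : _ - _ = - 4) ?oppr_eq0 ?pnatr_eq0 //; ring.
Qed.

Lemma regD_neq0 : regD !=set0.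
Proof.
exists (vec2 1 0); rewrite /regD /= xc_vec2 yc_vec2 expr1n expr0n eqn0Ngt k20.
by rewrite mulr0 subr0 oner_neq0.
Qed.

Lemma regB_neq0 s : regB s !=set0.
Proof.
exists (vec2 1 0); rewrite /regB /= xc_vec2 yc_vec2 oner_neq0; split=> //.
by rewrite (_ : _ - _ = - 4) ?oppr_eq0 ?pnatr_eq0 //; ring.
Qed.

End ConcreteGroups.

(** * Natural structures and constant fields *)

Section NaturalStructures.
Variable C : numFieldType.
Local Notation V := 'cV[C]_2.
Local Notation poly := (mpoly 2 C).

Definition const_vf (a b : C) : 'cV[poly]_2 :=
  mpolyC 2 a *: delta_mx ord0 0 + mpolyC 2 b *: delta_mx ord_max 0.

Lemma const_vf0 a b : const_vf a b ord0 0 = mpolyC 2 a.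
Proof. by rewrite !mxE /= mulr1 mulr0 addr0. Qed.

Lemma const_vf1 a b : const_vf a b ord_max 0 = mpolyC 2 b.
Proof. by rewrite !mxE /= mulr1 mulr0 add0r. Qed.

Lemma polycolP (e e' : 'cV[poly]_2) :
  e ord0 0 = e' ord0 0 -> e ord_max 0 = e' ord_max 0 -> e = e'.
Proof. by move=> h0 h1; apply/colP => i; case: (ord2P i) => ->. Qed.

Lemma const_vf_inj a b a' b' :
  const_vf a b = const_vf a' b' -> a = a' /\ b = b'.
Proof.
move=> h; split; apply: (can_inj (@mpolyCK 2 C)).
  by have := congr1 (fun M : 'cV[poly]_2 => M ord0 0) h; rewrite !const_vf0.
by have := congr1 (fun M : 'cV[poly]_2 => M ord_max 0) h; rewrite !const_vf1.
Qed.

Lemma const_vf_eq0 a b : (const_vf a b == 0) = (a == 0) && (b == 0).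
Proof.
have -> : (0 : 'cV[poly]_2) = const_vf 0 0.
  by rewrite /const_vf mpolyC0 !scale0r addr0.
apply/eqP/andP => [/const_vf_inj [-> ->]|[/eqP -> /eqP ->]] //.
Qed.

Lemma const_vfZ c a b : mpolyC 2 c *: const_vf a b = const_vf (c * a) (c * b).
Proof. by rewrite /const_vf scalerDr !scalerA !mpolyCM. Qed.

Lemma eval_const_vf a b : eval_vf (const_vf a b) = fun=> vec2 a b :> V.
Proof.
apply/funext => p; apply: vec2P; rewrite ?xc_vec2 ?yc_vec2 mxE.
  by rewrite const_vf0 /pval mevalC.
by rewrite const_vf1 /pval mevalC.
Qed.

Lemma supp0_const (q : poly) :
  (forall mo, mo \in msupp q -> mo = mnm0) -> q = mpolyC 2 (mcoeff mnm0 q).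
Proof.
move=> h; apply/mpolyP => mo; rewrite mcoeffC.
have [->|mo0] := eqVneq mo mnm0; first by rewrite mulr1.
rewrite mulr0; apply: memN_msupp_eq0; apply: contra mo0 => /h ->.
by rewrite eqxx.
Qed.

Lemma graded_const d0 d1 a b : (d1 = d0 \/ b = 0) ->
  graded_vf [tuple d0; d1] (- d0%:Z) (const_vf a b).
Proof.
move=> H i mo; case: (ord2P i) => ->.
  rewrite const_vf0 msuppC; case: ifP => // _; rewrite mem_seq1 => /eqP ->.
  by rewrite big1 ?sub0r ?(tnth_nth 0%N) // => j _; rewrite mnm0E.
rewrite const_vf1 msuppC; case: eqVneq => // b0; rewrite mem_seq1 => /eqP ->.
rewrite big1 ?sub0r ?(tnth_nth 0%N) => [|j _]; last by rewrite mnm0E.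
by case: H b0 => [->|->] //; rewrite eqxx.
Qed.

(** The weights of the monomials in both components are at most 0. *)
Lemma graded_const_inv d0 d1 e : (0 < d1 <= d0)%N ->
  graded_vf [tuple d0; d1] (- d0%:Z) e ->
  exists a b : C, e = const_vf a b /\ (d1 = d0 \/ b = 0).
Proof.
move=> /andP[d10 d1d0] gr; have d00 : (0 < d0)%N by exact: leq_trans d1d0.
have wt mo : \sum_(j < 2) (mo j * tnth [tuple d0; d1] j)%N =
    (mo ord0 * d0 + mo ord_max * d1)%N :> nat.
  rewrite big_ord_recr big_ord1 /= !(tnth_nth 0%N) /=.
  by have -> : widen_ord (leqnSn 1) ord0 = ord0 by exact: val_inj.
have mo0 (mo : multinom 2) : mo ord0 = 0%N -> mo ord_max = 0%N -> mo = mnm0.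
  by move=> h0 h1; apply/mnmP => j; rewrite mnm0E; case: (ord2P j) => ->.
have e0 : e ord0 0 = mpolyC 2 (mcoeff mnm0 (e ord0 0)).
  apply: supp0_const => mo /(gr ord0); rewrite wt (tnth_nth 0%N) /= => h.
  have {}h : (mo ord0 * d0 + mo ord_max * d1 = 0)%N by lia.
  by apply: mo0; nia.
have gr1 mo : mo \in msupp (e ord_max 0) ->
    (mo ord0 * d0 + mo ord_max * d1 + d0 = d1)%N.
  by move=> /(gr ord_max); rewrite wt (tnth_nth 0%N) /=; lia.
exists (mcoeff mnm0 (e ord0 0)), (mcoeff mnm0 (e ord_max 0)); split.
  apply: polycolP; rewrite ?const_vf0 ?const_vf1 //.
  apply: supp0_const => mo /gr1 h; apply: mo0; nia.
have [->|d10'] := eqVneq d1 d0; [by left|right].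
apply: memN_msupp_eq0; apply/negP => /gr1; move/eqP: d10'; lia.
Qed.

(** The orbit map determines the connection, and the last axiom then solves for
    the multiplication; rescaling the vector field changes neither. *)
Lemma natural_structure_unique (H : set 'M[C]_2) (x : 2.-tuple poly)
    (d : 2.-tuple nat) fx fy fxx fxy fyy GamH mulH wt a b :
  let N := regular_locus H x in
  let r := ((thead d)%:R : C)^-1 in
  etale_over N (poly_map x) fx fy fxx fxy fyy ->
  (forall p, N p -> exists q, poly_map x q = p) ->
  induced_connection (poly_map x) N (@trivial_connection C 1) GamH ->
  almost_saito N r GamH mulH (euler_field wt) (fun=> vec2 a b) ->
  (fun p => r *: E_deg d p) = euler_field wt ->
  (forall p w, N p -> GamH p w (vec2 a b) = 0 -> w = 0) ->
  (forall c, graded_vf d (- (thead d)%:Z) (const_vf (c * a) (c * b))) ->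
  forall c Gam mul, c != 0 ->
    natural_almost_saito H x d Gam mul (const_vf (c * a) (c * b)) <->
    eq_on N GamH Gam /\ eq_on N mulH mul.
Proof.
move=> N r et surj ind S Edeg inj gr c Gam mul c0.
have e0 : vec2 a b != 0 by have [_ _ _ _ _ _ [p _ h] _ _ _ _] := S.
have scaleS : almost_saito N r GamH mulH (euler_field wt) (fun=> vec2 (c * a) (c * b)).
  by rewrite -vec2Z; exact: almost_saito_scale.
have d1 := etale_differentiable et.
have d2 q u := (etale_derive2 et q u).1.
split=> [[ind' _ _ S']|[GG mm]].
  have GG : eq_on N GamH Gam.
    apply: (induced_connection_unique (et_open et) d1 d2 (etale_inj et)
      (etale_lift et) surj _ ind ind') => //.
  split=> //.
  have S1 : almost_saito N r GamH mul (euler_field wt) (fun=> vec2 (c * a) (c * b)).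
    move: S'; rewrite Edeg eval_const_vf; apply: almost_saito_eq_on => //.
    by move=> p u v Np; rewrite GG.
  have holG : holomorphic_bitensor N GamH by case: S.
  move=> p u v Np.
  apply: (multiplication_unique u v holG Np _ (almost_saito_pointwise scaleS)
    (almost_saito_pointwise S1)).
  move=> w; rewrite -vec2Z (linfunZ (bitensor_linearr _ holG Np)) => /eqP.
  by rewrite scaler_eq0 (negPf c0) /= => /eqP; exact: inj.
split; rewrite ?Edeg ?eval_const_vf.
- by apply: (induced_connection_eq_on (et_open et) d1 d2 (etale_inj et)
    (etale_lift et) _ GG ind).
- move: e0; rewrite const_vf_eq0 vec2_eq0 !mulf_eq0 (negPf c0) //.
- exact: gr.
- exact: almost_saito_eq_on scaleS.
Qed.

End NaturalStructures.

(** * Structures induced by a covering *)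

Section InducedFrom.
Variable C : numClosedFieldType.
Local Notation V := 'cV[C]_2.
Local Notation poly := (mpoly 2 C).

(** The product of the discriminant and of the difference of the two fields
    vanishes identically. *)
Lemma const_vf_dense (f : 'cV[poly]_2) (a b : C) :
  (forall p : V, regG p -> eval_vf f p = vec2 a b) -> f = const_vf a b.
Proof.
pose pu : poly := mpolyX C (mnm1 ord0); pose pv : poly := mpolyX C (mnm1 ord_max).
pose dd : poly := pv * (pu ^+ 2 + (- 4) *: pv ^+ 2).
have ddE (p : V) : pval dd p = yc p * (xc p ^+ 2 - 4 * yc p ^+ 2).
  by rewrite /dd !pval_simp mulNr.
have dd0 : dd != 0.
  apply/eqP => h; have := ddE (vec2 0 1); rewrite h /pval meval0 xc_vec2 yc_vec2.
  move/eqP; rewrite (_ : _ * _ = - 4); last by ring.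
  by rewrite eq_sym oppr_eq0 pnatr_eq0.
have key (q : poly) (e : C) :
    (forall p : V, regG p -> pval q p = e) -> q = mpolyC 2 e.
  move=> H; apply/eqP; rewrite -subr_eq0; apply/eqP.
  have : dd * (q - mpolyC 2 e) = 0.
    apply: pval_eq0 => p; rewrite /pval mevalM mevalB mevalC -![meval _ _]/(pval _ p).
    rewrite ddE; have [->|y0] := eqVneq (yc p) 0; first by rewrite !mul0r.
    have [->|d0] := eqVneq (xc p ^+ 2 - 4 * yc p ^+ 2) 0; first by rewrite mulr0 mul0r.
    by rewrite H ?subrr ?mulr0.
  by move/eqP; rewrite mulf_eq0 (negPf dd0) /= => /eqP.
move=> H; apply: polycolP.
  rewrite const_vf0; apply: key => p Np.
  by have := congr1 (fun v : V => xc v) (H p Np); rewrite xc_vec2 mxE.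
rewrite const_vf1; apply: key => p Np.
by have := congr1 (fun v : V => yc v) (H p Np); rewrite yc_vec2 mxE.
Qed.

Lemma vf_span_const (a b : C) (f : 'cV[poly]_2) :
  vf_span (const_vf a b) f <-> exists c, f = const_vf (c * a) (c * b).
Proof.
by split=> -[c ->]; exists c; rewrite const_vfZ.
Qed.

Lemma vf_span_scale (c a b : C) : c != 0 ->
  vf_span (const_vf (c * a) (c * b)) = vf_span (const_vf a b).
Proof.
move=> c0; apply/seteqP; split=> f /vf_span_const [e ->]; apply/vf_span_const.
  by exists (e * c); rewrite !mulrA.
by exists (e / c); rewrite !mulrA !divfK.
Qed.

(** On both orbit spaces the structures with the given vector field are unique,
    and the projection relates the two model structures, so it relates any two
    structures whose vector fields have the same scale [c]. *)
Lemma induced_from_models (G K : set 'M[C]_2) (x z proj : 2.-tuple poly)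
    (d dz : 2.-tuple nat) px py pxx pxy pyy GamG mulG GamK mulK (a b : C) :
  let NG := regular_locus G x in let NK := regular_locus K z in
  normal_subgroup K G -> duality_group K -> basic_invariants K z dz ->
  (forall i, tnth x i = comp_mpoly z (tnth proj i)) ->
  etale_over NG (poly_map proj) px py pxx pxy pyy ->
  (forall p, NG p -> exists q, poly_map proj q = p) ->
  (forall q, NG (poly_map proj q) -> NK q) ->
  (forall c Gam mul, c != 0 ->
    natural_almost_saito G x d Gam mul (const_vf (c * a) (c * b)) <->
    eq_on NG GamG Gam /\ eq_on NG mulG mul) ->
  (forall c Gam mul, c != 0 ->
    natural_almost_saito K z dz Gam mul (const_vf c 0) <->
    eq_on NK GamK Gam /\ eq_on NK mulK mul) ->
  (forall Gam mul f, natural_almost_saito K z dz Gam mul f ->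
    exists c, c != 0 /\ f = const_vf c 0) ->
  induced_connection (poly_map proj) NG GamK GamG ->
  induced_mul (poly_map proj) NG mulK mulG ->
  (forall q, px q = vec2 a b) ->
  (forall f (al be : C), (forall p, NG p -> eval_vf f p = vec2 al be) ->
    f = const_vf al be) ->
  induced_from G x d K z dz (vf_span (const_vf a b)).
Proof.
move=> NG NK nKG dK bK xz et surj pre natG natK grK indG indM pxE dense.
have d1 := etale_differentiable et.
have d2 q u := (etale_derive2 et q u).1.
have Dproj q c : 'D_(vec2 c 0) (poly_map proj) q = vec2 (c * a) (c * b).
  rewrite (etale_derive et) pxE; apply: vec2P; rewrite !mxE /=; ring.
split=> //; exists proj; split=> // Gam mul f; split.
  move=> [/vf_span_const [c fE] nat].
  have c0 : c != 0.
    apply/eqP => c0; have [_ /eqP f0 _ _] := nat; apply: f0.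
    by rewrite fE c0 !mul0r; apply/eqP; rewrite const_vf_eq0 eqxx.
  move: nat; rewrite fE => /(natG _ _ _ c0) [GG mm].
  exists GamK, mulK, (const_vf c 0); split.
  - by apply/(natK _ _ _ c0).
  - by apply: (induced_connection_eq_on (et_open et) d1 d2 (etale_inj et)
      (etale_lift et) _ GG indG).
  - by apply: (induced_mul_eq_on (et_open et) d1 (etale_inj et)
      (etale_lift et) _ mm indM).
  - by move=> q _; rewrite !eval_const_vf Dproj.
move=> [Gam' [mul' [f' [nat ic im rel]]]].
have [c [c0 f'E]] := grK _ _ _ nat; move: nat rel; rewrite f'E => nat rel.
have [GG mm] := (natK _ _ _ c0).1 nat.
have fE : f = const_vf (c * a) (c * b).
  apply: dense => p Np; have [q qp] := surj p Np.
  by rewrite -qp -rel ?qp // eval_const_vf Dproj.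
split; first by apply/vf_span_const; exists c.
rewrite fE; apply/(natG _ _ _ c0); split.
  apply: (induced_connection_unique (et_open et) d1 d2 (etale_inj et)
    (etale_lift et) surj _ indG ic).
  by move=> q u v /pre NKq; exact: GG.
apply: (induced_mul_unique (et_open et) d1 (etale_inj et)
  (etale_lift et) surj _ indM im).
by move=> q u v /pre NKq; exact: mm.
Qed.

End InducedFrom.

(** * The models are natural structures *)

Section Injectivity.
Variable C : numFieldType.
Local Notation V := 'cV[C]_2.
Variables (r s : C) (k : nat).
Hypothesis s1 : s = 1 \/ s = -1.
Hypothesis k1 : (1 < k)%N.
Hypothesis rk : r * (2 * k)%:R = 1.
Implicit Types p w : V.

Lemma sub_mul_neq0 n : (n < 2 * k)%N -> 1 - n%:R * r != 0.
Proof.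
move=> nk; apply/eqP => h; have := congr1 (fun x => x * (2 * k)%:R) h.
rewrite mul0r mulrBl mul1r -mulrA rk mulr1 -natrB ?(ltnW nk) // => /eqP.
by rewrite pnatr_eq0 subn_eq0 leqNgt nk.
Qed.

Lemma one_sub_r : 1 - r != 0.
Proof. by have := @sub_mul_neq0 1; rewrite mul1r; apply; lia. Qed.

Lemma one_sub_2r : 1 - 2 * r != 0.
Proof. by apply: (@sub_mul_neq0 2); lia. Qed.

(** The determinant of [u |-> nabla_u e] is a nonzero constant divided by a
    factor of the discriminant, here and for the other models. *)
Lemma chrG_D_inj p w : yc p != 0 -> xc p ^+ 2 - 4 * yc p ^+ 2 != 0 ->
  chrG r p w (vec2 1 0) = 0 -> w = 0.
Proof.
move=> y0 d0; rewrite /chrG sym_bitensorE; apply: comb_inj.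
rewrite /chrG0 /chrG1 /chrG2 !vec2_simp.
move: (xc p) (yc p) y0 d0 => x y y0 d0.
rewrite (_ : _ - _ = r * (1 - r) / (x ^+ 2 - 4 * y ^+ 2)); last first.
  by field; rewrite ?y0 ?d0.
by rewrite mulf_neq0 ?invr_neq0 ?mulf_neq0 ?one_sub_r ?(r_neq0 rk).
Qed.

Lemma chrG_B_inj p w : yc p != 0 -> xc p ^+ 2 - 4 * yc p ^+ 2 != 0 ->
  chrG r p w (vec2 (- 2 * s) 1) = 0 -> w = 0.
Proof.
move=> y0 d0; rewrite /chrG sym_bitensorE; apply: comb_inj.
have [e1 e2] : xc p - 2 * s * yc p != 0 /\ xc p + 2 * s * yc p != 0.
  apply/andP; rewrite -negb_or -mulf_eq0; apply: contra d0 => /eqP h.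
  by apply/eqP; rewrite -h; case: s1 => ->; ring.
rewrite /chrG0 /chrG1 /chrG2 !vec2_simp.
move: (xc p) (yc p) y0 d0 e1 e2 => x y y0 d0 e1 e2.
rewrite (_ : _ - _ = - 2 * s * (1 - r) * (1 - 2 * r) / (y * (x - 2 * s * y))).
  have s0 : s != 0 by case: s1 => ->; rewrite ?oppr_eq0 oner_neq0.
  have m2 : - 2 != 0 :> C by rewrite oppr_eq0 pnatr_eq0.
  by do ![exact: one_sub_r | exact: one_sub_2r | exact: s0 | exact: m2 | exact: e1
    | exact: y0 | rewrite invr_neq0 // | apply: mulf_neq0].
by case: s1 e1 e2 => ->; rewrite ?mulr1 ?mulrN1 => e1 e2;
  field; rewrite ?y0 ?d0 ?e1.
Qed.

Lemma chrD_inj p w : xc p ^+ 2 - 4 * yc p ^+ (2 * k) != 0 ->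
  chrD r k p w (vec2 1 0) = 0 -> w = 0.
Proof.
move=> d0; rewrite /chrD sym_bitensorE; apply: comb_inj.
have r0 := r_neq0 rk; rewrite /chrD0 /chrD1 /chrD2 !vec2_simp.
have e0 : yc p ^+ (2 * k) = yc p * yc p ^+ (2 * k - 1).
  by rewrite -exprS; congr (_ ^+ _); lia.
move: d0; rewrite e0.
move: (xc p) (yc p) (yc p ^+ (2 * k - 1)) => x y Y d0.
rewrite (_ : _ - _ = r * (1 - r) / (x ^+ 2 - 4 * (y * Y))); last first.
  by field; rewrite ?r0 ?d0.
by rewrite mulf_neq0 ?invr_neq0 ?mulf_neq0 ?one_sub_r.
Qed.

Lemma chrB_inj p w : xc p != 0 -> s * yc p ^+ 2 - 4 * xc p != 0 ->
  chrB r s p w (vec2 1 0) = 0 -> w = 0.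
Proof.
move=> x0 d0; rewrite /chrB sym_bitensorE; apply: comb_inj.
rewrite /chrB0 /chrB1 /chrB2 !vec2_simp.
move: (xc p) (yc p) x0 d0 => x y x0 d0.
rewrite (_ : _ - _ = - 2 * (1 - r) * (1 - 2 * r) / (x * (s * y ^+ 2 - 4 * x))).
  have m2 : - 2 != 0 :> C by rewrite oppr_eq0 pnatr_eq0.
  by do ![exact: one_sub_r | exact: one_sub_2r | exact: d0 | exact: m2
    | exact: x0 | rewrite invr_neq0 // | apply: mulf_neq0].
by case: s1 d0 => ->; rewrite ?mul1r ?mulN1r => d0; field; rewrite ?x0 ?d0.
Qed.

End Injectivity.

Section ConcreteStructures.
Variable C : numClosedFieldType.
Local Notation V := 'cV[C]_2.
Local Notation poly := (mpoly 2 C).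
Local Notation pu := (mpolyX C (mnm1 ord0) : poly).
Local Notation pv := (mpolyX C (mnm1 ord_max) : poly).
Variable k : nat.
Hypothesis k1 : (1 < k)%N.
Let r : C := ((2 * k)%:R)^-1.
Implicit Types (z s c : C) (Gam mul : bitensor C 1) (f : 'cV[poly]_2).

Lemma degree_inv : r * (2 * k)%:R = 1.
Proof. by rewrite /r mulVf // pnatr_eq0 muln_eq0 -lt0n ltnW. Qed.

Let dG : 2.-tuple nat := [tuple (2 * k)%N; (2 * k)%N].
Let dD : 2.-tuple nat := [tuple (2 * k)%N; 2%N].
Let dB : 2.-tuple nat := [tuple (2 * k)%N; k].

Lemma E_deg_euler (d1 : nat) : (fun p : V => r *: E_deg [tuple (2 * k)%N; d1] p) =
  euler_field (r * d1%:R).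
Proof.
apply/funext => p; apply: vec2P; rewrite !mxE (tnth_nth 0%N) /=.
  by rewrite mulrA degree_inv mul1r.
by rewrite mulrA.
Qed.

Lemma natural_GD c Gam mul : c != 0 ->
  natural_almost_saito (mono (2 * k) 2 1) (xG C k) dG Gam mul (const_vf (c * 1) (c * 0))
  <-> eq_on (@regG C) (chrG r) Gam /\ eq_on (@regG C) (@mulD C) mul.
Proof.
rewrite -(regular_locus_G C k1); apply: natural_structure_unique.
- rewrite (regular_locus_G C k1) poly_map_xG.
  by apply: (etale_orbG k1 degree_inv (@open_regG C)).
- by move=> p _; rewrite poly_map_xG; exact: orbG_surj.
- rewrite (regular_locus_G C k1) poly_map_xG.
  by apply: (induced_orbG k1 degree_inv (@open_regG C)).
- rewrite (regular_locus_G C k1).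
  rewrite -[thead _]/(2 * k)%N -/r.
  by have := saito_GD r (@open_regG C) (@regG_neq0 C); apply.
- by rewrite -[thead _]/(2 * k)%N -/r E_deg_euler degree_inv.
- by rewrite (regular_locus_G C k1) => p w [y0 d0]; exact: (chrG_D_inj k1 degree_inv y0 d0).
- by move=> c'; apply: graded_const; left.
Qed.

Lemma natural_GB s c Gam mul : s = 1 \/ s = -1 -> c != 0 ->
  natural_almost_saito (mono (2 * k) 2 1) (xG C k) dG Gam mul
    (const_vf (c * (- 2 * s)) (c * 1))
  <-> eq_on (@regG C) (chrG r) Gam /\ eq_on (@regG C) (mulB s) mul.
Proof.
move=> s1; rewrite -(regular_locus_G C k1); apply: natural_structure_unique.
- rewrite (regular_locus_G C k1) poly_map_xG.
  by apply: (etale_orbG k1 degree_inv (@open_regG C)).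
- by move=> p _; rewrite poly_map_xG; exact: orbG_surj.
- rewrite (regular_locus_G C k1) poly_map_xG.
  by apply: (induced_orbG k1 degree_inv (@open_regG C)).
- rewrite (regular_locus_G C k1).
  rewrite -[thead _]/(2 * k)%N -/r.
  by have := saito_GB r s1 (@open_regG C) (@regG_neq0 C); apply.
- by rewrite -[thead _]/(2 * k)%N -/r E_deg_euler degree_inv.
- by rewrite (regular_locus_G C k1) => p w [y0 d0]; exact: (chrG_B_inj s1 k1 degree_inv y0 d0).
- by move=> c'; apply: graded_const; left.
Qed.

Lemma natural_D c Gam mul : c != 0 ->
  natural_almost_saito (mono (2 * k) (2 * k) 1) (xD C k) dD Gam mul (const_vf c 0)
  <-> eq_on (@regD C k) (chrD r k) Gam /\ eq_on (@regD C k) (mulK r k) mul.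
Proof.
rewrite -(regular_locus_D C k1).
rewrite -{2}[c]mulr1 -{2}(mulr0 c); apply: natural_structure_unique.
- rewrite (regular_locus_D C k1) poly_map_xD.
  by apply: (etale_orbD k1 degree_inv (@open_regD C k)).
- by move=> p _; rewrite poly_map_xD; exact: orbD_surj.
- rewrite (regular_locus_D C k1) poly_map_xD.
  by apply: (induced_orbD k1 degree_inv (@open_regD C k)).
- rewrite (regular_locus_D C k1).
  rewrite -[thead _]/(2 * k)%N -/r.
  by have := saito_D k1 degree_inv (@open_regD C k) (regD_neq0 C k1); apply.
- by rewrite -[thead _]/(2 * k)%N -/r E_deg_euler mulrC.
- by rewrite (regular_locus_D C k1) => p w; exact: (chrD_inj k1 degree_inv).
- by move=> c'; apply: graded_const; right; rewrite mulr0.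
Qed.

Lemma natural_B z s c Gam mul : z != 0 -> z ^+ k = s -> s = 1 \/ s = -1 -> c != 0 ->
  natural_almost_saito (mono k 1 z) (xB k s) dB Gam mul (const_vf c 0)
  <-> eq_on (regB s) (chrB r s) Gam /\ eq_on (regB s) (mulM s) mul.
Proof.
move=> z0 zs s1; rewrite -(regular_locus_B k1 z0 zs s1).
rewrite -{2}[c]mulr1 -{2}(mulr0 c); apply: natural_structure_unique.
- rewrite (regular_locus_B k1 z0 zs s1) // poly_map_xB.
  by have := etale_orbB s1 k1 degree_inv (@open_regB C s); apply.
- by move=> p _; rewrite poly_map_xB; exact: orbB_surj zs.
- rewrite (regular_locus_B k1 z0 zs s1) // poly_map_xB.
  by have := induced_orbB s1 k1 degree_inv (@open_regB C s); apply.
- rewrite (regular_locus_B k1 z0 zs s1).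
  rewrite -[thead _]/(2 * k)%N -/r.
  by have := saito_B r s1 (@open_regB C s) (regB_neq0 s); apply.
- rewrite -[thead _]/(2 * k)%N -/r E_deg_euler; congr euler_field; rewrite /r natrM invfM mulfVK //.
  by rewrite pnatr_eq0 -lt0n ltnW.
- rewrite (regular_locus_B k1 z0 zs s1) => p w [x0 d0].
  exact: (chrB_inj s1 k1 degree_inv x0 d0).
- by move=> c'; apply: graded_const; right; rewrite mulr0.
Qed.

Lemma natural_field_const (K : set 'M[C]_2) (x : 2.-tuple poly) d1 Gam mul f :
  (0 < d1 < 2 * k)%N ->
  natural_almost_saito K x [tuple (2 * k)%N; d1] Gam mul f ->
  exists c, c != 0 /\ f = const_vf c 0.
Proof.
move=> /andP[d10 d1k] [_ f0 gr _].
have [|a [b [fE [h|b0]]]] := graded_const_inv _ gr.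
- by rewrite d10 ltnW.
- by rewrite h ltnn in d1k.
exists a; rewrite fE b0; split=> //; apply: contraNneq f0 => a0.
by rewrite fE a0 b0 const_vf_eq0 eqxx.
Qed.

End ConcreteStructures.

(** * The three coverings *)

Section ConcreteInduced.
Variable C : numClosedFieldType.
Local Notation V := 'cV[C]_2.
Local Notation poly := (mpoly 2 C).
Local Notation pu := (mpolyX C (mnm1 ord0) : poly).
Local Notation pv := (mpolyX C (mnm1 ord_max) : poly).
Variable k : nat.
Hypothesis k1 : (1 < k)%N.

Let k0 : (0 < k)%N. Proof. exact: ltnW. Qed.

Lemma poly_map_projD : poly_map [tuple pu; pv ^+ k] = projD k :> (V -> V).
Proof. by apply/funext => v; rewrite poly_map2 !pval_simp. Qed.

Lemma poly_map_projB (s : C) :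
  poly_map [tuple pv ^+ 2 + (- 2 * s) *: pu; pu] = projB s :> (V -> V).
Proof.
by apply/funext => v; rewrite poly_map2 !pval_simp !mulNr.
Qed.

Lemma xG_projD i : tnth (xG C k) i = comp_mpoly (xD C k) (tnth [tuple pu; pv ^+ k] i).
Proof.
apply: pval_inj => v; rewrite pval_comp poly_map_xD.
case: (ord2P i) => ->; rewrite !(tnth_nth 0) /= !pval_simp ?xc_vec2 ?yc_vec2 //.
by rewrite exprMn.
Qed.

Lemma xG_projB (s : C) i : s = 1 \/ s = -1 ->
  tnth (xG C k) i =
  comp_mpoly (xB k s) (tnth [tuple pv ^+ 2 + (- 2 * s) *: pu; pu] i).
Proof.
move=> s1; apply: pval_inj => v; rewrite pval_comp poly_map_xB.
case: (ord2P i) => ->; rewrite !(tnth_nth 0) /= !pval_simp ?xc_vec2 ?yc_vec2 //.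
by rewrite mulnC !exprM; case: s1 => ->; ring.
Qed.

Lemma induced_from_D :
  induced_from (mono (2 * k) 2 1) (xG C k) [tuple (2 * k)%N; (2 * k)%N]
    (mono (2 * k) (2 * k) 1) (xD C k) [tuple (2 * k)%N; 2%N]
    (vf_span (const_vf 1 0)).
Proof.
have k20 : (0 < 2 * k)%N by rewrite muln_gt0.
have k22 : (2 < 2 * k)%N by lia.
have rk := degree_inv C k1; have [w pw] := prim_root_exists C k20.
have [indG indM] := induced_projD k1 rk (@open_regG C) (fun p Np => Np).
have et := etale_projD k1 rk (@open_regG C) (fun p Np => Np.1).
apply: (induced_from_models (proj := [tuple pu; pv ^+ k])
  (mono_normal_D C k0) (duality_D k22 pw) (basic_invariants_D C k1) xG_projD);
  rewrite ?regular_locus_G ?regular_locus_D ?poly_map_projD //.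
- exact: et.
- move=> p _; exists (vec2 (xc p) (k.-root (yc p))).
  by apply: vec2P; rewrite !(xc_vec2, yc_vec2) ?rootCK.
- move=> q [_]; rewrite /regD /= !xc_vec2 !yc_vec2.
  by rewrite [(2 * k)%N]mulnC exprM.
- exact: natural_GD.
- exact: natural_D.
- by move=> Gam mul f; apply: natural_field_const => //; lia.
- exact: indG.
- exact: indM.
- by move=> f al be; exact: const_vf_dense.
Qed.

Lemma induced_from_B (z s : C) : z ^+ k = s -> s = 1 \/ s = -1 ->
  induced_from (mono (2 * k) 2 1) (xG C k) [tuple (2 * k)%N; (2 * k)%N]
    (mono k 1 z) (xB k s) [tuple (2 * k)%N; k]
    (vf_span (const_vf (- 2 * s) 1)).
Proof.
move=> zs s1; have s0 : s != 0 by case: s1 => ->; rewrite ?oppr_eq0 oner_neq0.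
have z0 : z != 0.
  by apply: contraNneq s0 => z0; rewrite -zs z0 expr0n eqn0Ngt k0.
have rk := degree_inv C k1; have [w pw] := prim_root_exists C k0.
have [indG indM] := induced_projB ((2 * k)%:R)^-1 s1 (@open_regG C) (fun p Np => Np).
have Ny (p : V) : regG p -> xc p + 2 * s * yc p != 0.
  move=> [_ d0]; apply: contraNneq d0 => h; apply/eqP.
  transitivity ((xc p + 2 * s * yc p) * (xc p - 2 * s * yc p)).
    by case: s1 => ->; ring.
  by rewrite h mul0r.
have et := etale_projB (@open_regG C) Ny.
apply: (induced_from_models (proj := [tuple pv ^+ 2 + (- 2 * s) *: pu; pu])
  (mono_normal_B k0 zs s1) (duality_B k1 pw z0) (basic_invariants_B k1 z0 zs)
  (fun i => xG_projB i s1));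
  rewrite ?regular_locus_G ?(regular_locus_B k1 z0 zs s1) ?poly_map_projB //.
- exact: et.
- move=> p _; exists (vec2 (yc p) (sqrtC (xc p + 2 * s * yc p))).
  by apply: vec2P; rewrite !(xc_vec2, yc_vec2) ?sqrtCK ?addrK.
- move=> q []; rewrite /regB /= !xc_vec2 !yc_vec2 => x0 d0; split=> //.
  apply: contraNneq d0 => h; apply/eqP.
  transitivity (s * yc q ^+ 2 * (s * yc q ^+ 2 - 4 * xc q)); last by rewrite h mulr0.
  by case: s1 => ->; ring.
- by move=> c Gam mul; exact: natural_GB.
- by move=> c Gam mul; exact: natural_B.
- by move=> Gam mul f; apply: natural_field_const => //; lia.
- exact: indG.
- exact: indM.
- by move=> f al be; exact: const_vf_dense.
Qed.

End ConcreteInduced.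

(** * Classification *)

Section NaturalFields.
Variable C : numClosedFieldType.
Local Notation V := 'cV[C]_2.
Local Notation poly := (mpoly 2 C).
Variable k : nat.
Hypothesis k1 : (1 < k)%N.

(** Necessity transfers to any natural structure because its connection agrees
    with [chrG] on the regular locus. *)
Lemma natural_field_lines (a b : C) : (a != 0) || (b != 0) ->
  (exists Gam mul, natural_almost_saito (mono (2 * k) 2 1) (xG C k)
    [tuple (2 * k)%N; (2 * k)%N] Gam mul (const_vf a b)) <->
  [\/ b = 0, a = - 2 * b | a = 2 * b].
Proof.
move=> ab0; have rk := degree_inv C k1; split=> [[Gam [mul [ind e0 gr S]]]|H].
  have ind0 := induced_orbG k1 rk (@open_regG C) (fun p Np => Np).
  have et := etale_orbG k1 rk (@open_regG C) (fun p Np => Np).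
  move: ind S; rewrite regular_locus_G // poly_map_xG => ind.
  have surj (p : V) : regG p -> exists q, orbG k q = p by move=> _; exact: orbG_surj.
  have GG : eq_on (@regG C) (chrG ((2 * k)%:R)^-1) Gam.
    by apply: (induced_connection_unique (et_open et) (etale_differentiable et)
      (fun q u => (etale_derive2 et q u).1) (etale_inj et) (etale_lift et) surj _
      ind0 ind).
  rewrite -[thead _]/(2 * k)%N (E_deg_euler C k1) rk eval_const_vf => S.
  have GG' : eq_on (@regG C) Gam (chrG ((2 * k)%:R)^-1).
    by move=> p u v Np; rewrite GG.
  have mm : eq_on (@regG C) mul mul by [].
  have S' := almost_saito_eq_on GG' mm S.
  have [h|h|h] := necessity (r_neq0 rk) (one_sub_r k1 rk) (one_sub_2r k1 rk)
    (fun p => iff_refl _) S'.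
  - by constructor 1.
  - by constructor 3.
  - by constructor 2.
have eqG : eq_on (@regG C) (chrG ((2 * k)%:R)^-1) (chrG ((2 * k)%:R)^-1) by [].
have [b0|b0] := eqVneq b 0.
  have a0 : a != 0 by move: ab0; rewrite b0 eqxx orbF.
  exists (chrG ((2 * k)%:R)^-1), (@mulD C).
  have -> : const_vf a b = const_vf (a * 1) (a * 0) by rewrite b0 mulr0 mulr1.
  by apply/(natural_GD k1 _ _ a0).
have [s s1 aE] : exists2 s : C, s = 1 \/ s = -1 & a = b * (- 2 * s).
  case: H b0 => [->|->|->] b0; first by rewrite eqxx in b0.
    by exists 1; [left|ring].
  by exists (-1); [right|ring].
exists (chrG ((2 * k)%:R)^-1), (mulB s).
have -> : const_vf a b = const_vf (b * (- 2 * s)) (b * 1) by rewrite -aE mulr1.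
by apply/(natural_GB k1 _ _ s1 b0).
Qed.

Lemma lowest_degree_fields (e : 'cV[poly]_2) :
  graded_vf [tuple (2 * k)%N; (2 * k)%N] (- (2 * k)%:Z) e <->
  exists a b, e = const_vf a b.
Proof.
split=> [gr|[a [b ->]]]; last by apply: graded_const; left.
have [|a [b [eE _]]] := graded_const_inv _ gr; last by exists a, b.
by rewrite leqnn andbT muln_gt0 (ltnW k1).
Qed.

End NaturalFields.

Lemma expiX (R : realType) (t : R) n : expi t ^+ n = expi (n%:R * t).
Proof.
elim: n => [|n IHn]; first by rewrite expr0 mul0r /expi cos0 sin0.
rewrite exprS IHn -natr1 mulrDl mul1r [_ + t]addrC /expi cosD sinD.
by apply/eqP; rewrite eq_complex /=; apply/andP; split=> //; apply/eqP; ring.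
Qed.

Lemma expi_half_turn (R : realType) k : (0 < k)%N ->
  expi (2 * pi / (2 * k)%:R : R) ^+ k = -1.
Proof.
move=> k0; rewrite expiX (_ : _ * _ = pi); last first.
  by rewrite natrM; field; rewrite ?pnatr_eq0 -?lt0n ?k0.
by rewrite /expi cospi sinpi; apply/eqP; rewrite eq_complex /= oppr0 !eqxx.
Qed.

Theorem mainTheorem7 (R : realType) (k : nat) (hk : (1 < k)%N) :
  let u : mpoly 2 R[i] := mpolyX R[i] (mnm1 ord0) in
  let v : mpoly 2 R[i] := mpolyX R[i] (mnm1 ord_max) in
  let G : set 'M[R[i]]_2 := Gmpn R[i] (2 * k) 2 2 in
  let x := [tuple u ^+ (2 * k) + v ^+ (2 * k); u ^+ k * v ^+ k] in
  let d := [tuple (2 * k)%N; (2 * k)%N] in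
  let X : set 'cV[mpoly 2 R[i]]_2 := graded_vf d (- (thead d)%:Z) in
  let dx : 'cV[mpoly 2 R[i]]_2 := delta_mx ord0 0 in
  let dy : 'cV[mpoly 2 R[i]]_2 := delta_mx ord_max 0 in
  let tau : 'M[R[i]]_2 :=
    diag_mx (\row_i (if i == ord0 then expi (2 * pi / (2 * k)%:R : R) else 1)) in
  let K1 : set 'M[R[i]]_2 := Gmpn R[i] (2 * k) (2 * k) 2 in
  let K2 : set 'M[R[i]]_2 := Gmpn R[i] k 1 2 in
  let K3 : set 'M[R[i]]_2 := [set invmx tau *m A *m tau | A in K2] in
  [/\ basic_invariants G x d,
      (* (dx, dy) is a basis of X *)
      forall e, X e <->
        exists! ab : R[i] * R[i], e = mpolyC 2 ab.1 *: dx + mpolyC 2 ab.2 *: dy &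
      exists l1 l2 l3 : set 'cV[mpoly 2 R[i]]_2,
      [/\ [/\ is_line_in X l1, is_line_in X l2 & is_line_in X l3],
          [/\ l1 <> l2, l1 <> l3 & l2 <> l3],
          forall e, X e -> e != 0 ->
            ((exists Gam mul, natural_almost_saito G x d Gam mul e) <->
             (l1 `|` l2 `|` l3) e),
          [/\ l1 = vf_span dx,
              l2 = vf_span (- 2 *: dx + dy) &
              l3 = vf_span (- 2 *: dx - dy)] &
          [/\ induced_from G x d K1
                [tuple u ^+ (2 * k) + v ^+ (2 * k); u * v]
                [tuple (2 * k)%N; 2%N] l1,
              induced_from G x d K2
                [tuple u ^+ k * v ^+ k; u ^+ k + v ^+ k]
                [tuple (2 * k)%N; k] l2 &
              induced_from G x d K3
                [tuple u ^+ k * v ^+ k; v ^+ k - u ^+ k]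
                [tuple (2 * k)%N; k] l3]]].
Proof.
move=> u v G x d X dx dy tau K1 K2 K3.
have k0 : (0 < k)%N by exact: ltnW.
pose z : R[i] := expi (2 * pi / (2 * k)%:R : R).
have zk : z ^+ k = -1 by exact: expi_half_turn.
have z0 : z != 0.
  apply/eqP => h; move/eqP: zk; rewrite h expr0n eqn0Ngt k0.
  by rewrite eq_sym oppr_eq0 oner_eq0.
have GE : G = mono (2 * k) 2 1 by exact: Gmpn_mono.
have K1E : K1 = mono (2 * k) (2 * k) 1 by exact: Gmpn_mono.
have K2E : K2 = mono k 1 1 by exact: Gmpn_mono.
have K3E : K3 = mono k 1 z by rewrite /K3 K2E; exact: conj_mono.
have xE : x = xG _ k by [].
have xB1 : [tuple u ^+ k * v ^+ k; u ^+ k + v ^+ k] = xB k 1.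
  rewrite /xB scale1r [v ^+ k + _]addrC; reflexivity.
have xBm1 : [tuple u ^+ k * v ^+ k; v ^+ k - u ^+ k] = xB k (-1).
  rewrite /xB scaleN1r; reflexivity.
have m2E : mpolyC 2 (-2) = -2 :> mpoly 2 R[i] by rewrite mpolyCN rmorph_nat.
have l1E : vf_span dx = vf_span (const_vf 1 0).
  by rewrite /const_vf scale1r mpolyC0 scale0r addr0.
have l2E : - 2 *: dx + dy = const_vf (- 2 * 1) 1.
  by rewrite mulr1 /const_vf m2E scale1r.
have l3E : vf_span (- 2 *: dx - dy) = vf_span (const_vf (- 2 * -1) 1).
  have m10 : -1 != 0 :> R[i] by rewrite oppr_eq0 oner_neq0.
  rewrite -(vf_span_scale _ _ m10) (_ : -1 * (- 2 * -1) = - 2); last by ring.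
  rewrite mulr1; congr vf_span.
  by rewrite /const_vf m2E; congr (_ + _); rewrite mpolyCN scaleN1r.
split; first by rewrite GE xE; exact: basic_invariants_G.
  move=> e; split=> [/(lowest_degree_fields hk) [a [b eE]]|[[a b] [/= eE _]]].
    exists (a, b); split; first exact: eE.
    move=> [a' b'] eE'; have h : const_vf a b = const_vf a' b'.
      exact: (etrans (esym eE) eE').
    by have [-> ->] := const_vf_inj h.
  by apply/(lowest_degree_fields hk); exists a, b.
have nat_iff (a b : R[i]) : const_vf a b != 0 ->
    (exists Gam mul, natural_almost_saito G x d Gam mul (const_vf a b)) <->
    [\/ b = 0, a = - 2 * b | a = 2 * b].
  rewrite const_vf_eq0 negb_and => ab0; rewrite GE xE.
  exact: (natural_field_lines hk ab0).
have line (a b : R[i]) : (a != 0) || (b != 0) ->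
    is_line_in X (vf_span (const_vf a b)).
  move=> ab0; exists (const_vf a b); split; last exact: erefl.
    by apply/(lowest_degree_fields hk); exists a, b; reflexivity.
  by rewrite const_vf_eq0 negb_and.
have m20 : 2 != 0 :> R[i] by rewrite pnatr_eq0.
have span_self (a b : R[i]) : vf_span (const_vf a b) (const_vf a b).
  by apply/vf_span_const; exists 1; rewrite [1 * a]mul1r [1 * b]mul1r; reflexivity.
have spanP (a b a' b' : R[i]) : vf_span (const_vf a b) (const_vf a' b') <->
    exists c, a' = c * a /\ b' = c * b.
  split=> [/vf_span_const [c h]|[c [-> ->]]].
    by exists c; exact: const_vf_inj h.
  by apply/vf_span_const; exists c; reflexivity.
exists (vf_span dx), (vf_span (- 2 *: dx + dy)), (vf_span (- 2 *: dx - dy)).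
rewrite l1E l2E l3E; split.
- by split; apply: line; rewrite ?oner_neq0 ?orbT.
- split=> h.
  + have := span_self 1 0; rewrite h => /spanP [c [h1 h2]].
    have c0 : c = 0 by rewrite -[c]mulr1 -h2.
    by move/eqP: h1; rewrite c0 mul0r oner_eq0.
  + have := span_self 1 0; rewrite h => /spanP [c [h1 h2]].
    have c0 : c = 0 by rewrite -[c]mulr1 -h2.
    by move/eqP: h1; rewrite c0 mul0r oner_eq0.
  have := span_self (- 2 * 1) 1; rewrite h => /spanP [c [h1 h2]].
  have c1 : c = 1 by rewrite -[c]mulr1 -h2.
  move/eqP: h1; rewrite c1 mul1r mulr1 mulrN1 opprK.
  by rewrite -subr_eq0 -opprD oppr_eq0 -natrD pnatr_eq0.
- move=> e /(lowest_degree_fields hk) [a [b ->]] e0.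
  apply: (iff_trans (nat_iff _ _ e0)); split.
  + case=> [->|->|->]; [left; left|left; right|right]; apply/spanP.
    * by exists a; split; [rewrite mulr1|rewrite mulr0]; reflexivity.
    * by exists b; split; [rewrite !mulr1 mulrC|rewrite mulr1]; reflexivity.
    * by exists b; split; [rewrite mulrNN mulr1 mulrC|rewrite mulr1]; reflexivity.
  + move=> [[]|] /spanP [c [-> ->]].
    * by constructor 1; rewrite mulr0.
    * by constructor 2; rewrite !mulr1 mulrC.
    * by constructor 3; rewrite mulrNN !mulr1 mulrC.
- by split; reflexivity.
- rewrite GE K1E K2E K3E xB1 xBm1; split.
  + exact: (induced_from_D _ hk).
  + by apply: (induced_from_B hk); [exact: expr1n|left].
  + by apply: (induced_from_B hk zk); right.
Qed.
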